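(* There is a polynomial-time reduction from r-$\nu$PN coverability to cEOS coverability.
   Context: $\nu$PN: fix disjoint infinite sets $\mathcal X$ (standard variables) and $\Upsilon$ (fresh variables), $Vars=\mathcal X\cup\Upsilon$. A $\nu$PN is $(P,T,F)$ with finite $P,T$ and $F:(P\times T)\cup(T\times P)\to Vars^{\oplus}$ (finite multisets of variables) such that for each $t$: $\Upsilon\cap{\tt pre}(t)=\emptyset$ and ${\tt post}(t)\setminus\Upsilon\subseteq{\tt pre}(t)$, where ${\tt pre}(t)=\bigcup_p\mathrm{supp}(F(p,t))$, ${\tt post}(t)=\bigcup_p\mathrm{supp}(F(t,p))$. Let $\mathrm{Var}(t)={\tt pre}(t)\cup{\tt post}(t)$, $\mathcal X(t)=\mathrm{Var}(t)\cap\mathcal X$, $\Upsilon(t)=\mathrm{Var}(t)\cap\Upsilon$, $F_x(p,t)=F(p,t)(x)$, $F_x(t,p)=F(t,p)(x)$, and $F_x(P,t),F_x(t,P)\in\mathbb N^{P}$ the corresponding vectors. A configuration is a finite multiset of vectors in $\mathbb N^P$ (tuples). $t$ is fireable on $M=\{\!\{m_1,\dots,m_k\}\!\}$ with mode $e$, an injective map from $\mathcal X(t)$ to $\{1,\dots,k\}$, if $F_x(P,t)\le m_{e(x)}$ for all $x\in\mathcal X(t)$; then $M=M''+\sum_{x\in\mathcal X(t)}\{\!\{m_{e(x)}\}\!\}$ and the result is $M'=M''+\sum_{\nu\in\Upsilon(t)}\{\!\{F_\nu(t,P)\}\!\}+\sum_{x\in\mathcal X(t)}\{\!\{m_{e(x)}-F_x(P,t)+F_x(t,P)\}\!\}$.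 r-$\nu$PN: a tuple $N=(P,T,F,T',F',R')$ where $(P,T,F)$ and $(P,T',F')$ are $\nu$PNs with $T\cap T'=\emptyset$; $R':T'\to P\times P$, written $R'(t')=(r_1^{t'},r_2^{t'})$; and for each $t'\in T'$, $\mathrm{Var}(t')=\{x_0,x_1,x_2\}$ and there are four distinct places $p_2,p_3,p_4,p_5\in P\setminus\{r_1^{t'},r_2^{t'}\}$ such that $F'_{x_0}(\cdot,t')=\delta_{p_2}$, $F'_{x_1}(\cdot,t')=F'_{x_1}(t',\cdot)=\delta_{p_3}$, $F'_{x_2}(\cdot,t')=F'_{x_2}(t',\cdot)=\delta_{p_4}$, $F'_{x_0}(t',\cdot)=\delta_{p_5}$ (here $\delta_p$ is the unit vector at $p$). Configurations are those of $(P,T,F)$. Transitions in $T$ fire as in $(P,T,F)$. A $t'\in T'$ is enabled on $M$ with mode $e'$ if it is in $(P,T',F')$; firing first yields $M''$ as in $(P,T',F')$ and then $M'=M''-\{\!\{m_{e'(x_1)},m_{e'(x_2)}\}\!\}+\{\!\{m_{e'(x_1)}-m_{e'(x_1)}(r_1^{t'})\delta_{r_1^{t'}}\}\!\}+\{\!\{m_{e'(x_2)}+m_{e'(x_1)}(r_1^{t'})\delta_{r_2^{t'}}\}\!\}$ (transfer of all tokens on $r_1^{t'}$ of the tuple bound to $x_1$ to place $r_2^{t'}$ of the tuple bound to $x_2$), where $m_{e'(x_i)}$ denotes the updated tuples. r-$\nu$PN coverability: given $N$, initial configuration $M_0$, target $M_1$, decide whether some configuration $M$ reachable from $M_0$ satisfies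 $M_1\le M$, where $M\le M'$ iff there is an injection $\iota$ from the tuples of $M$ to those of $M'$ (as multisets) with $m\le\iota(m)$ componentwise. EOS/cEOS and cEOS coverability: A PN is $(P,T,F)$ with $F:(P\times T)\cup(T\times P)\to\mathbb N$, ${\tt pre}_N(t)(p)=F(p,t)$, ${\tt post}_N(t)(p)=F(t,p)$, standard firing; $\blacksquare=(\emptyset,\emptyset,\emptyset)$ with unique marking $\varepsilon$. An EOS is $(\hat N,\mathcal N,d,\Theta)$: system PN $\hat N=(\hat P,\hat T,\hat F)$ containing idle transitions $id_p$ ($p\in\hat P$) that consume and produce one token on $p$ only; finite set $\mathcal N\ni\blacksquare$ of object PNs, all nets pairwise disjoint; typing $d:\hat P\to\mathcal N$; finite event set $\Theta$ of pairs $(\hat\tau,\theta)$, $\hat\tau\in\hat T$, $\theta(N)$ a finite multiset of transitions of $N$ for each $N\in\mathcal N$, with $\theta(d(p))\ne\emptyset$ if $\hat\tau=id_p$. Configurations are finite multisets of nested tokens $(\hat p,M)$, $M$ a marking of $d(\hat p)$. With $\Pi^1(\sum_i(\hat p_i,M_i))=\sum_i\hat p_i$, $\Pi^2_N(\sum_i(\hat p_i,M_i))=\sum_{d(\hat p_i)=N}M_i$, ${\tt pre}_N(\theta(N))$ the sum of the presets of the transitions in $\theta(N)$ (similarly ${\tt post}$): $(\hat\tau,\theta)$ fires on $\mu$ with mode $(\lambda,\rho)$ iff $\lambda\sqsubseteq\mu$, $\Pi^1(\lambda)={\tt pre}_{\hat N}(\hat\tau)$, $\Pi^1(\rho)={\tt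 post}_{\hat N}(\hat\tau)$, and for each $N$, $\Pi^2_N(\lambda)\ge{\tt pre}_N(\theta(N))$ and $\Pi^2_N(\rho)=\Pi^2_N(\lambda)-{\tt pre}_N(\theta(N))+{\tt post}_N(\theta(N))$, giving $\mu-\lambda+\rho$. $\mu\le_f\mu'$ iff $\mu'$ arises from $\mu$ by adding tokens inside nested tokens and/or adding nested tokens. A cEOS is an EOS with $d(\mathrm{supp}\,{\tt pre}_{\hat N}(\hat t))\subseteq d(\mathrm{supp}\,{\tt post}_{\hat N}(\hat t))$ for all $\hat t$. cEOS coverability: given a cEOS, $M_0$, $M_t$, decide whether some $M_1$ reachable from $M_0$ has $M_t\le_f M_1$. *)

(* Defs.v *)
(* MathComp world, with finmap for finite sets and multisets. *)
From HB Require Import structures.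
From mathcomp Require Import all_boot all_algebra.
From mathcomp Require Import finmap multiset.
From Stdlib Require Import Relations.
From Stdlib Require List.

Set Implicit Arguments.
Unset Strict Implicit.
Unset Printing Implicit Defensive.

Local Open Scope mset_scope.
Local Open Scope nat_scope.

(** * Vectors *)

Definition vec (P : finType) : choiceType := {ffun P -> nat}.

Definition vle (P : finType) (m m' : vec P) : Prop := forall p, m p <= m' p.
Definition vadd (P : finType) (m m' : vec P) : vec P := [ffun p => m p + m' p].
(* Truncated; only ever used when [vle m' m]. *)
Definition vsub (P : finType) (m m' : vec P) : vec P := [ffun p => m p - m' p].
Definition unitv (P : finType) (p0 : P) : vec P := [ffun p => (p == p0) : nat].
Definition vscale (P : finType) (n : nat) (m : vec P) : vec P :=
  [ffun p => n * m p].

(** * nu-Petri nets *)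

(* [inl n] are the standard variables, [inr n] the fresh ones. *)
Definition var : choiceType := (nat + nat)%type.
Definition is_fresh (v : var) : bool := if v is inr _ then true else false.

Section NuPN.
Variables P T : finType.

Section Flow.
Variables (F_in : P -> T -> {mset var}) (F_out : T -> P -> {mset var}).

Definition pre_vars (t : T) : {fset var} :=
  (\bigcup_(p <- enum P) finsupp (F_in p t))%fset.
Definition post_vars (t : T) : {fset var} :=
  (\bigcup_(p <- enum P) finsupp (F_out t p))%fset.
End Flow.

Record nuPN := NuPN {
  nu_in : P -> T -> {mset var};
  nu_out : T -> P -> {mset var};
  nu_pre_standard : forall t v, v \in pre_vars nu_in t -> ~~ is_fresh v;
  nu_post_bound : forall t v, v \in post_vars nu_out t -> ~~ is_fresh v ->
    v \in pre_vars nu_in t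
}.

Variable N : nuPN.

Definition nu_vars (t : T) : {fset var} :=
  (pre_vars (nu_in N) t `|` post_vars (nu_out N) t)%fset.
Definition std_vars (t : T) : {fset var} :=
  [fset v in nu_vars t | ~~ is_fresh v]%fset.
Definition fresh_vars (t : T) : {fset var} :=
  [fset v in nu_vars t | is_fresh v]%fset.

Definition nu_in_vec (x : var) (t : T) : vec P := [ffun p => nu_in N p t x].
Definition nu_out_vec (x : var) (t : T) : vec P := [ffun p => nu_out N t p x].

Definition config := {mset vec P}.

Definition nu_updated (t : T) (k : nat) (ms : k.-tuple (vec P))
    (e : std_vars t -> 'I_k) (x : std_vars t) : vec P :=
  vadd (vsub (tnth ms (e x)) (nu_in_vec (val x) t)) (nu_out_vec (val x) t).

Definition nu_enabled (t : T) (k : nat) (ms : k.-tuple (vec P))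
    (e : std_vars t -> 'I_k) : Prop :=
  injective e /\ forall x, vle (nu_in_vec (val x) t) (tnth ms (e x)).

(* [ms] enumerates the configuration [M] as m_1, ..., m_k. *)
Definition nu_fires (t : T) (k : nat) (ms : k.-tuple (vec P))
    (e : std_vars t -> 'I_k) (M M' : config) : Prop :=
  [/\ M = seq_mset ms, nu_enabled ms e &
    exists2 M'' : config,
      M = M'' `+` \big[msetD/mset0]_(x : std_vars t) [mset tnth ms (e x)] &
      M' = M'' `+`
        \big[msetD/mset0]_(v : fresh_vars t) [mset nu_out_vec (val v) t] `+`
        \big[msetD/mset0]_(x : std_vars t) [mset nu_updated ms e x]].

End NuPN.

Definition config_le (P : finType) (M M' : config P) : Prop :=
  exists (k k' : nat) (ms : k.-tuple (vec P)) (ms' : k'.-tuple (vec P))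
         (iota : 'I_k -> 'I_k'),
    [/\ M = seq_mset ms, M' = seq_mset ms', injective iota &
        forall i, vle (tnth ms i) (tnth ms' (iota i))].

(** * r-nu-PNs *)

(* The naming [rx0], [rx1], [rx2] of the three variables of a transfer
   transition is part of the net: the structural conditions are symmetric in
   [rx1] and [rx2], whereas the transfer goes from the tuple bound to [rx1] to
   the tuple bound to [rx2]. *)
Record rnuPN := RnuPN {
  r_place : finType;
  r_trans : finType;
  r_trans' : finType;
  r_net : nuPN r_place r_trans;
  r_net' : nuPN r_place r_trans';
  r_transfer : r_trans' -> r_place * r_place;
  rx0 : r_trans' -> var;
  rx1 : r_trans' -> var;
  rx2 : r_trans' -> var;
  r_vars : forall t, nu_vars r_net' t = [fset rx0 t; rx1 t; rx2 t]%fset;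
  r_shape : forall t, exists p2 p3 p4 p5 : r_place,
    [/\ uniq [:: p2; p3; p4; p5],
        forall r, r \in [:: (r_transfer t).1; (r_transfer t).2] ->
          r \notin [:: p2; p3; p4; p5],
        nu_in_vec r_net' (rx0 t) t = unitv p2 /\
          nu_out_vec r_net' (rx0 t) t = unitv p5,
        nu_in_vec r_net' (rx1 t) t = unitv p3 /\
          nu_out_vec r_net' (rx1 t) t = unitv p3 &
        nu_in_vec r_net' (rx2 t) t = unitv p4 /\
          nu_out_vec r_net' (rx2 t) t = unitv p4]
}.

Definition transfer_fires (N : rnuPN) (t : r_trans' N)
    (M M' : config (r_place N)) : Prop :=
  exists (k : nat) (ms : k.-tuple (vec (r_place N)))
         (e : std_vars (r_net' N) t -> 'I_k) (M'' : config (r_place N))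
         (y1 y2 : std_vars (r_net' N) t),
    let r1 := (r_transfer t).1 in
    let r2 := (r_transfer t).2 in
    let m1 := nu_updated ms e y1 in
    let m2 := nu_updated ms e y2 in
    [/\ nu_fires ms e M M'', val y1 = rx1 t, val y2 = rx2 t &
        M' = (M'' `\` ([mset m1] `+` [mset m2]))
             `+` [mset vsub m1 (vscale (m1 r1) (unitv r1))]
             `+` [mset vadd m2 (vscale (m1 r1) (unitv r2))]].

Definition r_step (N : rnuPN) (M M' : config (r_place N)) : Prop :=
  (exists (t : r_trans N) (k : nat) (ms : k.-tuple (vec (r_place N)))
          (e : std_vars (r_net N) t -> 'I_k), nu_fires ms e M M')
  \/ (exists t : r_trans' N, transfer_fires t M M').

Record rnuPN_instance := RnuPNInstance {
  ri_net : rnuPN;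
  ri_init : config (r_place ri_net);
  ri_target : config (r_place ri_net)
}.

Definition rnuPN_coverable (I : rnuPN_instance) : Prop :=
  exists M : config (r_place (ri_net I)),
    clos_refl_trans _ (@r_step (ri_net I)) (ri_init I) M /\
    config_le (ri_target I) M.

(** * Petri nets and elementary object systems *)

Record PN := MkPN {
  place : finType;
  trans : finType;
  arc_in : place -> trans -> nat;
  arc_out : trans -> place -> nat
}.

Definition pn_pre (N : PN) (t : trans N) : vec (place N) :=
  [ffun p => arc_in p t].
Definition pn_post (N : PN) (t : trans N) : vec (place N) :=
  [ffun p => arc_out t p].

Definition black : PN :=
  MkPN (fun (p : void) (_ : void) => of_void nat p)
       (fun (_ : void) (p : void) => of_void nat p).

(* The object nets are the family indexed by [option K], [None] being the empty
   net: a family of finite types is disjoint by construction, and [nets_nonempty]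
   makes the empty net occur only once, as in a set of nets. *)
Definition obj_family (K : finType) (nets : K -> PN) (k : option K) : PN :=
  if k is Some k' then nets k' else black.

(* A finite multiset of transitions is given by its multiplicities. *)
Definition event_of (S : PN) (K : finType) (nets : K -> PN) : choiceType :=
  (trans S * {dffun forall k : option K, {ffun trans (obj_family nets k) -> nat}})%type.

Record EOS := MkEOS {
  sys : PN;
  obj_idx : finType;
  obj_nets : obj_idx -> PN;
  nets_nonempty : forall k, 0 < #|place (obj_nets k)| + #|trans (obj_nets k)|;
  typing : place sys -> option obj_idx;
  idle : place sys -> trans sys;
  idle_pre : forall p, pn_pre (idle p) = unitv p;
  idle_post : forall p, pn_post (idle p) = unitv p;
  events : {fset event_of sys obj_nets};
  events_idle : forall (ev : event_of sys obj_nets) (p : place sys),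
    ev \in events -> ev.1 = idle p -> exists u, 0 < ev.2 (typing p) u
}.

Section EOSSemantics.
Variable E : EOS.

Definition onet (k : option (obj_idx E)) : PN := obj_family (@obj_nets E) k.

Definition event : choiceType := event_of (sys E) (@obj_nets E).

Definition token_marking (p : place (sys E)) : choiceType :=
  vec (place (onet (typing p))).

Definition nested : choiceType := {p : place (sys E) & token_marking p}.

Definition marking := {mset nested}.

Definition Pi1 (mu : marking) : vec (place (sys E)) :=
  [ffun p => count (fun x : nested => tag x == p) (mu : {mset nested})].

(* [untag 0 F u] is 0 unless [tag u = k], and otherwise applies [F] to the second
   component of [u] cast to type [k]: a token on a place of another type does
   not contribute. *)
Definition Pi2 (k : option (obj_idx E)) (mu : marking) : vec (place (onet k)) :=
  [ffun q => \sum_(x <- (mu : {mset nested}))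
     untag 0 (fun m : vec (place (onet k)) => m q)
       (Tagged (fun k' => vec (place (onet k'))) (tagged x))].

Definition event_pre (ev : event) (k : option (obj_idx E)) :
    vec (place (onet k)) :=
  [ffun q => \sum_(u : trans (onet k)) ev.2 k u * pn_pre u q].
Definition event_post (ev : event) (k : option (obj_idx E)) :
    vec (place (onet k)) :=
  [ffun q => \sum_(u : trans (onet k)) ev.2 k u * pn_post u q].

Definition eos_mode (ev : event) (lambda rho : marking) : Prop :=
  [/\ Pi1 lambda = pn_pre ev.1, Pi1 rho = pn_post ev.1 &
      forall k, vle (event_pre ev k) (Pi2 k lambda) /\
        Pi2 k rho =
          vadd (vsub (Pi2 k lambda) (event_pre ev k)) (event_post ev k)].

Definition eos_step (mu mu' : marking) : Prop :=
  exists (ev : event) (lambda rho : marking),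
    [/\ ev \in events E, lambda `<=` mu, eos_mode ev lambda rho &
        mu' = (mu `\` lambda) `+` rho].

(* Same place, with tokens possibly added to the inner marking. *)
Inductive nested_le : nested -> nested -> Prop :=
  NestedLe (p : place (sys E)) (m m' : token_marking p) :
    vle m m' -> nested_le (Tagged token_marking m) (Tagged token_marking m').

Definition marking_le (mu mu' : marking) : Prop :=
  exists (k : nat) (xs ys : k.-tuple nested) (added : marking),
    [/\ mu = seq_mset xs, mu' = seq_mset ys `+` added &
        forall i, nested_le (tnth xs i) (tnth ys i)].

Definition conservative : Prop :=
  forall t : trans (sys E),
    (@typing E) @: [set p | 0 < pn_pre t p]
      \subset (@typing E) @: [set p | 0 < pn_post t p].

End EOSSemantics.

Record cEOS_instance := CEOSInstance {
  ci_eos : EOS;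
  ci_conservative : conservative ci_eos;
  ci_init : marking ci_eos;
  ci_target : marking ci_eos
}.

Definition cEOS_coverable (I : cEOS_instance) : Prop :=
  exists mu : marking (ci_eos I),
    clos_refl_trans _ (@eos_step (ci_eos I)) (ci_init I) mu /\
    marking_le (ci_target I) mu.

(** * Multi-tape Turing machines *)

(* A cell is blank ([None]), holds an input/output symbol ([Some (inl a)]) or an
   auxiliary one ([Some (inr g)]). *)
Inductive move := MoveL | MoveR | Stay.

Record TM (Sigma : finType) := MkTM {
  tm_tapes : nat; (* one less than the number of tapes *)
  tm_state : finType;
  tm_aux : finType;
  tm_start : tm_state;
  tm_halt : pred tm_state;
  tm_delta : tm_state -> {ffun 'I_tm_tapes.+1 -> option (Sigma + tm_aux)} ->
    tm_state * ('I_tm_tapes.+1 -> option (Sigma + tm_aux) * move)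
}.

Section TMSemantics.
Variables (Sigma : finType) (M : TM Sigma).

Definition cell := option (Sigma + tm_aux M).

(* [tp_left] is listed from the head outwards; cells beyond the lists are blank. *)
Record tape := Tape { tp_left : seq cell; tp_head : cell; tp_right : seq cell }.

Definition tape_of (s : seq cell) : tape :=
  Tape [::] (head None s) (behead s).

Definition tape_act (a : cell * move) (tp : tape) : tape :=
  match a.2 with
  | Stay => Tape (tp_left tp) a.1 (tp_right tp)
  | MoveL => Tape (behead (tp_left tp)) (head None (tp_left tp)) (a.1 :: tp_right tp)
  | MoveR => Tape (a.1 :: tp_left tp) (head None (tp_right tp)) (behead (tp_right tp))
  end.

Definition tm_config := (tm_state M * ('I_(tm_tapes M).+1 -> tape))%type.

Definition tm_step (c : tm_config) : tm_config :=
  if tm_halt c.1 then c else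
  let d := tm_delta c.1 [ffun i => tp_head (c.2 i)] in
  (d.1, fun i => tape_act (d.2 i) (c.2 i)).

Definition tm_init (w : seq Sigma) : tm_config :=
  (tm_start M,
   fun i => tape_of (if i == ord0 then [seq Some (inl a) | a <- w] else [::])).

Fixpoint read_word (s : seq cell) : seq Sigma :=
  if s is Some (inl a) :: s' then a :: read_word s' else [::].

(* The output is the word on the first tape, from the head up to the first cell
   that does not hold an input/output symbol. *)
Definition tm_output (c : tm_config) : seq Sigma :=
  read_word (tp_head (c.2 ord0) :: tp_right (c.2 ord0)).

Definition tm_computes (w : seq Sigma) (n : nat) (v : seq Sigma) : Prop :=
  exists2 t, t <= n &
    let c := iter t tm_step (tm_init w) in tm_halt c.1 /\ tm_output c = v.

End TMSemantics.

(** * Encodings of instances as words *)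

Inductive symb := LPar | RPar | Bit of bool | Sep.

Definition symb_pickle (a : symb) : 'I_5 :=
  inord match a with LPar => 0 | RPar => 1 | Bit false => 2 | Bit true => 3
                   | Sep => 4 end.
Definition symb_unpickle (i : 'I_5) : symb :=
  match val i with 0 => LPar | 1 => RPar | 2 => Bit false | 3 => Bit true
                 | _ => Sep end.
Lemma symb_pickleK : cancel symb_pickle symb_unpickle.
Proof. by case=> [||[]|]; rewrite /symb_unpickle /symb_pickle /= inordK. Qed.
HB.instance Definition _ := Finite.copy symb (can_type symb_pickleK).

Inductive data := Num of nat | Lst of seq data.

(* Least significant bit first; 0 is the empty word. *)
Fixpoint pos_bits (p : BinNums.positive) : seq bool :=
  match p with
  | BinNums.xH => [:: true]
  | BinNums.xO q => false :: pos_bits q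
  | BinNums.xI q => true :: pos_bits q
  end.
Definition nat_bits (n : nat) : seq bool :=
  if bin_of_nat n is BinNums.Npos p then pos_bits p else [::].

Fixpoint serialize (d : data) : seq symb :=
  match d with
  | Num n => rcons [seq Bit b | b <- nat_bits n] Sep
  | Lst l => LPar :: rcons (flatten [seq serialize d' | d' <- l]) RPar
  end.

(* Encodings are relations because a finite set or multiset may be listed in any
   order; elements of a finite type are numbered by [enum_rank], and maps on a
   finite type are listed in the order of [enum]. *)
Definition coding (A : Type) := A -> data -> Prop.

Definition c_nat : coding nat := fun n d => d = Num n.

Definition c_card (T : finType) : data := Num #|T|.

Definition c_fin (T : finType) : coding T := fun x d => d = Num (enum_rank x).

Definition c_pair A B (cA : coding A) (cB : coding B) : coding (A * B) :=
  fun x d => exists dA dB, [/\ cA x.1 dA, cB x.2 dB & d = Lst [:: dA; dB]].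

Definition c_seq A (cA : coding A) : coding (seq A) :=
  fun s d => exists2 l, List.Forall2 cA s l & d = Lst l.

Definition c_fun (T : finType) (B : T -> Type) (cB : forall x, coding (B x)) :
    coding (forall x, B x) :=
  fun f d => exists2 g : T -> data,
    (forall x, cB x (f x) (g x)) & d = Lst [seq g x | x <- enum T].

Definition c_vec (P : finType) : coding (vec P) :=
  fun m => c_fun (fun _ => c_nat) m.

Definition c_mset (A : choiceType) (cA : coding A) : coding {mset A} :=
  fun M d => exists2 s : seq A, perm_eq s (finsupp M) &
    c_seq (c_pair cA c_nat) [seq (a, M a) | a <- s] d.

Definition c_fset (A : choiceType) (cA : coding A) : coding {fset A} :=
  fun X d => exists2 s : seq A, perm_eq s X & c_seq cA s d.

Definition c_var : coding var :=
  fun v d => d = Lst [:: Num (is_fresh v); Num match v with inl n | inr n => n end].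

Definition c_nuPN (P T : finType) : coding (nuPN P T) :=
  fun N d => exists d1 d2,
    [/\ c_fun (fun p => c_fun (fun t => c_mset c_var)) (nu_in N) d1,
        c_fun (fun t => c_fun (fun p => c_mset c_var)) (nu_out N) d2 &
        d = Lst [:: d1; d2]].

Definition c_rnuPN : coding rnuPN :=
  fun N d => exists d1 d2 d3 d4 d5 d6,
    [/\ c_nuPN (r_net N) d1 /\ c_nuPN (r_net' N) d2,
        c_fun (fun t => c_pair (@c_fin _) (@c_fin _)) (@r_transfer N) d3,
        c_fun (fun t => c_var) (@rx0 N) d4,
        c_fun (fun t => c_var) (@rx1 N) d5 /\
          c_fun (fun t => c_var) (@rx2 N) d6 &
        d = Lst [:: c_card (r_place N); c_card (r_trans N); c_card (r_trans' N);
                    d1; d2; d3; d4; d5; d6]].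

Definition c_rnuPN_instance : coding rnuPN_instance :=
  fun I d => exists dN d0 d1,
    [/\ c_rnuPN (ri_net I) dN,
        c_mset (@c_vec _) (ri_init I) d0,
        c_mset (@c_vec _) (ri_target I) d1 &
        d = Lst [:: dN; d0; d1]].

Definition c_PN : coding PN :=
  fun N d => exists d1 d2,
    [/\ c_fun (fun p => c_fun (fun t => c_nat)) (@arc_in N) d1,
        c_fun (fun t => c_fun (fun p => c_nat)) (@arc_out N) d2 &
        d = Lst [:: c_card (place N); c_card (trans N); d1; d2]].

Definition c_event (E : EOS) : coding (event E) :=
  fun ev d => exists2 dth, c_fun (fun k => @c_vec _) (fun k => ev.2 k) dth &
    d = Lst [:: Num (enum_rank ev.1); dth].

Definition c_EOS : coding EOS :=
  fun E d => exists dS dK dt di de,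
    [/\ c_PN (sys E) dS,
        c_fun (fun k => c_PN) (@obj_nets E) dK,
        c_fun (fun p => @c_fin _) (@typing E) dt,
        c_fun (fun p => @c_fin _) (@idle E) di /\
          c_fset (@c_event E) (events E) de &
        d = Lst [:: dS; dK; dt; di; de]].

Definition c_nested (E : EOS) : coding (nested E) :=
  fun x d => exists2 dm, c_vec (tagged x) dm &
    d = Lst [:: Num (enum_rank (tag x)); dm].

Definition c_cEOS_instance : coding cEOS_instance :=
  fun I d => exists dE d0 d1,
    [/\ c_EOS (ci_eos I) dE,
        c_mset (@c_nested _) (ci_init I) d0,
        c_mset (@c_nested _) (ci_target I) d1 &
        d = Lst [:: dE; d0; d1]].

(** * Decision problems and polynomial-time many-one reductions *)

Record problem := Problem {
  instance : Type;
  instance_code : coding instance;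
  yes : instance -> Prop
}.

Definition encodes (A : problem) (x : instance A) (w : seq symb) : Prop :=
  exists2 d, instance_code x d & w = serialize d.

Definition poly_time_reduces (A B : problem) : Prop :=
  exists (M : TM symb) (p : {poly nat}),
    forall (x : instance A) (w : seq symb), encodes x w ->
      exists (v : seq symb) (y : instance B),
        [/\ tm_computes M w (horner p (size w)) v, encodes y v &
            yes x <-> yes y].

Definition rnuPN_coverability : problem :=
  Problem c_rnuPN_instance rnuPN_coverable.
Definition cEOS_coverability : problem :=
  Problem c_cEOS_instance cEOS_coverable.

(* Main.v *)
(** An r-nu-PN is simulated by an object system whose system net has constant size.
    Each tuple of a configuration is a nested token over an object net on the places
    of the r-nu-PN; it lies on the system place [s_sim], or on one of five auxiliary
    places while a firing is simulated.  One further nested token records the phase of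
    the simulation.  Its marking (c, 6-c, 2^i, 2^(n-i), 2^j, 2^(n-j)) ranges over an
    antichain, so that only the events of the current phase are enabled.  A firing is
    simulated by handling the variables of the transition one after the other.  In a
    transfer the tokens of the tuple bound to [rx1] are removed one by one: those on
    the place r1 are added to r2 in the tuple bound to [rx2], the others are moved to
    a new tuple, which replaces the old one.  The old tuple is thrown away at an
    arbitrary moment, so tokens may get lost, but by monotonicity lost tokens do not
    affect coverability.

    The encoding of the object system is a concatenation of words that are determined
    by boundedly many positions in the input word.  Such a word is printed by a
    machine whose registers are positions, that is, heads on copies of the input. *)

From HB Require Import structures.
From mathcomp Require Import all_boot all_algebra.
From mathcomp Require Import finmap multiset.
From mathcomp Require Import zify.
From Stdlib Require Import Relations FunctionalExtensionality.
Require Import Defs.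

Set Implicit Arguments.
Unset Strict Implicit.
Unset Printing Implicit Defensive.

Local Open Scope mset_scope.
Local Open Scope nat_scope.

(** If a system transition consumed two nested tokens of one type, the firing rule would allow their
    contents to be redistributed at will. Hence a proper transition handles at most one tuple
    besides the control token, so that an event determines the tuple it leaves behind; this is what
    forces a firing to be cut into small steps. Events test lower bounds only, so a mere counter
    could not select a phase: each component of the control marking needs its complement. A
    conservative net cannot consume a tuple without producing one, so a tuple is thrown away by
    parking it on a place that no event empties. The printer shapes the rest. Its registers cannot
    exceed the input length [n], and the variables of a transition carry no small numbers. A
    variable is therefore named by the position of its first entry in the input; a walk visits all
    positions below [n] and idles where no variable occurs first. Multiplicities may be exponential
    and are copied digit by digit, never evaluated. Events form a set whose encoding lists each
    element once, so the printed events also have to be shown pairwise distinct. *)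

Definition ocell := option (symb + unit).

Definition mark : ocell := Some (inr tt).

Definition track (w : seq symb) : seq ocell :=
  mark :: [seq Some (inl a) | a <- w].

Definition rd (w : seq symb) (v : nat) : ocell := nth None (track w) v.

(** Saturation at both ends keeps every register within the legal head positions without any test in
    the program. *)
Definition shift (w : seq symb) (m : move) (v : nat) : nat :=
  match m with MoveL => v.-1 | MoveR => minn v.+1 (size w).+1 | Stay => v end.

Definition upd (s : nat -> nat) (r v : nat) : nat -> nat :=
  fun i => if i == r then v else s i.
Arguments upd : simpl never.

(* The registers hold positions from 0 (the mark) to [size w + 1] (the first blank);
   symbols are output from right to left. *)
Inductive cmd :=
| Act of nat & (ocell -> move * option symb)
| Seq of cmd & cmd
| If of nat & pred ocell & cmd & cmd
| While of nat & pred ocell & cmd.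

Definition state := ((nat -> nat) * seq symb)%type.

Definition act_state (w : seq symb) (r : nat) (a : move * option symb)
    (s : state) : state :=
  (upd s.1 r (shift w a.1 (s.1 r)), if a.2 is Some x then x :: s.2 else s.2).

Inductive exec (w : seq symb) : cmd -> state -> nat -> state -> Prop :=
| ExAct r g s : exec w (Act r g) s 1 (act_state w r (g (rd w (s.1 r))) s)
| ExSeq c1 c2 s1 s2 s3 t1 t2 : exec w c1 s1 t1 s2 -> exec w c2 s2 t2 s3 ->
    exec w (Seq c1 c2) s1 (t1 + t2) s3
| ExIf r (b : pred ocell) c1 c2 s t s' :
    exec w (if b (rd w (s.1 r)) then c1 else c2) s t s' ->
    exec w (If r b c1 c2) s t.+1 s'
| ExWhile0 r (b : pred ocell) c s : ~~ b (rd w (s.1 r)) -> exec w (While r b c) s 1 s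
| ExWhile r (b : pred ocell) c s1 s2 s3 t1 t2 : b (rd w (s1.1 r)) -> exec w c s1 t1 s2 ->
    exec w (While r b c) s2 t2 s3 -> exec w (While r b c) s1 (t1 + t2).+1 s3.

(** * Compilation to Turing machines *)

Definition instr := (nat * (ocell -> nat * (move * option symb)))%type.

(** The code sits at address [base] and exits to [next]. The entry of the second part of a [Seq] is
    needed before the first part is compiled; [compile c1 0 0] supplies the length, which does not
    depend on addresses. *)
Fixpoint compile (c : cmd) (base next : nat) : seq instr :=
  match c with
  | Act r g => [:: (r, fun x => (next, g x))]
  | Seq c1 c2 =>
      let k1 := compile c1 base (base + size (compile c1 0 0)) in
      k1 ++ compile c2 (base + size k1) next
  | If r b c1 c2 =>
      let k1 := compile c1 base.+1 next in
      (r, fun x => (if b x then base.+1 else base.+1 + size k1, (Stay, None)))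
        :: k1 ++ compile c2 (base.+1 + size k1) next
  | While r b c =>
      (r, fun x => (if b x then base.+1 else next, (Stay, None)))
        :: compile c base.+1 base
  end.

Lemma size_compile c base next base' next' :
  size (compile c base next) = size (compile c base' next').
Proof.
elim: c base next base' next' => //= [c1 IH1 c2 IH2|r b c1 IH1 c2 IH2|r b c IH] x y x' y'.
- by rewrite !size_cat; congr (_ + _); [exact: IH1|exact: IH2].
- by rewrite !size_cat; congr (_ + _).+1; [exact: IH1|exact: IH2].
- by congr _.+1; exact: IH.
Qed.

Definition instr0 : instr := (0, fun _ => (0, (Stay, None))).

Definition code_at (code : seq instr) (base : nat) (k : seq instr) : Prop :=
  exists pre post, code = pre ++ k ++ post /\ size pre = base.

Lemma code_at_catl code base k1 k2 :
  code_at code base (k1 ++ k2) -> code_at code base k1.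
Proof. by case=> pre [post [-> <-]]; exists pre, (k2 ++ post); rewrite -catA. Qed.

Lemma code_at_catr code base k1 k2 :
  code_at code base (k1 ++ k2) -> code_at code (base + size k1) k2.
Proof.
case=> pre [post [-> <-]]; exists (pre ++ k1), post.
by rewrite size_cat !catA.
Qed.

Lemma code_at_nth code base i k : code_at code base (i :: k) ->
  nth instr0 code base = i /\ base < size code.
Proof.
case=> pre [post [-> <-]]; rewrite nth_cat ltnn subnn /=; split=> //.
by rewrite !size_cat /=; lia.
Qed.

Lemma code_at_le code base k : code_at code base k -> base + size k <= size code.
Proof. by case=> pre [post [-> <-]]; rewrite !size_cat; lia. Qed.

(** The exit label is [size code]; larger targets are clipped to it, so that labels fit into a
    finite set of states. *)
Definition fstep (w : seq symb) (code : seq instr) (x : nat * state) : nat * state :=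
  let ins := nth instr0 code x.1 in
  let a := ins.2 (rd w (x.2.1 ins.1)) in
  if x.1 < size code then (minn a.1 (size code), act_state w ins.1 a.2 x.2) else x.

Lemma upd_id s r : upd s r (s r) = s.
Proof. by apply: functional_extensionality => i; rewrite /upd; case: eqP => // ->. Qed.

Lemma act_state_stay w r s : act_state w r (Stay, None) s = s.
Proof. by case: s => s o; rewrite /act_state /= upd_id. Qed.

(** Step counts agree exactly: the extra unit that [exec] charges for a test of [If] or [While] is
    the jump instruction in front of the code. Time bounds thus carry over without loss. *)
Lemma compileP w code c s t s' : exec w c s t s' ->
  forall base next, code_at code base (compile c base next) -> next <= size code ->
    iter t (fstep w code) (base, s) = (next, s').
Proof.
elim=> {c s t s'} [r g s|c1 c2 s1 s2 s3 t1 t2 _ IH1 _ IH2|r b c1 c2 s t s' _ IH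
  |r b c s Nb|r b c s1 s2 s3 t1 t2 hb _ IH1 _ IH2] base next hc hn; rewrite /= in hc.
- have [hi lt] := code_at_nth hc.
  by rewrite /= /fstep /= hi lt /= (minn_idPl hn).
- have e: size (compile c1 base (base + size (compile c1 0 0))) = size (compile c1 0 0).
    exact: size_compile.
  rewrite addnC iterD (IH1 _ _ (code_at_catl hc)); last first.
    by have := code_at_le (code_at_catl hc); rewrite e.
  by apply: IH2 => //; have := code_at_catr hc; rewrite e.
- have [hi lt] := code_at_nth hc.
  have hc1 : code_at code base.+1 (compile c1 base.+1 next ++
      compile c2 (base.+1 + size (compile c1 base.+1 next)) next).
    by have := @code_at_catr _ _ [:: _] _ hc; rewrite addn1.
  have le := code_at_le hc1; rewrite size_cat in le.
  rewrite iterSr /fstep /= hi lt /= act_state_stay.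
  case: (b _) IH => IH.
    rewrite (minn_idPl _); last by lia.
    by apply: IH => //; apply: code_at_catl hc1.
  rewrite (minn_idPl _); last by lia.
  by apply: IH => //; apply: code_at_catr hc1.
- have [hi lt] := code_at_nth hc.
  by rewrite /= /fstep /= hi lt /= (negbTE Nb) act_state_stay (minn_idPl hn).
- have [hi lt] := code_at_nth hc.
  have hc1 : code_at code base.+1 (compile c base.+1 base).
    by have := @code_at_catr _ _ [:: _] _ hc; rewrite addn1.
  rewrite iterSr /fstep /= hi lt /= hb act_state_stay (minn_idPl _); last by lia.
  rewrite addnC iterD (IH1 base.+1 base) //; last by lia.
  exact: IH2.
Qed.

(** * The Turing machine of a flat program *)

Section Machine.
Variable code : seq instr.

Definition nregs := (foldr maxn 0 [seq i.1 | i <- code]).+1.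

Lemma nregsP l : (nth instr0 code l).1 < nregs.
Proof.
rewrite /nregs ltnS; elim: code l => [|i k IH] [|l] //=.
  by rewrite leq_maxl.
by apply: leq_trans (IH l) _; rewrite leq_maxr.
Qed.

(** A tape head does not saturate by itself, so a move off the mark or beyond the first blank is
    suppressed on the basis of the scanned symbol. *)
Definition eff (x : ocell) (m : move) : move :=
  match m, x with
  | MoveL, Some (inr _) => Stay
  | MoveR, None => Stay
  | _, _ => m
  end.

(** The offset 2 skips the two loading states; together with the exit label and the halting state
    there are [size code + 4] states. *)
Definition lab (l : nat) : 'I_(size code).+4 := inord (minn l (size code)).+2.

(* State 1 erases the input on the first tape, which becomes the output tape, and
   copies it to the register tapes; state l + 2 executes the instruction l. *)
Definition delta (q : 'I_(size code).+4) (x : {ffun 'I_nregs.+1 -> ocell}) :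
    'I_(size code).+4 * ('I_nregs.+1 -> ocell * move) :=
  match val q with
  | 0 => (inord 1, fun i => if i == ord0 then (x i, Stay) else (mark, MoveR))
  | 1 => if x ord0 is Some a
         then (q, fun i => if i == ord0 then (None, MoveR) else (Some a, MoveR))
         else (lab 0, fun i => (x i, Stay))
  | l.+2 =>
      if l < size code then
        let ins := nth instr0 code l in
        let a := ins.2 (x (inord ins.1.+1)) in
        (lab a.1, fun i =>
           if i == ord0 then (if a.2.2 is Some b then (Some (inl b), MoveL)
                              else (x i, Stay))
           else if i == inord ins.1.+1 then (x i, eff (x i) a.2.1)
           else (x i, Stay))
      else (ord_max, fun i => (x i, if i == ord0 then MoveR else Stay))
  end.

Definition machine : TM symb :=
  @MkTM symb nregs 'I_(size code).+4 unit ord0 (pred1 ord_max) delta.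

Variable w : seq symb.

(** The number of trailing blanks is left open, since a head that returns from the first blank
    leaves a blank cell in the list. *)
Definition reg_tape (v : nat) (tp : tape machine) : Prop :=
  exists k, tp = @Tape symb machine (rev (take v (track w))) (rd w v)
                   (drop v.+1 (track w) ++ nseq k None).

(** The output grows leftwards, hence the head rests on the blank in front of it; the blanks on its
    left remain from the erased input. *)
Definition out_tape (o : seq symb) (tp : tape machine) : Prop :=
  exists k, tp = @Tape symb machine (nseq k None) None [seq Some (inl a) | a <- o].

Definition represents (x : nat * state) (c : tm_config machine) : Prop :=
  [/\ val c.1 = x.1.+2, out_tape x.2.2 (c.2 ord0),
      forall i : 'I_nregs, reg_tape (x.2.1 i) (c.2 (lift ord0 i)) &
      forall i : 'I_nregs, x.2.1 i <= (size w).+1].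

Lemma size_track : size (track w) = (size w).+1.
Proof. by rewrite /track /= size_map. Qed.

Lemma rd_blank v : v <= (size w).+1 -> (rd w v == None) = (v == (size w).+1).
Proof.
rewrite leq_eqVlt => /orP[/eqP->|lt].
  by rewrite /rd nth_default ?size_track // !eqxx.
rewrite (ltn_eqF lt) /rd /track; case: v lt => [|v] //= lt.
by rewrite (nth_map LPar).
Qed.

Lemma rd_mark v : (rd w v == mark) = (v == 0).
Proof.
case: v => [|v] //=; rewrite /rd /track /=.
have [lt|ge] := ltnP v (size w); first by rewrite (nth_map LPar).
by rewrite nth_default ?size_map.
Qed.

Opaque track.
Lemma reg_tape_step v tp m : v <= (size w).+1 -> reg_tape v tp ->
  reg_tape (shift w m v) (@tape_act symb machine (rd w v, eff (rd w v) m) tp).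
Proof.
move=> le [k ->].
have st : reg_tape v (@tape_act symb machine (rd w v, Stay) (@Tape symb machine
    (rev (take v (track w))) (rd w v) (drop v.+1 (track w) ++ nseq k None))).
  by exists k.
case: m => //.
- case: v le st => [|v] le st; first exact: st.
  have -> : eff (rd w v.+1) MoveL = MoveL.
    have := rd_mark v.+1; rewrite /mark /eff.
    by case: (rd _ _) => [[//|[]]|//]; rewrite eqxx.
  have lt : v < size (track w) by rewrite size_track.
  rewrite /tape_act (take_nth None lt) rev_rcons -/(rd w v) /=.
  case: (ltnP v.+1 (size (track w))) => lt'.
    by exists k; rewrite /= [in RHS](drop_nth None lt') -/(rd w v.+1).
  exists k.+1; rewrite /= (drop_oversize lt') (drop_oversize (leqW lt')).
  by have -> : rd w v.+1 = None by rewrite /rd nth_default.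
- have b := rd_blank le; case: eqP b => b.
    rewrite b => /esym/eqP ev /=.
    by rewrite ev (minn_idPr _) // -ev; rewrite b in st.
  move=> ne; have lt : v < (size w).+1 by rewrite ltn_neqAle le -ne.
  have -> : eff (rd w v) MoveR = MoveR by case: (rd w v) b.
  rewrite /shift (minn_idPl lt) /tape_act /=.
  have lt' : v < size (track w) by rewrite size_track.
  have -> : rd w v :: rev (take v (track w)) = rev (take v.+1 (track w)).
    by rewrite (take_nth None lt') rev_rcons.
  case: (ltnP v.+1 (size (track w))) => lt2.
    by exists k; rewrite (drop_nth None lt2).
  exists k.-1; rewrite (drop_oversize lt2) (drop_oversize (leqW lt2)) !cat0s.
  have -> : rd w v.+1 = None by rewrite /rd nth_default.
  by case: k {st}.
Qed.

Transparent track.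

Lemma represents_step x c : represents x c -> x.1 < size code ->
  represents (fstep w code x) (tm_step c).
Proof.
case: x c => [l [s o]] [[q hq'] tps] /= [/= hq ho hr hb] lt; subst q.
have nh : ~~ @tm_halt _ machine (Ordinal hq').
  by rewrite /= -val_eqE /=; move: lt => /=; lia.
rewrite /tm_step ?ifN // /= /delta /= /fstep /= lt.
set ins := nth instr0 code l.
have ltr : ins.1 < nregs := nregsP l.
have hin : inord ins.1.+1 = lift ord0 (Ordinal ltr).
  by apply: val_inj; rewrite /= inordK.
rewrite hin ffunE.
have hd (i : 'I_nregs) : tp_head (tps (lift ord0 i)) = rd w (s i).
  by have [k ->] := hr i.
rewrite hd /=; set a := ins.2 _.
split=> /=.
- rewrite /lab inordK // !ltnS; exact: leq_trans (geq_minr _ _) (leqnSn _).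
- rewrite ffunE; case: ho => k ->.
  by case: a.2.2 => [b|]; [exists k.-1; case: k|exists k].
- move=> i; rewrite ffunE hd /upd.
  rewrite (inj_eq lift_inj) -val_eqE /=; case: eqP => [e|_]; last first.
    by have [k e] := hr i; exists k; rewrite e.
  have -> : s ins.1 = s i by rewrite e.
  exact: reg_tape_step.
- move=> i; rewrite /upd; case: eqP => // e; rewrite -e; have := hb i.
  by case: a.2.1 => //= h; [exact: leq_trans (leq_pred _) h|exact: geq_minr].
Qed.

Lemma represents_iter t x c : represents x c ->
  (forall i, i < t -> (iter i (fstep w code) x).1 < size code) ->
  represents (iter t (fstep w code) x) (iter t (@tm_step symb machine) c).
Proof.
elim: t => // t IH hx ht; rewrite !iterS; apply: represents_step.
  by apply: IH => // i lt; apply: ht; apply: ltnW.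
exact: ht.
Qed.

Definition loaded (i : nat) (tps : 'I_(tm_tapes machine).+1 -> tape machine) : Prop :=
  [/\ tps ord0 = @Tape symb machine (nseq i None)
        (head None (drop i [seq Some (inl a) | a <- w]))
        (behead (drop i [seq Some (inl a) | a <- w])) &
      forall j : 'I_nregs, tps (lift ord0 j) =
        @Tape symb machine (rev (take i.+1 (track w))) None [::]].

Lemma machine_load i : i <= size w ->
  let c := iter i.+1 (@tm_step symb machine) (tm_init machine w) in
  val c.1 = 1 /\ loaded i c.2.
Proof.
elim: i => [|i IH] le.
  split; first by rewrite /= inordK.
  split; first by rewrite drop0 /= ffunE; case: (w).
  by move=> j; rewrite /= take0.
have {IH} [] := IH (ltnW le); rewrite (iterS i.+1); set c := iter i.+1 _ _.
case: c => [[q hq'] tps] /= hq [h0 hj]; subst q.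
have nh : ~~ @tm_halt _ machine (Ordinal hq') by rewrite /= -?val_eqE /=; lia.
have dr : drop i [seq Some (inl a) | a <- w] =
    Some (inl (nth LPar w i)) :: drop i.+1 [seq Some (inl a) | a <- w] :> seq ocell.
  by rewrite (drop_nth None) ?size_map // (nth_map LPar).
rewrite /tm_step ?ifN // /= /delta /= ffunE h0 dr /=; split=> //; split=> /=.
  by rewrite h0 dr.
move=> j; rewrite hj /tape_act /= (take_nth None) ?size_map //.
by rewrite (nth_map LPar) // -rcons_cons rev_rcons.
Qed.

(** Copying ends with every register head on the first blank, which is position [(size w).+1]. The
    steps are one for the marks, one per symbol and one that finds the blank. *)
Lemma machine_init s0 : (forall i, i < nregs -> s0 i = (size w).+1) ->
  represents (0, (s0, [::]))
    (iter (size w).+2 (@tm_step symb machine) (tm_init machine w)).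
Proof.
move=> hs0; have := machine_load (leqnn _); rewrite (iterS (size w).+1); set c := iter _ _ _.
case: c => [[q hq'] tps] /= [hq [h0 hj]]; subst q.
have nh : ~~ @tm_halt _ machine (Ordinal hq') by rewrite /= -?val_eqE /=; lia.
rewrite drop_oversize ?size_map //= in h0.
rewrite /tm_step ?ifN // /= /delta /= ffunE h0 /=; split=> //=.
- by rewrite /lab min0n inordK.
- by rewrite ffunE h0; exists (size w).
- move=> i; rewrite ffunE hj hs0 //; exists 0.
  rewrite /rd [nth _ _ _]nth_default ?size_track //.
  by rewrite drop_oversize ?size_track.
- by move=> i; rewrite hs0.
Qed.

(** The surcharge is [size w + 2] steps for loading and one step that moves the output head onto the
    first symbol. *)
Lemma machineP t s0 s o : (forall i, i < nregs -> s0 i = (size w).+1) ->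
  iter t (fstep w code) (0, (s0, [::])) = (size code, (s, o)) ->
  tm_computes machine w (t + size w + 3) o.
Proof.
set x0 := (0, _) => hs0 hi.
have ex : exists i, size code <= (iter i (fstep w code) x0).1 by exists t; rewrite hi.
(* The simulation is valid only until the exit label is reached, so the first such time [t0] is
   taken; the abstract code is stuck afterwards, and the final state is already there at [t0]. *)
have [t0 ht0 min] := ex_minnP ex.
have le : t0 <= t by apply: min; rewrite hi.
have stuck k : iter k (fstep w code) (iter t0 (fstep w code) x0) = iter t0 (fstep w code) x0.
  by elim: k => //= k ->; rewrite /fstep ltnNge ht0.
have hl i : i < t0 -> (iter i (fstep w code) x0).1 < size code.
  by move=> lt; rewrite ltnNge; apply/negP => /min; rewrite leqNgt lt.
have := represents_iter (machine_init hs0) hl.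
rewrite -(stuck (t - t0)) -iterD subnK // hi -iterD.
move=> r; exists (t0 + size w + 3); first by rewrite !leq_add2r.
have -> : t0 + size w + 3 = (t0 + (size w).+2).+1 by lia.
rewrite iterS; set c := iter _ _ _ in r *; case: c r => [[q hq'] tps] /= [/= hq [k ho] _ _]; subst q.
have nh : ~~ @tm_halt _ machine (Ordinal hq').
  by rewrite /= -?val_eqE /=; lia.
rewrite /tm_step ?ifN // /= /delta /= ltnn eqxx; split=> //.
rewrite /tm_output /= ho /=; case: o {ho hi} => [|a o] //=; congr cons.
by elim: o => //= b o ->.
Qed.

End Machine.

(** * Computable terms and printers *)

(** The exponent is to be independent of the input. As the base is at least 2, a sum of two bounds
    is absorbed by adding the exponents and one more. *)
Definition run (w : seq symb) (c : cmd) (k : nat) (s s' : state) : Prop :=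
  exists2 t, t <= (size w + 2) ^ k & exec w c s t s'.

Definition nz (x : ocell) : bool := x != mark.
Definition dec (r : nat) : cmd := Act r (fun _ => (MoveL, None)).
Definition inc (r : nat) : cmd := Act r (fun _ => (MoveR, None)).
Definition skip : cmd := Act 0 (fun _ => (Stay, None)).
Definition emit (a : symb) : cmd := Act 0 (fun _ => (Stay, Some a)).
Definition loop (r : nat) (c : cmd) : cmd := While r nz (Seq (dec r) c).
Definition clear (r : nat) : cmd := loop r skip.
Definition mv (a b : nat) : cmd := loop a (inc b).

Section Run.
Variable w : seq symb.
Let N := size w + 2.

Lemma expN_gt0 k : 0 < N ^ k. Proof. by rewrite expn_gt0 /N addn2. Qed.

Lemma leq_expN k k' : k <= k' -> N ^ k <= N ^ k'.
Proof. by apply: leq_pexp2l; rewrite /N addn2. Qed.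

Lemma expN_double k : N ^ k + N ^ k <= N ^ k.+1.
Proof. by rewrite addnn -mul2n expnS leq_mul2r /N addn2 orbT. Qed.

Lemma expN_add k k' : N ^ k + N ^ k' <= N ^ (k + k').+1.
Proof.
apply: leq_trans (expN_double _).
by apply: leq_add; apply: leq_expN; [exact: leq_addr|exact: leq_addl].
Qed.

Lemma run_le c k k' s s' : k <= k' -> run w c k s s' -> run w c k' s s'.
Proof. by move=> le [t ht e]; exists t => //; apply: leq_trans ht (leq_expN le). Qed.

Lemma run_seq c1 c2 k1 k2 s1 s2 s3 :
  run w c1 k1 s1 s2 -> run w c2 k2 s2 s3 -> run w (Seq c1 c2) (k1 + k2).+1 s1 s3.
Proof.
move=> [t1 h1 e1] [t2 h2 e2]; exists (t1 + t2); last exact: ExSeq e1 e2.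
exact: leq_trans (leq_add h1 h2) (expN_add _ _).
Qed.

Lemma run_act r g s : run w (Act r g) 0 s (act_state w r (g (rd w (s.1 r))) s).
Proof. by exists 1 => //; exact: ExAct. Qed.

Lemma run_skip s : run w skip 0 s s.
Proof. by have := run_act 0 (fun _ => (Stay, None)) s; rewrite act_state_stay. Qed.

Lemma run_emit a s : run w (emit a) 0 s (s.1, a :: s.2).
Proof. by have := run_act 0 (fun _ => (Stay, Some a)) s; rewrite /act_state /= upd_id. Qed.

Lemma run_dec r s : run w (dec r) 0 s (upd s.1 r (s.1 r).-1, s.2).
Proof. exact: (run_act r (fun _ => (MoveL, None))). Qed.

Lemma run_inc r s : run w (inc r) 0 s (upd s.1 r (minn (s.1 r).+1 (size w).+1), s.2).
Proof. exact: (run_act r (fun _ => (MoveR, None))). Qed.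

Lemma run_if r (b : pred ocell) c1 c2 k s s' :
  run w (if b (rd w (s.1 r)) then c1 else c2) k s s' -> run w (If r b c1 c2) k.+1 s s'.
Proof.
move=> [t ht e]; exists t.+1; last exact: ExIf.
by apply: leq_trans (expN_double _); rewrite -addn1 leq_add // expN_gt0.
Qed.

Lemma nz_rd v : nz (rd w v) = (v != 0).
Proof. by rewrite /nz rd_mark. Qed.

(** [S i] is the state when [i] rounds remain; the body starts with [r] already lowered. At most
    [size w + 1] rounds cost one factor, the tests and decrements two more. *)
Lemma run_loop r c k (S : nat -> state) b :
  (forall i, i <= b -> (S i).1 r = i) -> b <= (size w).+1 ->
  (forall i, i < b -> run w c k (upd (S i.+1).1 r i, (S i.+1).2) (S i)) ->
  run w (loop r c) k.+3 (S b) (S 0).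
Proof.
move=> hr hb hc.
suff [t ht e] : exists2 t, t <= b * (N ^ k + 2) + 1 & exec w (loop r c) (S b) t (S 0).
  exists t => //; apply: leq_trans ht _.
  have h1 : N ^ k + 2 <= N ^ k.+2.
    apply: leq_trans (expN_double _).
    apply: leq_add; first exact: leq_expN.
    rewrite expnS; have := expN_gt0 k; rewrite /N; nia.
  rewrite (expnS _ k.+2); have lb : b.+1 <= N by rewrite /N; lia.
  have := leq_mul lb h1; have := expN_gt0 k; rewrite -/N; nia.
elim: b hr hb hc => [|b IH] hr hb hc.
  by exists 1 => //; apply: ExWhile0; rewrite nz_rd hr.
have [|||t2 h2 e2] := IH _ _ _.
- by move=> i le; apply: hr; apply: leqW.
- exact: ltnW.
- by move=> i lt; apply: hc; apply: ltnW.
have [t1 h1 e1] := hc b (leqnn _).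
exists (1 + t1 + t2).+1; first by rewrite mulSn -/N in h1 *; lia.
apply: ExWhile e2; first by rewrite nz_rd hr.
apply: ExSeq e1; have := ExAct w r (fun _ => (MoveL, None)) (S b.+1).
by rewrite /act_state /= hr.
Qed.

End Run.

Ltac updt :=
  apply: functional_extensionality => ?; rewrite /upd /=;
  repeat (case: eqP => ?); subst; try congruence; try lia.

Lemma upd_same s r v : upd s r v r = v.
Proof. by rewrite /upd eqxx. Qed.

Lemma upd_upd s r v v' : upd (upd s r v) r v' = upd s r v'.
Proof. by apply: functional_extensionality => i; rewrite /upd; case: eqP. Qed.

Lemma upd_neq s r v i : i != r -> upd s r v i = s i.
Proof. by rewrite /upd => /negbTE ->. Qed.

Lemma updC s r v r' v' : r != r' -> upd (upd s r v) r' v' = upd (upd s r' v') r v.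
Proof.
move=> ne; apply: functional_extensionality => i; rewrite /upd.
by case: (i =P r') => [->|//]; rewrite eq_sym (negbTE ne).
Qed.

Lemma upd_eq s r v : s r = v -> upd s r v = s.
Proof. by move <-; rewrite upd_id. Qed.

Lemma run_clear w r s : s.1 r <= (size w).+1 -> run w (clear r) 3 s (upd s.1 r 0, s.2).
Proof.
case: s => s o /= le.
have -> : (s, o) = (fun i => (upd s r i, o)) (s r) by rewrite upd_id.
apply: (@run_loop w r skip 0 (fun i => (upd s r i, o))) => //=.
  by move=> i _; rewrite upd_same.
by move=> i _; rewrite upd_upd; exact: run_skip.
Qed.

Lemma run_mv w a b s : a != b -> s.1 a + s.1 b <= (size w).+1 ->
  run w (mv a b) 3 s (upd (upd s.1 b (s.1 a + s.1 b)) a 0, s.2).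
Proof.
case: s => s o /= ne le; have ne' := ne; rewrite eq_sym in ne'.
pose S i := (upd (upd s b (s a - i + s b)) a i, o).
have e : (s, o) = S (s a) by rewrite /S subnn add0n upd_id (upd_eq (erefl (s a))).
have -> : (upd (upd s b (s a + s b)) a 0, o) = S 0 by rewrite /S subn0.
rewrite e; apply: run_loop => //=; try lia.
  by move=> i _; rewrite upd_same.
move=> i lt; have := run_inc w b (upd (S i.+1).1 a i, (S i.+1).2).
rewrite /S /= !upd_upd (upd_neq _ _ ne') upd_same updC // upd_upd.
have -> : (s a - i.+1 + s b).+1 = s a - i + s b by lia.
by rewrite (minn_idPl _) 1?(updC _ _ _ ne') //; lia.
Qed.

(** * Closure properties of computable terms and of printers *)

Section Comp.
Variables (G : Type) (wd : G -> seq symb).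
Implicit Types (rs : seq (G -> nat)) (f h : G -> nat).

Definition clean (w : seq symb) (m : nat) (s : nat -> nat) : Prop :=
  (forall i, m <= i -> s i = 0) /\ (forall i, s i <= (size w).+1).

(* The code receives the values [rs] in the registers [ix], may use the registers
   from [m] on, which are initially 0, and returns its result in register [m]. *)
Definition Comp rs f : Prop :=
  forall m ix, size ix = size rs -> all (fun i => i < m) ix ->
  exists c k, forall g s o, clean (wd g) m s -> map s ix = [seq r g | r <- rs] ->
    f g <= (size (wd g)).+1 /\ run (wd g) c k (s, o) (upd s m (f g), o).

Definition Emits rs (p : G -> seq symb) : Prop :=
  forall m ix, size ix = size rs -> all (fun i => i < m) ix ->
  exists c k, forall g s o, clean (wd g) m s -> map s ix = [seq r g | r <- rs] ->
    run (wd g) c k (s, o) (s, p g ++ o).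

Lemma clean_upd w m s v : clean w m s -> v <= (size w).+1 -> clean w m.+1 (upd s m v).
Proof.
move=> [h0 hb] hv; split=> i; last by rewrite /upd; case: eqP.
by move=> lt; rewrite upd_neq ?h0 ?gtn_eqF // ltnW.
Qed.

Lemma map_upd ix m s v : all (fun i => i < m) ix -> map (upd s m v) ix = map s ix.
Proof.
move=> /allP h; apply/eq_in_map => i /h lt.
by rewrite upd_neq // ltn_eqF.
Qed.

Lemma all_ltS ix m : all (fun i => i < m) ix -> all (fun i => i < m.+1) ix.
Proof. by apply: sub_all => i; apply: leqW. Qed.

Lemma Comp_ext rs f h : f =1 h -> Comp rs f -> Comp rs h.
Proof.
move=> e hf m ix sz lt; have [c [k H]] := hf m ix sz lt.
by exists c, k => g s o; rewrite -e; exact: H.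
Qed.

Lemma Emits_ext rs p q : p =1 q -> Emits rs p -> Emits rs q.
Proof.
move=> e hf m ix sz lt; have [c [k H]] := hf m ix sz lt.
by exists c, k => g s o; rewrite -e; exact: H.
Qed.

(** Reading a register by counting it down destroys it. The value is therefore copied twice, and the
    second copy is moved back to the source. *)
Lemma Comp_var rs i : i < size rs -> Comp rs (nth (fun _ => 0) rs i).
Proof.
move=> li m ix sz /allP lt; rewrite -sz in li.
set r := nth 0 ix i; have rm : r < m by apply: lt; exact: mem_nth.
exists (Seq (loop r (Seq (inc m) (inc m.+1))) (mv m.+1 r)), 8 => g s o [h0 hb] e.
have -> : nth (fun _ => 0) rs i g = s r.
  have -> : s r = nth 0 (map s ix) i by rewrite (nth_map 0).
  by rewrite e (nth_map (fun _ => 0)) // -sz.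
split=> //.
pose S j := (upd (upd (upd s r j) m (s r - j)) m.+1 (s r - j), o).
have n1 : r != m by lia.
have n2 : r != m.+1 by lia.
have n3 : m != m.+1 by lia.
have z1 : s m = 0 by apply: h0.
have z2 : s m.+1 = 0 by apply: h0.
have e0 : (s, o) = S (s r).
  by rewrite /S subnn upd_id (upd_eq z1) (upd_eq z2).
apply: (@run_seq _ _ _ 4 3 _ (S 0)).
  rewrite e0; apply: run_loop => //.
    by move=> j _; rewrite /S /= (upd_neq _ _ n2) (upd_neq _ _ n1) upd_same.
  move=> j lj; rewrite /S /=.
  have := run_seq (run_inc (wd g) m (upd (S j.+1).1 r j, o)) (run_inc (wd g) m.+1 _).
  have hr := hb r; congr run; congr pair.
  by rewrite /S /=; updt.
have n2' : m.+1 != r by lia.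
have n1' : m != r by lia.
have := @run_mv (wd g) m.+1 r (S 0) n2'.
rewrite /S /= upd_same (upd_neq _ _ n2) (upd_neq _ _ n1) upd_same subn0 addn0 => /(_ (hb r)).
by congr (run _ _ _ _ (_, _)); updt.
Qed.

Lemma Comp0 rs : Comp rs (fun _ => 0).
Proof.
move=> m ix _ _; exists skip, 0 => g s o [h0 _] _; split=> //.
rewrite upd_eq ?h0 //; exact: run_skip.
Qed.

Lemma Comp_succ rs f : Comp rs f -> Comp rs (fun g => minn (f g).+1 (size (wd g)).+1).
Proof.
move=> hf m ix sz lt; have [c [k H]] := hf m ix sz lt.
exists (Seq c (inc m)), (k + 0).+1 => g s o cl e.
have [le r] := H g s o cl e; split; first exact: geq_minr.
by have := run_seq r (run_inc _ m _); rewrite /= upd_same upd_upd.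
Qed.

Lemma Comp_pred rs f : Comp rs f -> Comp rs (fun g => (f g).-1).
Proof.
move=> hf m ix sz lt; have [c [k H]] := hf m ix sz lt.
exists (Seq c (dec m)), (k + 0).+1 => g s o cl e.
have [le r] := H g s o cl e; split; first exact: leq_trans (leq_pred _) le.
by have := run_seq r (run_dec _ m _); rewrite /= upd_same upd_upd.
Qed.

Lemma Comp_test rs f (q : pred ocell) : Comp rs f -> Comp rs (fun g => q (rd (wd g) (f g))).
Proof.
move=> hf m ix sz lt; have [c [k H]] := hf m ix sz lt.
exists (Seq c (If m q (Seq (clear m) (inc m)) (clear m))), (k + 5).+1 => g s o cl e.
have [le r] := H g s o cl e; split; first by case: (q _).
apply: run_seq r _; apply: run_if; rewrite /= upd_same.
have hc : run (wd g) (clear m) 3 (upd s m (f g), o) (upd s m 0, o).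
  by have := @run_clear (wd g) m (upd s m (f g), o); rewrite /= upd_same upd_upd; apply.
case: (q _); last exact: run_le hc.
by have := run_seq hc (run_inc _ m _); rewrite /= upd_same upd_upd minnSS min0n.
Qed.

Lemma Comp_if rs (b : G -> bool) f h :
  Comp rs b -> Comp rs f -> Comp rs h -> Comp rs (fun g => if b g then f g else h g).
Proof.
move=> hb hf hh m ix sz lt.
have [cb [kb Hb]] := hb m ix sz lt.
have [cf [kf Hf]] := hf m ix sz lt.
have [ch [kh Hh]] := hh m ix sz lt.
(* Both branches expect register [m] to be 0, so the truth value 1 is removed before the first one
   starts. *)
exists (Seq cb (If m nz (Seq (dec m) cf) ch)), (kb + (kf + kh).+2).+1 => g s o cl e.
have [_ rb] := Hb g s o cl e.
have [lf rf] := Hf g s o cl e.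
have [lh rh] := Hh g s o cl e.
split; first by case: (b g).
apply: run_seq rb _; apply: run_if; rewrite nz_rd /= upd_same.
have z : s m = 0 by case: cl => z _; apply: z.
case: (b g) => /=.
  have := run_dec (wd g) m (upd s m 1, o).
  rewrite /= upd_same upd_upd (upd_eq z) => rd; have := run_seq rd rf.
  by apply: run_le; lia.
by rewrite (upd_eq z); apply: run_le rh; lia.
Qed.

Lemma Comp_sub rs f h : Comp rs f -> Comp rs h -> Comp rs (fun g => f g - h g).
Proof.
move=> hf hh m ix sz lt.
have [cf [kf Hf]] := hf m ix sz lt.
have [ch [kh Hh]] := hh m.+1 ix sz (all_ltS lt).
exists (Seq cf (Seq ch (loop m.+1 (dec m)))), (kf + (kh + 3).+1).+1 => g s o cl e.
have [lf rf] := Hf g s o cl e.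
have [||lh rh] := Hh g (upd s m (f g)) o; first exact: clean_upd.
  by rewrite map_upd.
split; first by lia.
apply: run_seq rf _; apply: run_seq rh _.
pose S i := (upd (upd s m (f g - (h g - i))) m.+1 i, o).
have -> : (upd (upd s m (f g)) m.+1 (h g), o) = S (h g) by rewrite /S subnn subn0.
have -> : (upd s m (f g - h g), o) = S 0.
  by rewrite /S subn0 [in RHS]upd_eq // upd_neq; [case: cl => -> //|]; lia.
apply: run_loop => // [i _|i li]; first by rewrite /S /= upd_same.
have := run_dec (wd g) m (upd (S i.+1).1 m.+1 i, o).
by rewrite /S /=; congr (run _ _ _ _ (_, _)); updt.
Qed.

End Comp.

Definition lift1 G (rs : seq (G -> nat)) : seq (G * nat -> nat) :=
  rcons [seq (fun x => r x.1) | r <- rs] snd.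

Definition lift2 G (rs : seq (G -> nat)) : seq (G * nat * nat -> nat) :=
  lift1 (lift1 rs).

Section Fold.
Variables (G : Type) (wd : G -> seq symb).
Implicit Types (rs : seq (G -> nat)) (f h : G -> nat).

(** A right fold suits a loop whose counter runs downwards: the last index is processed first.
    Register [m] is the counter, [m.+1] the accumulator and [m.+2] receives each new value. *)
Lemma Comp_fold rs b f (F : G -> nat -> nat -> nat) :
  Comp wd rs b -> Comp wd rs f ->
  Comp (fun x => wd x.1.1) (lift2 rs) (fun x => F x.1.1 x.1.2 x.2) ->
  Comp wd rs (fun g => foldr (F g) (f g) (iota 0 (b g))).
Proof.
move=> hb hf hF m ix sz lt.
have [cb [kb Hb]] := hb m ix sz lt.
have [cf [kf Hf]] := hf m.+1 ix sz (all_ltS lt).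
have [||cF [kF HF]] := hF m.+2 (rcons (rcons ix m) m.+1).
- by rewrite /lift2 /lift1 !(size_rcons, size_map) sz.
- by rewrite !all_rcons !ltnS leqnn leqnSn /=; apply: all_ltS; apply: all_ltS.
exists (Seq cb (Seq cf (Seq (loop m (Seq cF (Seq (clear m.+1) (mv m.+2 m.+1))))
  (mv m.+1 m)))), (kb + (kf + (((kF + (3 + 3).+1).+1.+3 + 3).+1)).+1).+1 => g s o cl e.
have [lb rb] := Hb g s o cl e.
have [||lf rf] := Hf g (upd s m (b g)) o; first exact: clean_upd.
  by rewrite map_upd.
pose acc i := foldr (F g) (f g) (iota i (b g - i)).
have accS i : i < b g -> acc i = F g i (acc i.+1).
  by move=> li; rewrite /acc; have -> : b g - i = (b g - i.+1).+1 by lia.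
pose st i a := upd (upd s m i) m.+1 a.
have cst i a : i <= (size (wd g)).+1 -> a <= (size (wd g)).+1 -> clean (wd g) m.+2 (st i a).
  by move=> li la; do 2! apply: clean_upd => //.
have mst i a : map (st i a) (rcons (rcons ix m) m.+1) =
    [seq r (g, i, a) | r <- lift2 rs].
  rewrite /lift2 /lift1 !map_rcons -!map_comp /= /st; congr rcons; last by rewrite upd_same.
  congr rcons; last by rewrite upd_neq ?upd_same //; lia.
  rewrite map_upd; last exact: all_ltS.
  by rewrite map_upd.
(* The accumulators stay in range because the computability of [F] includes a bound on its values;
   the induction starts from the largest index. *)
have accb d i : i + d = b g -> acc i <= (size (wd g)).+1.
  elim: d i => [|d IH] i ei; first by rewrite /acc -ei addn0 subnn.
  rewrite accS; last by lia.
  have lacc := IH i.+1 (etrans (addSnnS i d) ei).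
  have li : i <= (size (wd g)).+1 by lia.
  by have [] := HF (g, i, acc i.+1) _ o (cst _ _ li lacc) (mst _ _).
have accb0 i : i <= b g -> acc i <= (size (wd g)).+1.
  by move=> li; apply: (accb (b g - i)); lia.
split; first by have := accb0 0 isT; rewrite /acc subn0.
apply: run_seq rb _; apply: run_seq rf _; case: (cl) => z0 _.
have zm : s m = 0 by apply: z0.
have zm1 : s m.+1 = 0 by apply: z0.
have zm2 : s m.+2 = 0 by apply: z0; lia.
apply: (@run_seq _ _ _ _ _ _ (st 0 (acc 0), o)).
  have -> : (upd (upd s m (b g)) m.+1 (f g), o) = (st (b g) (acc (b g)), o).
    by rewrite /acc subnn.
  apply: (@run_loop _ _ _ _ (fun i => (st i (acc i), o))) => // [i _|i li] /=.
    by rewrite /st upd_neq ?upd_same //; lia.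
  have lacc := accb0 i.+1 li; have lacc' := accb0 i (ltnW li).
  have li' : i <= (size (wd g)).+1 by lia.
  have [_] := HF (g, i, acc i.+1) _ o (cst _ _ li' lacc) (mst _ _) => /=; rewrite -accS //.
  have -> : upd (st i.+1 (acc i.+1)) m i = st i (acc i.+1) by rewrite /st; updt.
  move=> rF; apply: run_seq rF _.
  have := @run_clear (wd g) m.+1 (upd (st i (acc i.+1)) m.+2 (acc i), o).
  have -> : upd (upd (st i (acc i.+1)) m.+2 (acc i), o).1 m.+1 0 = 
    upd (st i 0) m.+2 (acc i) by rewrite /st /=; updt.
  rewrite /= upd_neq; last by lia.
  rewrite {1}/st upd_same => /(_ lacc) rc; apply: run_seq rc _.
  have ne : m.+2 != m.+1 by lia.
  have := @run_mv (wd g) m.+2 m.+1 (upd (st i 0) m.+2 (acc i), o) ne.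
  rewrite /= upd_same upd_neq; last by lia.
  by rewrite /st upd_same addn0 => /(_ lacc'); congr (run _ _ _ _ (_, _)); updt.
have ne : m.+1 != m by lia.
have := @run_mv (wd g) m.+1 m (st 0 (acc 0), o) ne.
rewrite /= /st upd_same upd_neq; last by lia.
rewrite upd_same addn0 => /(_ (accb0 0 isT)); rewrite /acc subn0.
by congr (run _ _ _ _ (_, _)); updt.
Qed.

(** The value of [f] becomes one more input register of the code for [F]; this is how closed
    functions are applied to arguments. *)
Lemma Comp_let rs f (F : G -> nat -> nat) :
  Comp wd rs f -> Comp (fun x => wd x.1) (lift1 rs) (fun x => F x.1 x.2) ->
  Comp wd rs (fun g => F g (f g)).
Proof.
move=> hf hF m ix sz lt.
have [cf [kf Hf]] := hf m ix sz lt.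
have [||cF [kF HF]] := hF m.+1 (rcons ix m).
- by rewrite /lift1 !size_rcons size_map sz.
- by rewrite all_rcons ltnS leqnn /=; apply: all_ltS.
exists (Seq cf (Seq cF (Seq (clear m) (mv m.+1 m)))),
  (kf + (kF + (3 + 3).+1).+1).+1 => g s o cl e.
have [lf rf] := Hf g s o cl e.
have [||/= lF rF] := HF (g, f g) (upd s m (f g)) o; first exact: clean_upd.
  rewrite map_rcons map_upd // upd_same e /lift1 map_rcons -map_comp //.
split=> //; apply: run_seq rf _; apply: run_seq rF _; case: cl => z0 _.
have zm1 : s m.+1 = 0 by apply: z0.
have := @run_clear (wd g) m (upd (upd s m (f g)) m.+1 (F g (f g)), o).
rewrite /= upd_neq; last by lia.
rewrite upd_same => /(_ lf) rc; apply: run_seq rc _.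
have ne : m.+1 != m by lia.
have := @run_mv (wd g) m.+1 m (upd (upd (upd s m (f g)) m.+1 (F g (f g))) m 0, o) ne.
rewrite /= upd_same upd_neq; last by lia.
rewrite upd_same addn0 => /(_ lF).
by congr (run _ _ _ _ (_, _)); updt.
Qed.

Lemma Emits_const rs (t : seq symb) : Emits wd rs (fun _ => t).
Proof.
move=> m ix _ _; elim: t => [|a t [c [k H]]].
  by exists skip, 0 => g s o _ _; exact: run_skip.
exists (Seq c (emit a)), (k + 0).+1 => g s o cl e.
exact: run_seq (H g s o cl e) (run_emit _ _ _).
Qed.

(** Symbols are output from right to left, so the code for [q] runs first. *)
Lemma Emits_cat rs p q : Emits wd rs p -> Emits wd rs q -> Emits wd rs (fun g => p g ++ q g).
Proof.
move=> hp hq m ix sz lt.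
have [cp [kp Hp]] := hp m ix sz lt.
have [cq [kq Hq]] := hq m ix sz lt.
exists (Seq cq cp), (kq + kp).+1 => g s o cl e; rewrite -catA.
exact: run_seq (Hq g s o cl e) (Hp g s _ cl e).
Qed.

Lemma Emits_if rs (b : G -> bool) p q : Comp wd rs b -> Emits wd rs p -> Emits wd rs q ->
  Emits wd rs (fun g => if b g then p g else q g).
Proof.
move=> hb hp hq m ix sz lt.
have [cb [kb Hb]] := hb m ix sz lt.
have [cp [kp Hp]] := hp m ix sz lt.
have [cq [kq Hq]] := hq m ix sz lt.
exists (Seq cb (If m nz (Seq (dec m) cp) cq)), (kb + (kp + kq).+2).+1 => g s o cl e.
have [_ rb] := Hb g s o cl e.
have rp := Hp g s o cl e; have rq := Hq g s o cl e.
apply: run_seq rb _; apply: run_if; rewrite nz_rd /= upd_same.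
have z : s m = 0 by case: cl => z _; apply: z.
case: (b g) => /=.
  have := run_dec (wd g) m (upd s m 1, o).
  rewrite /= upd_same upd_upd (upd_eq z) => rd; have := run_seq rd rp.
  by apply: run_le; lia.
by rewrite (upd_eq z); apply: run_le rq; lia.
Qed.

(** The counter runs downwards and the output grows leftwards; the two reversals cancel and the
    words appear in increasing order. *)
Lemma Emits_for rs b (p : G -> nat -> seq symb) :
  Comp wd rs b -> Emits (fun x => wd x.1) (lift1 rs) (fun x => p x.1 x.2) ->
  Emits wd rs (fun g => flatten [seq p g i | i <- iota 0 (b g)]).
Proof.
move=> hb hp m ix sz lt.
have [cb [kb Hb]] := hb m ix sz lt.
have [||cp [kp Hp]] := hp m.+1 (rcons ix m).
- by rewrite /lift1 !size_rcons size_map sz.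
- by rewrite all_rcons ltnS leqnn /=; apply: all_ltS.
exists (Seq cb (loop m cp)), (kb + kp.+3).+1 => g s o cl e.
have [lb rb] := Hb g s o cl e; apply: run_seq rb _.
pose S i := (upd s m i, flatten [seq p g j | j <- iota i (b g - i)] ++ o).
have -> : (upd s m (b g), o) = S (b g) by rewrite /S subnn.
have z : s m = 0 by case: cl => z _; apply: z.
have -> : (s, flatten [seq p g i | i <- iota 0 (b g)] ++ o) = S 0.
  by rewrite /S subn0 (upd_eq z).
apply: run_loop => // [i _|i li]; first by rewrite /S /= upd_same.
rewrite /S /= upd_upd; have -> : b g - i = (b g - i.+1).+1 by lia.
rewrite /= -catA; apply: (Hp (g, i)); first by apply: clean_upd => //=; lia.
by rewrite /lift1 !map_rcons upd_same map_upd // e -map_comp.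
Qed.

Lemma Emits_let rs f (p : G -> nat -> seq symb) :
  Comp wd rs f -> Emits (fun x => wd x.1) (lift1 rs) (fun x => p x.1 x.2) ->
  Emits wd rs (fun g => p g (f g)).
Proof.
move=> hf hp m ix sz lt.
have [cf [kf Hf]] := hf m ix sz lt.
have [||cp [kp Hp]] := hp m.+1 (rcons ix m).
- by rewrite /lift1 !size_rcons size_map sz.
- by rewrite all_rcons ltnS leqnn /=; apply: all_ltS.
exists (Seq cf (Seq cp (clear m))), (kf + (kp + 3).+1).+1 => g s o cl e.
have [lf rf] := Hf g s o cl e; apply: run_seq rf _.
have [||t ht et] := Hp (g, f g) (upd s m (f g)) o; first exact: clean_upd.
  by rewrite /lift1 !map_rcons upd_same map_upd // e -map_comp.
apply: (run_seq (s2 := (upd s m (f g), p g (f g) ++ o))); first by exists t.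
have z : s m = 0 by case: cl => z _; apply: z.
have := @run_clear (wd g) m (upd s m (f g), p g (f g) ++ o).
by rewrite /= upd_same upd_upd (upd_eq z); apply.
Qed.

End Fold.

(* [sel] lists the registers of the new context that hold the old one. *)
Lemma Comp_sub_context G G' (wd : G -> seq symb) (phi : G' -> G) rs rs' (sel : seq nat) f :
  size sel = size rs -> all (fun i => i < size rs') sel ->
  (forall x, [seq nth (fun _ => 0) rs' i x | i <- sel] = [seq r (phi x) | r <- rs]) ->
  Comp wd rs f -> Comp (fun x => wd (phi x)) rs' (fun x => f (phi x)).
Proof.
move=> hz /allP hs hv hf m ix sz /allP lt.
have hsel i : i \in sel -> i < size ix by move=> /hs; rewrite sz.
have [||c [k H]] := hf m [seq nth 0 ix i | i <- sel]; first by rewrite size_map.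
  by apply/allP => ? /mapP[i /hsel li ->]; apply: lt; exact: mem_nth.
exists c, k => x s o cl e; apply: H => //.
rewrite -hv -map_comp; apply/eq_in_map => i hi /=.
have li := hsel i hi.
rewrite -[LHS](nth_map 0 0 s) // e (nth_map (fun _ => 0)) //; exact: hs.
Qed.

Lemma Emits_sub_context G G' (wd : G -> seq symb) (phi : G' -> G) rs rs' (sel : seq nat) p :
  size sel = size rs -> all (fun i => i < size rs') sel ->
  (forall x, [seq nth (fun _ => 0) rs' i x | i <- sel] = [seq r (phi x) | r <- rs]) ->
  Emits wd rs p -> Emits (fun x => wd (phi x)) rs' (fun x => p (phi x)).
Proof.
move=> hz /allP hs hv hf m ix sz /allP lt.
have hsel i : i \in sel -> i < size ix by move=> /hs; rewrite sz.
have [||c [k H]] := hf m [seq nth 0 ix i | i <- sel]; first by rewrite size_map.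
  by apply/allP => ? /mapP[i /hsel li ->]; apply: lt; exact: mem_nth.
exists c, k => x s o cl e; apply: H => //.
rewrite -hv -map_comp; apply/eq_in_map => i hi /=.
have li := hsel i hi.
rewrite -[LHS](nth_map 0 0 s) // e (nth_map (fun _ => 0)) //; exact: hs.
Qed.

Lemma nth_lift1 G (rs : seq (G -> nat)) i x : i < size rs ->
  nth (fun _ => 0) (lift1 rs) i x = nth (fun _ => 0) rs i x.1.
Proof. by move=> li; rewrite /lift1 nth_rcons size_map li (nth_map (fun _ => 0)). Qed.

Lemma nth_lift1_last G (rs : seq (G -> nat)) i x : i = size rs ->
  nth (fun _ => 0) (lift1 rs) i x = x.2.
Proof. by move=> ->; rewrite /lift1 nth_rcons size_map ltnn eqxx. Qed.

Lemma size_lift1 G (rs : seq (G -> nat)) : size (lift1 rs) = (size rs).+1.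
Proof. by rewrite /lift1 size_rcons size_map. Qed.

Lemma Comp_weak G (wd : G -> seq symb) rs f :
  Comp wd rs f -> Comp (fun x => wd x.1) (lift1 rs) (fun x => f x.1).
Proof.
apply: (@Comp_sub_context _ _ wd fst rs (lift1 rs) (iota 0 (size rs))).
- exact: size_iota.
- by apply/allP => i; rewrite mem_iota size_lift1 => /andP[_ /leqW].
move=> x; rewrite -[in RHS](mkseq_nth (fun _ => 0) rs) /mkseq -map_comp.
by apply/eq_in_map => i; rewrite mem_iota => /andP[_ li] /=; rewrite nth_lift1.
Qed.

Notation word := (seq symb).

(** In this closed form the code depends on the word and the arguments only, and can be plugged into
    any context. *)
Definition Fun1 (F : word -> nat -> nat) : Prop :=
  Comp (fun x : word * nat => x.1) [:: snd] (fun x => F x.1 x.2).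
Definition Fun2 (F : word -> nat -> nat -> nat) : Prop :=
  Comp (fun x : word * nat * nat => x.1.1) [:: (fun x => x.1.2); snd]
    (fun x => F x.1.1 x.1.2 x.2).
Definition Out1 (p : word -> nat -> word) : Prop :=
  Emits (fun x : word * nat => x.1) [:: snd] (fun x => p x.1 x.2).
Definition Out2 (p : word -> nat -> nat -> word) : Prop :=
  Emits (fun x : word * nat * nat => x.1.1) [:: (fun x => x.1.2); snd]
    (fun x => p x.1.1 x.1.2 x.2).
Section Apply.
Variables (G : Type) (wd : G -> word) (rs : seq (G -> nat)).
Variables (a b : G -> nat).
Hypotheses (ha : Comp wd rs a) (hb : Comp wd rs b).

Lemma Comp_app1 F : Fun1 F -> Comp wd rs (fun g => F (wd g) (a g)).
Proof.
move=> hF; apply: (Comp_let (F := fun g => F (wd g))) ha _.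
apply: (@Comp_sub_context _ _ _ (fun x : G * nat => (wd x.1, x.2)) _ _ [:: size rs]) hF => //=.
  by rewrite size_lift1 leqnn.
by move=> x; rewrite nth_lift1_last.
Qed.

Lemma Comp_app2 F : Fun2 F -> Comp wd rs (fun g => F (wd g) (a g) (b g)).
Proof.
move=> hF; apply: (Comp_let (F := fun g v => F (wd g) v (b g))) ha _.
apply: (Comp_let (F := fun x : G * nat => F (wd x.1) x.2)) (Comp_weak hb) _.
apply: (@Comp_sub_context _ _ _ (fun x : G * nat * nat => (wd x.1.1, x.1.2, x.2)) _ _
  [:: size rs; (size rs).+1]) hF => //=.
  by rewrite !size_lift1; lia.
by move=> x; rewrite nth_lift1 ?size_lift1 // !nth_lift1_last ?size_lift1.
Qed.

Lemma Emits_app1 p : Out1 p -> Emits wd rs (fun g => p (wd g) (a g)).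
Proof.
move=> hF; apply: (Emits_let (p := fun g => p (wd g))) ha _.
apply: (@Emits_sub_context _ _ _ (fun x : G * nat => (wd x.1, x.2)) _ _ [:: size rs]) hF => //=.
  by rewrite size_lift1 leqnn.
by move=> x; rewrite nth_lift1_last.
Qed.

Lemma Emits_app2 p : Out2 p -> Emits wd rs (fun g => p (wd g) (a g) (b g)).
Proof.
move=> hF; apply: (Emits_let (p := fun g v => p (wd g) v (b g))) ha _.
apply: (Emits_let (p := fun x : G * nat => p (wd x.1) x.2)) (Comp_weak hb) _.
apply: (@Emits_sub_context _ _ _ (fun x : G * nat * nat => (wd x.1.1, x.1.2, x.2)) _ _
  [:: size rs; (size rs).+1]) hF => //=.
  by rewrite !size_lift1; lia.
by move=> x; rewrite nth_lift1 ?size_lift1 // !nth_lift1_last ?size_lift1.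
Qed.

End Apply.

(** Saturating arithmetic is exact only within the range of a register. The computability of [b]
    provides this range, so the two functions need to agree only there. *)
Lemma Comp_bounded G (wd : G -> word) rs b f h : Comp wd rs b ->
  (forall g, b g <= (size (wd g)).+1 -> f g = h g) -> Comp wd rs f -> Comp wd rs h.
Proof.
move=> hb e hf m ix sz lt.
have [cb [kb Hb]] := hb m ix sz lt; have [c [k H]] := hf m ix sz lt.
exists c, k => g s o cl es; have [lb _] := Hb g s o cl es.
by rewrite -(e g lb); exact: H.
Qed.

Definition sym (w : word) (a : nat) : option symb := onth w a.

(** The mark shifts the word by one cell, so position [a] of the word is cell [a + 1] of the track.
    Saturation sends every position outside the word to the blank. *)
Lemma rd_sym w a (q : pred (option symb)) :
  (if rd w (minn a.+1 (size w).+1) is Some (inl x) then q (Some x) else q None)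
  = q (sym w a).
Proof.
rewrite minnSS /rd /sym /=; case: (ltnP a (size w)) => la.
  by rewrite (nth_map LPar) // onthE (nth_map LPar).
by rewrite nth_default ?size_map // onth_default.
Qed.

Section Derived.
Variables (G : Type) (wd : G -> word) (rs : seq (G -> nat)).
Implicit Types (a b : G -> nat) (p q : G -> bool).

Lemma Comp_true : Comp wd rs (fun _ => true).
Proof. by apply: Comp_ext (Comp_succ (@Comp0 G wd rs)) => g; rewrite minnSS min0n. Qed.

Lemma Comp_false : Comp wd rs (fun _ => false).
Proof. exact: Comp0. Qed.

Lemma Comp_not p : Comp wd rs p -> Comp wd rs (fun g => ~~ p g).
Proof.
move=> hp; apply: Comp_ext (Comp_if hp Comp_false Comp_true) => g.
by case: (p g).
Qed.

Lemma Comp_and p q : Comp wd rs p -> Comp wd rs q -> Comp wd rs (fun g => p g && q g).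
Proof.
move=> hp hq; apply: Comp_ext (Comp_if hp hq Comp_false) => g.
by case: (p g).
Qed.

Lemma Comp_or p q : Comp wd rs p -> Comp wd rs q -> Comp wd rs (fun g => p g || q g).
Proof.
move=> hp hq; apply: Comp_ext (Comp_if hp Comp_true hq) => g.
by case: (p g).
Qed.

Lemma Comp_leq a b : Comp wd rs a -> Comp wd rs b -> Comp wd rs (fun g => a g <= b g).
Proof.
move=> ha hb; apply: Comp_ext (Comp_test (fun x => x == mark) (Comp_sub ha hb)) => g.
by rewrite rd_mark.
Qed.

Lemma Comp_ltn a b : Comp wd rs a -> Comp wd rs b -> Comp wd rs (fun g => a g < b g).
Proof.
move=> ha hb; apply: Comp_ext (Comp_not (Comp_leq hb ha)) => g.
by rewrite -ltnNge.
Qed.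

Lemma Comp_eq a b : Comp wd rs a -> Comp wd rs b -> Comp wd rs (fun g => a g == b g).
Proof.
move=> ha hb; apply: Comp_ext (Comp_and (Comp_leq ha hb) (Comp_leq hb ha)) => g.
by rewrite eqn_leq.
Qed.

Lemma Comp_sym a (q : pred (option symb)) :
  Comp wd rs a -> Comp wd rs (fun g => q (sym (wd g) (a g))).
Proof.
move=> ha; apply: Comp_ext (Comp_test
  (fun x => if x is Some (inl y) then q (Some y) else q None) (Comp_succ ha)) => g.
by rewrite rd_sym.
Qed.

(** A count never exceeds the number of tested indices, so the saturating successor is exact
    here. *)
Lemma Comp_count b (p : G -> nat -> bool) : Comp wd rs b ->
  Comp (fun x => wd x.1) (lift1 rs) (fun x => p x.1 x.2) ->
  Comp wd rs (fun g => count (p g) (iota 0 (b g))).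
Proof.
move=> hb hp.
pose F g i acc := if p g i then minn acc.+1 (size (wd g)).+1 else acc.
have hF : Comp (fun x => wd x.1.1) (lift2 rs) (fun x => F x.1.1 x.1.2 x.2).
  have hv : Comp (fun x => wd x.1.1) (lift2 rs) (fun x : G * nat * nat => x.2).
    have := @Comp_var _ (fun x => wd x.1.1) (lift2 rs) (size rs).+1.
    rewrite /lift2 !size_lift1 ltnSn => /(_ isT); apply: Comp_ext => x.
    by rewrite nth_lift1_last ?size_lift1.
  exact: Comp_if (Comp_weak hp) (Comp_succ hv) hv.
apply: (Comp_bounded hb) (Comp_fold hb (@Comp0 G wd rs) hF) => g.
move: (b g) => k lk.
have aux l : size l <= (size (wd g)).+1 -> foldr (F g) 0 l = count (p g) l.
  elim: l => //= i l IH lt; rewrite /F IH; last exact: ltnW.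
  case: (p g i) => //; rewrite add1n (minn_idPl _) //.
  by apply: leq_trans lt; rewrite ltnS count_size.
by rewrite aux // size_iota.
Qed.

Lemma Comp_all b (p : G -> nat -> bool) : Comp wd rs b ->
  Comp (fun x => wd x.1) (lift1 rs) (fun x => p x.1 x.2) ->
  Comp wd rs (fun g => all (p g) (iota 0 (b g))).
Proof.
move=> hb hp; apply: Comp_ext (Comp_eq (Comp_count hb hp) hb) => g.
by rewrite all_count size_iota.
Qed.

Lemma Comp_has b (p : G -> nat -> bool) : Comp wd rs b ->
  Comp (fun x => wd x.1) (lift1 rs) (fun x => p x.1 x.2) ->
  Comp wd rs (fun g => has (p g) (iota 0 (b g))).
Proof.
move=> hb hp; apply: Comp_ext (Comp_ltn (@Comp0 G wd rs) (Comp_count hb hp)) => g.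
by rewrite has_count.
Qed.

(** The head runs to the first blank; all other loops count a register down. *)
Lemma Comp_size : Comp wd rs (fun g => (size (wd g)).+1).
Proof.
move=> m ix _ _; exists (While m (fun x => x != None) (inc m)), 2 => g s o [z hb] _.
split=> //; set w := wd g in z hb *.
have fill d s' : s' m + d = (size w).+1 -> exec w (While m (fun x => x != None) (inc m))
    (s', o) (2 * d).+1 (upd s' m (size w).+1, o).
  elim: d s' => [|d IH] s' e.
    rewrite upd_eq; last by lia.
    by apply: ExWhile0; rewrite rd_blank /=; apply/negPn/eqP; lia.
  have nb : rd w (s' m) != None by rewrite rd_blank; [apply/eqP; lia|lia].
  have -> : (2 * d.+1).+1 = (1 + (2 * d).+1).+1 by lia.
  have ei := ExAct w m (fun _ => (MoveR, None)) (s', o).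
  apply: ExWhile nb ei _; rewrite /act_state /= (minn_idPl _); last by lia.
  by have := IH (upd s' m (s' m).+1); rewrite upd_same upd_upd; apply; lia.
exists (2 * (size w).+1).+1; first by rewrite expnS expn1; nia.
by apply: fill; rewrite z.
Qed.
End Derived.

(** * From printers to machines *)

Lemma compile_regs c base next base' next' :
  [seq i.1 | i <- compile c base next] = [seq i.1 | i <- compile c base' next'].
Proof.
elim: c base next base' next' => //= [c1 IH1 c2 IH2|r b c1 IH1 c2 IH2|r b c IH] x y x' y'.
- by rewrite !map_cat; congr cat; [exact: IH1|exact: IH2].
- by rewrite !map_cat; congr (_ :: _ ++ _); [exact: IH1|exact: IH2].
- by congr cons; exact: IH.
Qed.

Definition max_reg (c : cmd) : nat := foldr maxn 0 [seq i.1 | i <- compile c 0 0].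

Lemma max_reg_seq c1 c2 : max_reg (Seq c1 c2) = maxn (max_reg c1) (max_reg c2).
Proof.
rewrite /max_reg /= map_cat (compile_regs c1 _ _ 0 0) (compile_regs c2 _ _ 0 0).
elim: [seq _ | i <- compile c1 0 0] => [|a l IH]; first by rewrite /= max0n.
by rewrite /= IH maxnA.
Qed.

(** A loaded machine has its registers at the first blank, whereas printers are specified for
    registers that are 0. *)
Fixpoint reset (n : nat) (c : cmd) : cmd :=
  if n is n'.+1 then reset n' (Seq (clear n') c) else c.

Lemma max_reg_reset n c : n <= (max_reg c).+1 -> max_reg (reset n c) = max_reg c.
Proof.
elim: n c => //= n IH c le.
have e : max_reg (Seq (clear n) c) = max_reg c.
  by rewrite max_reg_seq /max_reg /= !maxn0 -/(max_reg c) maxnn; lia.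
by rewrite IH e // ltnW.
Qed.

Lemma run_reset w n c k s s' : (forall i, s.1 i <= (size w).+1) ->
  run w c k (fun i => if i < n then 0 else s.1 i, s.2) s' ->
  run w (reset n c) (k + 4 * n) s s'.
Proof.
move=> hb; elim: n c k => [|n IH] c k hr.
  by rewrite muln0 addn0; case: s hr hb.
have -> : k + 4 * n.+1 = (3 + k).+1 + 4 * n by lia.
apply: IH; apply: run_seq hr.
have := @run_clear w n (fun i => if i < n then 0 else s.1 i, s.2).
rewrite /= ltnn => /(_ (hb n)); congr (run _ _ _ _ (_, _)).
apply: functional_extensionality => i; rewrite /upd.
have -> : (i < n.+1) = (i == n) || (i < n) by lia.
by case: eqP.
Qed.

Theorem Emits_machine G (wd : G -> word) p : Emits wd [::] p ->
  exists (M : TM symb) (k : nat), forall g, tm_computes M (wd g) ((size (wd g) + 2) ^ k) (p g).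
Proof.
move=> hp; have [//|//|c [k H]] := hp 0 [::].
pose K := (max_reg c).+1; pose c' := reset K c.
pose code := compile c' 0 (size (compile c' 0 0)).
have sz : size code = size (compile c' 0 0) by exact: size_compile.
exists (machine code), (k + 4 * K + 3) => g; set w := wd g.
(* [clean] speaks of all indices. Indices beyond the registers of the machine can be taken to be 0
   from the start, since only the first [K] are cleared. *)
pose s0 i := if i < nregs code then (size w).+1 else 0.
have hK : nregs code = K.
  by rewrite /nregs (compile_regs _ _ _ 0 0) -/(max_reg c') max_reg_reset.
have [t ht e] : run w c' (k + 4 * K) (s0, [::]) (fun _ => 0, p g).
  apply: run_reset => [i|] /=; first by rewrite /s0; case: ifP.
  have := H g (fun _ => 0) [::]; rewrite cats0 => /(_ _ erefl) r.
  have {r} := r (conj (fun _ _ => erefl) (fun _ => leq0n _)); congr (run _ _ _ (_, _) _).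
  by apply: functional_extensionality => i; rewrite /s0 hK; case: (i < K).
have lc : code_at code 0 code by exists [::], [::]; rewrite cats0.
have := compileP e lc; rewrite -[size (compile c' 0 0)]sz => /(_ (leqnn _)) hi.
have hs0 i : i < nregs code -> s0 i = (size w).+1 by rewrite /s0 => ->.
have [t' ht' r] := machineP hs0 hi; exists t' => //; apply: leq_trans ht' _.
have -> : k + 4 * K + 3 = (k + 4 * K + 2).+1 by lia.
apply: leq_trans (expN_add w (k + 4 * K) 2); rewrite -addnA leq_add //.
by rewrite expnS expn1; nia.
Qed.

(** * The object system simulating a list of rules *)

Lemma perm_msetD (K : choiceType) (A B : {mset K}) : perm_eq (A `+` B) (A ++ B).
Proof.
apply/allP => x _ /=; rewrite count_cat !count_mem_mset; apply/eqP.
by rewrite /msetD msetE2.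
Qed.

Lemma msetDE (K : choiceType) (A B : {mset K}) x : (A `+` B) x = A x + B x.
Proof. by rewrite msetE2. Qed.

Lemma msetBE (K : choiceType) (A B : {mset K}) x : (A `\` B) x = A x - B x.
Proof. by rewrite msetE2. Qed.

Lemma enum_mset1 (K : choiceType) (a : K) : [mset a] = [:: a] :> seq K.
Proof. exact: enum_msetn. Qed.

Section CounterNet.
Variable Q : finType.

(* [None] is an isolated transition, so that the net is nonempty even if [Q] is
   empty; [Some (inl q)] removes a token from [q], [Some (inr q)] adds one. *)
Definition cnet : PN :=
  @MkPN Q (option (Q + Q)%type)
    (fun q t => if t is Some (inl q') then q' == q : nat else 0)
    (fun t q => if t is Some (inr q') then q' == q : nat else 0).

(** With one removing and one adding transition per place, any pair of vectors is the preset and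
    postset of a multiset of transitions, and the pair can be read off its multiplicities. *)
Definition theta (a b : vec Q) : {ffun trans cnet -> nat} :=
  [ffun t : option (Q + Q)%type =>
     match t with None => 0 | Some (inl q) => a q | Some (inr q) => b q end].

Lemma theta_pre a b (q : Q) : \sum_(u : trans cnet) theta a b u * pn_pre u q = a q.
Proof.
rewrite (bigD1 (Some (inl q) : trans cnet)) //= big1 => [|[[q'|q']|] ne];
  rewrite /theta /pn_pre !ffunE ?muln0 //=.
  by rewrite eqxx muln1 addn0.
by case: (eqVneq q' q) ne => [->|]; rewrite ?eqxx ?muln0.
Qed.

Lemma theta_post a b (q : Q) : \sum_(u : trans cnet) theta a b u * pn_post u q = b q.
Proof.
rewrite (bigD1 (Some (inr q) : trans cnet)) //= big1 => [|[[q'|q']|] ne];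
  rewrite /theta /pn_post !ffunE ?muln0 //=.
  by rewrite eqxx muln1 addn0.
by case: (eqVneq q' q) ne => [->|]; rewrite ?eqxx ?muln0.
Qed.

End CounterNet.

(** These six elements serve twice: as the system places for tuples, and as the places of the object
    net of the control token. *)
Definition slot := 'I_6.
Definition splace : finType := option slot.
Definition kind : finType := (option slot * option slot)%type.

(** Without a target the tuple returns to its source, so that no transition lowers the number of
    tuples. *)
Definition dest (k : kind) : option slot := if k.2 is Some q then Some q else k.1.

(* Every proper transition keeps the control token, may take a nested token from
   the place [k.1] and puts one back to the place [dest k]. *)
Definition sysnet : PN :=
  @MkPN splace (splace + kind)%type
    (fun p t => match t with
                | inl p' => p == p' : nat
                | inr k => (p == None) || (p == k.1) : nat
                end)
    (fun t p => match t with
                | inl p' => p == p' : nat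
                | inr k => (p == None) || (p == dest k) : nat
                end).

Definition styping (p : place sysnet) : option bool :=
  if p is Some _ then Some true else Some false.

(** * Markings and steps of the object system of a list of rules *)

Section System.
Variable P : finType.

Definition nets (b : bool) : PN := if b then cnet P else cnet slot.

Definition rule : choiceType := (kind * (vec slot * vec slot) * (vec P * vec P))%type.
Definition r_kind (r : rule) : kind := r.1.1.
Definition r_from (r : rule) : vec slot := r.1.2.1.
Definition r_to (r : rule) : vec slot := r.1.2.2.
Definition r_take (r : rule) : vec P := r.2.1.
Definition r_give (r : rule) : vec P := r.2.2.

Definition ev_theta (r : rule) (k : option bool) : {ffun trans (obj_family nets k) -> nat} :=
  match k return {ffun trans (obj_family nets k) -> nat} with
  | None => [ffun _ => 0]
  | Some true => theta (r_take r) (r_give r)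
  | Some false => theta (r_from r) (r_to r)
  end.

Definition ev_of (r : rule) : event_of sysnet nets :=
  (inr (r_kind r), [ffun k => ev_theta r k]).

Variable L : seq rule.

Definition evs : {fset event_of sysnet nets} := seq_fset tt [seq ev_of r | r <- L].

Lemma nets_nonemptyP (b : bool) : 0 < #|place (nets b)| + #|trans (nets b)|.
Proof. by case: b; rewrite /= card_option addnS. Qed.

Definition sidle (p : place sysnet) : trans sysnet := inl p.

Lemma sidle_pre (p : place sysnet) : pn_pre (sidle p) = unitv p.
Proof. by []. Qed.

Lemma sidle_post (p : place sysnet) : pn_post (sidle p) = unitv p.
Proof. by []. Qed.

(** Vacuous, since every event has a proper system transition; thus no object net ever fires on its
    own. *)
Lemma evs_idle (ev : event_of sysnet nets) (p : place sysnet) :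
  ev \in evs -> ev.1 = sidle p -> exists u, 0 < ev.2 (styping p) u.
Proof. by rewrite seq_fsetE => /mapP[r _ ->]. Qed.

Definition sim_eos : EOS :=
  @MkEOS sysnet bool nets nets_nonemptyP styping sidle sidle_pre sidle_post evs evs_idle.

Definition ctl (s : vec slot) : nested sim_eos :=
  Tagged (@token_marking sim_eos) (i := None : place (sys sim_eos)) s.
Definition tok (q : slot) (m : vec P) : nested sim_eos :=
  Tagged (@token_marking sim_eos) (i := Some q : place (sys sim_eos)) m.

Definition store := slot -> {mset vec P}.

(** Normal form of the markings with exactly one control token; all reachable markings are of this
    kind. *)
Definition mk (s : vec slot) (A : store) : marking sim_eos :=
  seq_mset (ctl s :: flatten [seq [seq tok q m | m <- (A q : {mset _})] | q <- enum slot]).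

Lemma nestedP (x : nested sim_eos) : (exists s, x = ctl s) \/ (exists q m, x = tok q m).
Proof. by case: x => [[q|] v]; [right; exists q, v|left; exists v]. Qed.

Lemma ctl_inj s s' : (ctl s == ctl s') = (s == s').
Proof. by rewrite eq_Tagged. Qed.

Lemma tok_inj q m m' : (tok q m == tok q m') = (m == m').
Proof. by rewrite eq_Tagged. Qed.

Lemma tok_neq q q' m m' : q != q' -> (tok q m == tok q' m') = false.
Proof. by move=> ne; apply/eqP => /(congr1 tag) [] /eqP; rewrite (negbTE ne). Qed.

Lemma mk_ctl s A s' : mk s A (ctl s') = (s' == s).
Proof.
rewrite /mk mset_seqE /= ctl_inj eq_sym (_ : count _ _ = 0) ?addn0 //.
apply/count_memPn/flattenP => -[? /mapP[q _ ->]] /mapP[m _] /(congr1 tag) //.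
Qed.

Lemma mk_tok s A q m : mk s A (tok q m) = A q m.
Proof.
rewrite /mk mset_seqE /=.
rewrite add0n count_flatten -map_comp sumnE big_map big_enum /=.
rewrite (bigD1 q) //= big1 => [|q' ne].
  rewrite addn0 count_map -[RHS]count_mem_mset; apply: eq_count => m' /=.
  by rewrite tok_inj.
rewrite count_map (eq_count (a2 := pred0)) ?count_pred0 // => m' /=.
by rewrite tok_neq.
Qed.

Lemma mkP (mu : marking sim_eos) s (A : store) :
  (forall s', mu (ctl s') = (s' == s)) -> (forall q m, mu (tok q m) = A q m) -> mu = mk s A.
Proof.
move=> h1 h2; apply/msetP => x; case: (nestedP x) => [[s' ->]|[q [m ->]]].
  by rewrite h1 mk_ctl.
by rewrite h2 mk_tok.
Qed.

Lemma Pi1D (mu nu : marking sim_eos) p : Pi1 (mu `+` nu) p = Pi1 mu p + Pi1 nu p.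
Proof. by rewrite !ffunE (permP (perm_msetD _ _)) count_cat. Qed.

Lemma Pi2D k (mu nu : marking sim_eos) q : Pi2 k (mu `+` nu) q = Pi2 k mu q + Pi2 k nu q.
Proof. by rewrite !ffunE (perm_big _ (perm_msetD _ _)) big_cat. Qed.

Definition somet (a : option slot) (m : vec P) : marking sim_eos :=
  if a is Some q then [mset tok q m] else mset0.

Definition somev (a : option slot) (m : vec P) : vec P :=
  if a is Some _ then m else [ffun _ => 0].

Lemma Pi1_ctl s p : Pi1 ([mset ctl s] : marking sim_eos) p = (p == None).
Proof. by rewrite ffunE enum_mset1 /= addn0 eq_sym. Qed.

Lemma Pi1_somet a m p : Pi1 (somet a m) p = (p != None) && (p == a).
Proof.
rewrite ffunE; case: a => [q|] /=; first by rewrite enum_mset1 /= addn0 eq_sym; case: p.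
by rewrite enum_mset0 /= andNb.
Qed.

Lemma Pi2_ctl_C s q : @Pi2 sim_eos (Some false) ([mset ctl s] : marking sim_eos) q = s q.
Proof. by rewrite ffunE enum_mset1 big_seq1; exact: (@untagE _ _ _ _ _ _ _ erefl). Qed.

Lemma Pi2_ctl_N s q : @Pi2 sim_eos (Some true) ([mset ctl s] : marking sim_eos) q = 0.
Proof. by rewrite ffunE enum_mset1 big_seq1 untag_dflt. Qed.

Lemma Pi2_tok_C a m q : @Pi2 sim_eos (Some false) (somet a m) q = 0.
Proof.
rewrite ffunE; case: a => [q'|] /=; last by rewrite enum_mset0 big_nil.
by rewrite enum_mset1 big_seq1 untag_dflt.
Qed.

Lemma Pi2_tok_N a m q : @Pi2 sim_eos (Some true) (somet a m) q = somev a m q.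
Proof.
rewrite ffunE; case: a => [q'|] /=; last by rewrite enum_mset0 big_nil ffunE.
by rewrite enum_mset1 big_seq1; exact: (@untagE _ _ _ _ _ _ _ erefl).
Qed.

Lemma Pi1_mem (mu : marking sim_eos) x : x \in mu -> 0 < Pi1 mu (tag x).
Proof.
by move=> hx; rewrite ffunE -has_count; apply/hasP; exists x; rewrite /= ?eqxx.
Qed.

Lemma Pi1_pick (mu : marking sim_eos) p : 0 < Pi1 mu p ->
  exists x nu, [/\ tag x = p, mu = x +` nu &
    forall p', Pi1 mu p' = (p == p') + Pi1 nu p'].
Proof.
rewrite ffunE -has_count => /hasP[x hx /eqP tx]; exists x, (mu `\ x).
have e : mu = x +` (mu `\ x) by rewrite msetB1K.
by split=> // p'; rewrite {1}e Pi1D ffunE enum_mset1 /= tx addn0.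
Qed.

(** The projection leaves room for the control token and at most one tuple. After picking these, the
    rest projects to zero and is empty. *)
Lemma Pi1_shape (lam : marking sim_eos) (a : option slot) :
  (forall p, Pi1 lam p = ((p == None) || (p == a) : nat)) ->
  exists s m, lam = [mset ctl s] `+` somet a m.
Proof.
move=> h.
have [|x [nu [tx elam hnu]]] := @Pi1_pick lam None; first by rewrite h.
have [[s ex]|[q [m ex]]] := nestedP x; last by rewrite ex in tx.
have {}hnu p : Pi1 nu p = (p != None) && (p == a) :> nat.
  by have := hnu p; rewrite h eq_sym; case: (p) (a) => [?|] [?|] /=; lia.
exists s; rewrite elam ex; case: a h hnu => [q|] h hnu.
  have [|y [nu' [ty enu hnu']]] := @Pi1_pick nu (Some q); first by rewrite hnu /= eqxx.
  have [[s' ey]|[q' [m ey]]] := nestedP y; first by rewrite ey in ty.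
  rewrite ey in ty; case: ty => eq; exists m; rewrite enu ey eq.
  have -> : nu' = mset0; last by rewrite msetD0.
  apply/msetP => z; rewrite mset0E; apply/mset_eq0P/negP => /Pi1_mem.
  have := hnu' (tag z); rewrite hnu (eq_sym (Some q)).
  by case: (tag z) => [?|] /=; [case: (_ == _)|] => /=; lia.
exists [ffun _ => 0] => /=; have -> : nu = mset0; last by rewrite msetD0.
apply/msetP => z; rewrite mset0E; apply/mset_eq0P/negP => /Pi1_mem.
by rewrite hnu; case: (tag z).
Qed.

Lemma pre_C r : @event_pre sim_eos (ev_of r) (Some false) = r_from r.
Proof.
apply/ffunP => q; rewrite ffunE -[RHS](theta_pre _ (r_to r)).
by apply: eq_bigr => u _; rewrite ffunE.
Qed.
Lemma pre_N r : @event_pre sim_eos (ev_of r) (Some true) = r_take r.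
Proof.
apply/ffunP => q; rewrite ffunE -[RHS](theta_pre _ (r_give r)).
by apply: eq_bigr => u _; rewrite ffunE.
Qed.
Lemma post_C r : @event_post sim_eos (ev_of r) (Some false) = r_to r.
Proof.
apply/ffunP => q; rewrite ffunE -[RHS](theta_post (r_from r)).
by apply: eq_bigr => u _; rewrite ffunE.
Qed.
Lemma post_N r : @event_post sim_eos (ev_of r) (Some true) = r_give r.
Proof.
apply/ffunP => q; rewrite ffunE -[RHS](theta_post (r_take r)).
by apply: eq_bigr => u _; rewrite ffunE.
Qed.

Definition fire (a b m : vec P) : vec P := vadd (vsub m a) b.

(** As each side contains one control token and at most one tuple, and these have different types,
    the summed equations of the firing rule become equations between single markings. *)
Lemma modeP r (lam rho : marking sim_eos) :
  @eos_mode sim_eos (ev_of r) lam rho <->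
  exists s m s' m', [/\ lam = [mset ctl s] `+` somet (r_kind r).1 m,
    rho = [mset ctl s'] `+` somet (dest (r_kind r)) m',
    vle (r_from r) s, s' = vadd (vsub s (r_from r)) (r_to r) &
    vle (r_take r) (somev (r_kind r).1 m) /\
    somev (dest (r_kind r)) m' = fire (r_take r) (r_give r) (somev (r_kind r).1 m)].
Proof.
split=> [[h1 h2 h3]|[s [m [s' [m' [[-> -> hle ->] [hle' hm']]]]]]].
  have [|s [m el]] := @Pi1_shape lam (r_kind r).1; first by move=> p; rewrite h1 ffunE.
  have [|s' [m' er]] := @Pi1_shape rho (dest (r_kind r)); first by move=> p; rewrite h2 ffunE.
  exists s, m, s', m'.
  have [] := h3 (Some false); rewrite pre_C post_C el er => c1 c2.
  have [] := h3 (Some true); rewrite pre_N post_N el er => n1 n2.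
  have eC s1 a m1 : @Pi2 sim_eos (Some false) ([mset ctl s1] `+` somet a m1) = s1.
    by apply/ffunP => q; rewrite Pi2D Pi2_ctl_C Pi2_tok_C addn0.
  have eN s1 a m1 : @Pi2 sim_eos (Some true) ([mset ctl s1] `+` somet a m1) = somev a m1.
    by apply/ffunP => q; rewrite Pi2D Pi2_ctl_N Pi2_tok_N.
  by rewrite !eC !eN in c1 c2 n1 n2.
have e1 s1 a m1 : Pi1 ([mset ctl s1] `+` somet a m1) =
    [ffun p => ((p == None) || (p == a) : nat)].
  by apply/ffunP => p; rewrite Pi1D Pi1_ctl Pi1_somet ffunE; case: (p == None).
have eC s1 a m1 : @Pi2 sim_eos (Some false) ([mset ctl s1] `+` somet a m1) = s1.
  by apply/ffunP => q; rewrite Pi2D Pi2_ctl_C Pi2_tok_C addn0.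
have eN s1 a m1 : @Pi2 sim_eos (Some true) ([mset ctl s1] `+` somet a m1) = somev a m1.
  by apply/ffunP => q; rewrite Pi2D Pi2_ctl_N Pi2_tok_N.
split; first by rewrite e1; apply/ffunP => p; rewrite !ffunE.
  by rewrite e1; apply/ffunP => p; rewrite !ffunE.
case=> [[]|].
- by rewrite pre_N post_N !eN.
- by rewrite pre_C post_C !eC.
split; first by case.
by apply/ffunP; case.
Qed.

Definition put (A : store) (a : option slot) (m : vec P) : store :=
  if a is Some q then fun x => if x == q then m +` A x else A x else A.
Definition rem (A : store) (a : option slot) (m : vec P) : store :=
  if a is Some q then fun x => if x == q then A x `\ m else A x else A.

Lemma putE A a m q x : put A a m q x = A q x + ((a == Some q) && (x == m)).
Proof.
case: a => [q'|] /=; last by rewrite addn0.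
by rewrite (inj_eq Some_inj) eq_sym; case: (q' == q); rewrite ?addn0 // mset1DE addnC.
Qed.

Lemma remE A a m q x : rem A a m q x = A q x - ((a == Some q) && (x == m)).
Proof.
case: a => [q'|] /=; last by rewrite subn0.
by rewrite (inj_eq Some_inj) eq_sym; case: (q' == q); rewrite ?subn0 // msetB1E.
Qed.

Definition present (A : store) (a : option slot) (m : vec P) : Prop :=
  if a is Some q then m \in A q else True.

Lemma mk_fire s s' A a b m m' : present A a m ->
  ([mset ctl s] `+` somet a m) `<=` mk s A /\
  (mk s A `\` ([mset ctl s] `+` somet a m)) `+` ([mset ctl s'] `+` somet b m') =
    mk s' (put (rem A a m) b m').
Proof.
have nc q m1 s1 : (ctl s1 == tok q m1) = false by apply/eqP => /(congr1 tag).
have nt q m1 s1 : (tok q m1 == ctl s1) = false by apply/eqP => /(congr1 tag).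
have so a' m1 s1 : somet a' m1 (ctl s1) = 0.
  by case: a' => [q|]; rewrite /= ?mset0E // msetnE nc.
move=> pr; split.
  apply/msubsetP => x; case: (nestedP x) => [[s1 ->]|[q [m1 ->]]].
    by rewrite msetDE mk_ctl so addn0 msetnE ctl_inj.
  rewrite msetDE mk_tok msetnE nt add0n; case: a pr => [q'|] /= pr; last by rewrite mset0E.
  rewrite msetnE; have [e|ne] := eqVneq q q'; last by rewrite tok_neq.
  by rewrite e tok_inj; case: eqP => // ->; rewrite -in_mset.
apply: mkP => [s1|q m1]; rewrite !(msetDE, msetBE).
  by rewrite mk_ctl !so !msetnE !ctl_inj !addn0; do 2! case: eqP.
rewrite mk_tok !msetnE !nt !add0n.
have st a' m2 : somet a' m2 (tok q m1) = (a' == Some q) && (m1 == m2) :> nat.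
  case: a' => [q'|] /=; last by rewrite mset0E.
  rewrite msetnE (inj_eq Some_inj) eq_sym; have [->|ne] := eqVneq q' q.
    by rewrite tok_inj eq_sym; case: eqP.
  by rewrite tok_neq // eq_sym.
by rewrite !st putE remE.
Qed.

Lemma eos_step_fire r A m m' : r \in L -> present A (r_kind r).1 m ->
  vle (r_take r) (somev (r_kind r).1 m) ->
  somev (dest (r_kind r)) m' = fire (r_take r) (r_give r) (somev (r_kind r).1 m) ->
  @eos_step sim_eos (mk (r_from r) A) (mk (r_to r) (put (rem A (r_kind r).1 m) (dest (r_kind r)) m')).
Proof.
move=> hr pr ht hm; have [h1 h2] := mk_fire (r_from r) (r_to r) (dest (r_kind r)) m' pr.
exists (ev_of r), ([mset ctl (r_from r)] `+` somet (r_kind r).1 m),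
  ([mset ctl (r_to r)] `+` somet (dest (r_kind r)) m').
split; [by rewrite seq_fsetE map_f|exact: h1| |by rewrite h2].
apply/modeP; exists (r_from r), m, (r_to r), m'; split=> //.
by apply/ffunP => x; rewrite !ffunE subnn.
Qed.

(** Enabledness only gives [r_from r] below the control marking; equality comes later, from the
    antichain of states. *)
Lemma eos_step_inv s A mu : @eos_step sim_eos (mk s A) mu ->
  exists r m m', [/\ r \in L, vle (r_from r) s, present A (r_kind r).1 m,
    vle (r_take r) (somev (r_kind r).1 m) /\
    somev (dest (r_kind r)) m' = fire (r_take r) (r_give r) (somev (r_kind r).1 m) &
    mu = mk (vadd (vsub s (r_from r)) (r_to r)) (put (rem A (r_kind r).1 m) (dest (r_kind r)) m')].
Proof.
case=> ev [lam [rho [hev hle hmode ->]]].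
move: hev; rewrite seq_fsetE => /mapP[r hr eev]; rewrite eev in hmode.
have [s1 [m [s2 [m' [[el er hs hs2] [ht hm]]]]]] := (modeP r lam rho).1 hmode.
have es : s1 = s.
  have := msubsetP hle (ctl s1); rewrite mk_ctl el msetDE msetnxx.
  by case: eqP.
subst s1; exists r, m, m'.
have pr : present A (r_kind r).1 m.
  case ek : (r_kind r).1 => [q|] //=.
  have := msubsetP hle (tok q m); rewrite mk_tok el msetDE ek /= msetnxx addnC.
  by rewrite in_mset; apply: leq_trans.
split=> //; rewrite el er hs2.
by have [_ ->] := mk_fire s (vadd (vsub s (r_from r)) (r_to r)) (dest (r_kind r)) m' pr.
Qed.

(** A proper transition always returns the control token, and if it consumes a tuple then [dest] is
    a tuple place. *)
Lemma sim_conservative : conservative sim_eos.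
Proof.
move=> t; apply/subsetP => k /imsetP[p]; rewrite inE ffunE => hp ->.
case: t hp => [p'|k'] /= hp.
  by apply/imsetP; exists p; rewrite ?inE ?ffunE.
case: p hp => [q|] /= hp.
  apply/imsetP; exists (dest k').
    by rewrite inE ffunE /= eqxx orbT.
  by rewrite /dest; case: k' hp => [[q'|] [q2|]].
by apply/imsetP; exists None; rewrite ?inE ?ffunE.
Qed.

End System.

(** * Monotonicity of nu-nets with transfers *)

Lemma seq_mset_cons (K : choiceType) (a : K) s : seq_mset (a :: s) = a +` seq_mset s.
Proof. by apply/msetP => x; rewrite mset1DE !mset_seqE /= eq_sym. Qed.

Lemma seq_mset_cat (K : choiceType) (s s' : seq K) :
  seq_mset (s ++ s') = seq_mset s `+` seq_mset s'.
Proof. by apply/msetP => x; rewrite msetDE !mset_seqE count_cat. Qed.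

Lemma seq_mset_nil (K : choiceType) : seq_mset [::] = mset0 :> {mset K}.
Proof. by apply/msetP => x; rewrite mset_seqE mset0E. Qed.

Lemma seq_mset1 (K : choiceType) (a : K) : seq_mset [:: a] = [mset a].
Proof. by rewrite seq_mset_cons seq_mset_nil msetD0. Qed.

Lemma big_mset_seq (T : finType) (K : choiceType) (F : T -> K) :
  \big[msetD/mset0]_(x : T) [mset F x] = seq_mset [seq F x | x <- enum T].
Proof.
rewrite /index_enum -enumT; elim: (enum T) => [|x s IH]; first by rewrite big_nil seq_mset_nil.
by rewrite big_cons IH /= seq_mset_cons.
Qed.

Lemma big_mset_fset (I K : choiceType) (A : {fset I}) (F : I -> K) :
  \big[msetD/mset0]_(x : A) [mset F (val x)] = seq_mset [seq F x | x <- enum_fset A].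
Proof. by rewrite big_mset_seq enum_fsetE -map_comp. Qed.

(** * Domination between multisets *)

Section MsetOrder.
Variables (K : choiceType) (le : K -> K -> Prop).
Implicit Types (m u : K) (A B C X : {mset K}).

(** A list of matched pairs and a rest. The relation is a parameter because both the configurations
    of the net and the markings of the object system are compared in this way. *)
Definition mle A B : Prop := exists (l : seq (K * K)) (X : {mset K}),
  [/\ A = seq_mset (unzip1 l), B = seq_mset (unzip2 l) `+` X &
    forall x, x \in l -> le x.1 x.2].

Lemma mle0 B : mle mset0 B.
Proof. by exists [::], B; split; rewrite ?seq_mset_nil ?mset0D. Qed.

(** Makes the order accessible to induction over the smaller multiset; most later facts about it are
    derived in this way. *)
Lemma mle_cons m A B :
  mle (m +` A) B <-> exists u C, [/\ B = u +` C, le m u & mle A C].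
Proof.
split=> [[l [X [e -> hl]]]|[u [C [-> mu [l [X [-> -> hl]]]]]]]; last first.
  exists ((m, u) :: l), X; split; rewrite /= ?seq_mset_cons ?msetDA //.
  by move=> x; rewrite inE => /predU1P[->|/hl].
have : m \in unzip1 l.
  have := perm_mem (perm_eq_seq_mset (unzip1 l)) m; rewrite -e => <-.
  exact: mset1D1.
case/mapP=> -[m' u] ml /= em; subst m'.
have pl := perm_to_rem ml; set l' := seq.rem _ _ in pl.
exists u, (seq_mset (unzip2 l') `+` X); split.
- rewrite msetDA -seq_mset_cons; congr (_ `+` _).
  by apply/eq_seq_msetP; exact: (perm_map snd pl).
- exact: (hl _ ml).
exists l', X; split=> //; last by move=> x hx; apply: hl; rewrite (perm_mem pl) inE hx orbT.
have : m +` A = m +` seq_mset (unzip1 l').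
  by rewrite e -seq_mset_cons; apply/eq_seq_msetP; exact: (perm_map fst pl).
by move/(congr1 (fun X => X `\ m)); rewrite !msetD1K.
Qed.

End MsetOrder.

Section ConfigOrder.
Variable P : finType.
Implicit Types (m u v : vec P) (A B C M : config P).

Lemma vle_trans m u v : vle m u -> vle u v -> vle m v.
Proof. by move=> h1 h2 p; apply: leq_trans (h1 p) (h2 p). Qed.

Definition cle : config P -> config P -> Prop := mle (@vle P).

Lemma config_leP A B : config_le A B <-> cle A B.
Proof.
split=> [[k [k' [ms [ms' [iota [-> -> inj le]]]]]]|[l [X [-> -> le]]]].
  (* The tuples outside the image of the injection form the rest. *)
  exists [seq (tnth ms i, tnth ms' (iota i)) | i <- enum 'I_k],
    (seq_mset [seq tnth ms' i | i <- enum 'I_k' & i \notin codom iota]).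
  split; last by move=> x /mapP[i _ ->]; exact: le.
    by rewrite /unzip1 -map_comp map_tnth_enum.
  rewrite -seq_mset_cat /unzip2 -map_comp.
  apply/eq_seq_msetP; rewrite -{1}(map_tnth_enum ms').
  have -> : [seq (snd \o (fun i => (tnth ms i, tnth ms' (iota i)))) i | i <- enum 'I_k] =
      [seq tnth ms' i | i <- codom iota].
    by rewrite codomE -map_comp.
  rewrite -map_cat; apply: perm_map.
  have := permEl (perm_filterC (mem (codom iota)) (enum 'I_k')).
  rewrite perm_sym => /perm_trans; apply; rewrite perm_cat2r; apply: uniq_perm => [||i].
  - by rewrite filter_uniq // enum_uniq.
  - by rewrite codomE map_inj_uniq // enum_uniq.
  by rewrite mem_filter mem_enum andbT.
(* With the matched tuples listed first, the injection is the inclusion of an initial segment. *)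
pose s := unzip2 l ++ enum_mset X.
have sz : size (unzip1 l) <= size s by rewrite size_cat !size_map leq_addr.
exists (size (unzip1 l)), (size s), (in_tuple (unzip1 l)), (in_tuple s), (widen_ord sz).
split=> //.
- by rewrite /s seq_mset_cat seq_mset_id.
- by move=> i j /(congr1 val) /= /val_inj.
pose d : vec P := [ffun _ => 0].
have n1 j : j < size l -> nth d (unzip1 l) j = (nth (d, d) l j).1.
  exact: (@nth_map _ (d, d) _ d fst).
have n2 j : j < size l -> nth d s j = (nth (d, d) l j).2.
  move=> lj; rewrite /s nth_cat size_map lj; exact: (@nth_map _ (d, d) _ d snd).
move=> i; rewrite !(tnth_nth d) /=.
have li : i < size l := leq_trans (ltn_ord i) (eq_leq (size_map fst l)).
by rewrite n1 // n2 //; apply: le; rewrite mem_nth.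
Qed.

Lemma cle0 B : cle mset0 B.
Proof. exact: mle0. Qed.

Lemma cle_cons m A B :
  cle (m +` A) B <-> exists u C, [/\ B = u +` C, vle m u & cle A C].
Proof. exact: mle_cons. Qed.

Lemma config_ind (Q : config P -> Prop) :
  Q mset0 -> (forall m A, Q A -> Q (m +` A)) -> forall A, Q A.
Proof.
move=> h0 h1 A; rewrite -(seq_mset_id A); elim: (enum_mset A) => [|m s IH].
  by rewrite seq_mset_nil.
by rewrite seq_mset_cons; exact: h1.
Qed.

Lemma cle_trans A B C : cle A B -> cle B C -> cle A C.
Proof.
elim/config_ind: A B C => [|m A IH] B C; first by move=> *; exact: cle0.
move=> /cle_cons[u [B' [-> mu AB']]] /cle_cons[v [C' [-> uv BC']]].
by apply/cle_cons; exists v, C'; split=> //; [exact: vle_trans mu uv|exact: IH BC'].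
Qed.

Lemma cleD A B A' B' : cle A A' -> cle B B' -> cle (A `+` B) (A' `+` B').
Proof.
elim/config_ind: A A' => [|m A IH] A' h1 h2.
  case: h2 => l [X [-> -> le]]; exists l, (A' `+` X); split; rewrite ?mset0D //.
  by rewrite msetDCA.
case/cle_cons: h1 => u [C [-> mu hC]]; rewrite -!msetDA; apply/cle_cons.
by exists u, (C `+` B'); split=> //; exact: IH.
Qed.

Lemma cle_split A B M : cle (A `+` B) M ->
  exists A' B', [/\ M = A' `+` B', cle A A' & cle B B'].
Proof.
elim/config_ind: A M => [|m A IH] M; rewrite ?mset0D => h.
  by exists mset0, M; rewrite mset0D; split=> //; exact: cle0.
rewrite -msetDA in h; case/cle_cons: h => u [C [-> mu /IH[A' [B' [-> hA hB]]]]].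
exists (u +` A'), B'; split; rewrite ?msetDA //.
by apply/cle_cons; exists u, A'.
Qed.

Lemma cle_refl A : cle A A.
Proof.
elim/config_ind: A => [|m A IH]; first exact: cle0.
by apply/cle_cons; exists m, A; split.
Qed.

Lemma cle1 m u : vle m u -> cle [mset m] [mset u].
Proof.
move=> mu; rewrite -[[mset m]]msetD0 -[[mset u]]msetD0; apply/cle_cons.
by exists u, mset0; split=> //; exact: cle0.
Qed.

(** Assigns to each variable the dominating tuple of the larger configuration, from which a mode
    there is built. *)
Lemma cle_map (I : eqType) (f : I -> vec P) s M : uniq s ->
  cle (seq_mset [seq f x | x <- s]) M ->
  exists g Y, [/\ M = Y `+` seq_mset [seq g x | x <- s] & forall x, x \in s -> vle (f x) (g x)].
Proof.
elim: s M => [|x s IH] M /=.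
  by move=> _ _; exists f, M; rewrite seq_mset_nil msetD0.
move=> /andP[xs us]; rewrite seq_mset_cons => /cle_cons[u [C [-> fu /IH]]].
move=> /(_ us)[g [Y [-> hg]]].
exists (fun y => if y == x then u else g y), Y; split.
  rewrite eqxx seq_mset_cons msetDCA; congr (_ `+` (_ `+` seq_mset _)).
  by apply/eq_in_map => y ys; case: eqP xs => // <-; rewrite ys.
move=> y; rewrite inE; case: eqP => [->|_] //= ; exact: hg.
Qed.

Lemma cle_map2 (I : eqType) (f g : I -> vec P) s : (forall x, x \in s -> vle (f x) (g x)) ->
  cle (seq_mset [seq f x | x <- s]) (seq_mset [seq g x | x <- s]).
Proof.
elim: s => [|x s IH] h /=; first by rewrite seq_mset_nil; exact: cle0.
rewrite !seq_mset_cons; apply/cle_cons; exists (g x), (seq_mset [seq g x | x <- s]).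
split=> //; first by apply: h; rewrite mem_head.
by apply: IH => y ys; apply: h; rewrite inE ys orbT.
Qed.

End ConfigOrder.

(** * Firing described by assignments of tuples to variables *)

Section NuFiring.
Variables (P T : finType) (N : nuPN P T) (t : T).

Definition gain (f : var -> vec P) (v : var) : vec P :=
  vadd (vsub (f v) (nu_in_vec N v t)) (nu_out_vec N v t).

Definition stds : seq var := enum_fset (std_vars N t).
Definition freshs : seq var := enum_fset (fresh_vars N t).

(** Trades injective modes into an enumeration for functions from variables to tuples: the bound
    tuples are enumerated first, so a variable is sent to its own index, and injectivity is that of
    [index]. The converse is [nu_fires_inv]. *)
Lemma nu_fires_intro (X : config P) (f : var -> vec P) :
  (forall v, v \in stds -> vle (nu_in_vec N v t) (f v)) ->
  exists k (ms : k.-tuple (vec P)) (e : std_vars N t -> 'I_k),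
    (forall y, nu_updated ms e y = gain f (val y)) /\
    nu_fires ms e (X `+` seq_mset [seq f v | v <- stds])
      (X `+` seq_mset [seq nu_out_vec N v t | v <- freshs]
         `+` seq_mset [seq gain f v | v <- stds]).
Proof.
move=> hf; pose s := [seq f v | v <- stds] ++ enum_mset X.
have hlt (y : std_vars N t) : index (val y) stds < size s.
  rewrite size_cat size_map ltn_addr // index_mem; exact: valP y.
pose e y := Ordinal (hlt y).
have et y : tnth (in_tuple s) (e y) = f (val y).
  rewrite (tnth_nth (f (val y))) /= /s nth_cat size_map index_mem.
  have hy : val y \in stds by exact: valP y.
  by rewrite hy (nth_map (val y)) ?index_mem // nth_index.
exists (size s), (in_tuple s), e.
have eu y : nu_updated (in_tuple s) e y = gain f (val y) by rewrite /nu_updated et.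
split=> //; split.
- by rewrite /= seq_mset_cat seq_mset_id msetDC.
- split=> [y y' /(congr1 val) /= ey|y].
    apply: val_inj; rewrite -(nth_index (val y) (valP y : val y \in stds)) ey.
    by rewrite nth_index //; exact: valP y'.
  by rewrite et; apply: hf; exact: valP y.
exists X.
  by rewrite -big_mset_fset; congr (_ `+` _); apply: eq_bigr => y _; rewrite et.
rewrite -!big_mset_fset; congr (_ `+` _); apply: eq_bigr => y _; by rewrite eu.
Qed.

Lemma nu_fires_inv k (ms : k.-tuple (vec P)) (e : std_vars N t -> 'I_k) M M' :
  nu_fires ms e M M' -> exists (X : config P) (f : var -> vec P),
    [/\ forall v, v \in stds -> vle (nu_in_vec N v t) (f v),
        forall y, nu_updated ms e y = gain f (val y),
        M = X `+` seq_mset [seq f v | v <- stds] &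
        M' = X `+` seq_mset [seq nu_out_vec N v t | v <- freshs]
         `+` seq_mset [seq gain f v | v <- stds]].
Proof.
case=> _ [_ hen] [X -> ->].
pose f v := if insub v is Some y then tnth ms (e y) else [ffun _ => 0].
have ef y : f (val y) = tnth ms (e y) by rewrite /f valK.
exists X, f; split.
- by move=> v hv; rewrite -[v](@insubdK _ _ (std_vars N t) (FSetSub hv)) // ef; exact: hen.
- by move=> y; rewrite /nu_updated /gain ef.
- by rewrite -big_mset_fset; congr (_ `+` _); apply: eq_bigr => y _; rewrite ef.
rewrite -!big_mset_fset; congr (_ `+` _); apply: eq_bigr => y _.
by rewrite /nu_updated /gain ef.
Qed.

End NuFiring.

Section Occurrences.
Variables (P T : finType) (N : nuPN P T) (t : T).

Definition vec0 : vec P := [ffun _ => 0].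

Definition lists_vars (vs : seq var) : Prop := uniq vs /\ vs =i nu_vars N t.

Lemma in_vec_fresh v : is_fresh v -> nu_in_vec N v t = vec0.
Proof.
move=> fr; apply/ffunP => p; rewrite !ffunE; apply/eqP/contraT => ne.
have hv : v \in pre_vars (nu_in N) t.
  apply/bigfcupP; exists p; first by rewrite mem_enum.
  by rewrite mem_finsupp.
by have := nu_pre_standard hv; rewrite fr.
Qed.

Lemma gain_fresh f v : is_fresh v -> f v = vec0 -> gain N t f v = nu_out_vec N v t.
Proof.
by move=> fr f0; apply/ffunP => p; rewrite /gain in_vec_fresh // f0 !ffunE subnn.
Qed.

Lemma mem_stds v : (v \in stds N t) = (v \in nu_vars N t) && ~~ is_fresh v.
Proof. by rewrite /stds /std_vars !inE. Qed.

Lemma mem_freshs v : (v \in freshs N t) = (v \in nu_vars N t) && is_fresh v.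
Proof. by rewrite /freshs /fresh_vars !inE. Qed.

Lemma perm_stds vs : lists_vars vs -> perm_eq [seq v <- vs | ~~ is_fresh v] (stds N t).
Proof.
move=> [uv mv]; apply: uniq_perm; rewrite ?filter_uniq ?fset_uniq // => v.
by rewrite mem_filter mv mem_stds andbC.
Qed.

Lemma perm_freshs vs : lists_vars vs -> perm_eq [seq v <- vs | is_fresh v] (freshs N t).
Proof.
move=> [uv mv]; apply: uniq_perm; rewrite ?filter_uniq ?fset_uniq // => v.
by rewrite mem_filter mv mem_freshs andbC.
Qed.

Lemma mset_map_perm (I : eqType) (s s' : seq I) (f : I -> vec P) :
  perm_eq s s' -> seq_mset [seq f v | v <- s] = seq_mset [seq f v | v <- s'].
Proof. by move=> h; apply/eq_seq_msetP; exact: perm_map. Qed.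

(** A fresh variable that is bound to the zero tuple gains exactly its output vector. With this
    convention a single list of variables covers both kinds. *)
Lemma mset_gain_split vs f : lists_vars vs ->
  (forall v, is_fresh v -> f v = vec0) ->
  seq_mset [seq gain N t f v | v <- vs] =
  seq_mset [seq nu_out_vec N v t | v <- freshs N t] `+`
  seq_mset [seq gain N t f v | v <- stds N t].
Proof.
move=> hv f0; rewrite -(mset_map_perm _ (perm_freshs hv)) -(mset_map_perm _ (perm_stds hv)).
have -> : [seq nu_out_vec N v t | v <- vs & is_fresh v] = [seq gain N t f v | v <- vs & is_fresh v].
  apply/eq_in_map => v; rewrite mem_filter => /andP[fr _].
  by rewrite gain_fresh // f0.
rewrite -seq_mset_cat -map_cat; apply: mset_map_perm.
by rewrite perm_sym; apply: permEl; exact: perm_filterC.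
Qed.

Lemma gain_le f g v : vle (f v) (g v) -> vle (gain N t f v) (gain N t g v).
Proof. by move=> h p; rewrite !ffunE leq_add2r leq_sub2r. Qed.

(** The larger assignment [g] is returned explicitly, because a transfer goes on to modify the
    updated tuples. *)
Lemma nu_fires_mono f (Y M : config P) :
  (forall v, v \in stds N t -> vle (nu_in_vec N v t) (f v)) ->
  cle (Y `+` seq_mset [seq f v | v <- stds N t]) M ->
  exists Z g k (ms : k.-tuple (vec P)) (e : std_vars N t -> 'I_k),
    [/\ cle Y Z, forall v, v \in stds N t -> vle (f v) (g v),
      forall y, nu_updated ms e y = gain N t g (val y) &
      nu_fires ms e M (Z `+` seq_mset [seq nu_out_vec N v t | v <- freshs N t]
         `+` seq_mset [seq gain N t g v | v <- stds N t])].
Proof.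
move=> hin /cle_split[Y' [B [-> hY hB]]].
have [g [Z [-> hg]]] := cle_map (fset_uniq _) hB.
have hin' v : v \in stds N t -> vle (nu_in_vec N v t) (g v).
  by move=> hv; apply: vle_trans (hin _ hv) (hg _ hv).
have [k [ms [e [eu hf]]]] := nu_fires_intro (Y' `+` Z) hin'.
exists (Y' `+` Z), g, k, ms, e; split=> //; last by rewrite msetDA.
by rewrite -(msetD0 Y); apply: cleD => //; exact: cle0.
Qed.

End Occurrences.

(** * Transfer transitions *)

Section TransferNet.
Variable N : rnuPN.
Notation P := (r_place N).
Implicit Types (t : r_trans' N) (f g : var -> vec P).

Definition tr1 t (m1 : vec P) : vec P :=
  vsub m1 (vscale (m1 (r_transfer t).1) (unitv (r_transfer t).1)).
Definition tr2 t (m1 m2 : vec P) : vec P :=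
  vadd m2 (vscale (m1 (r_transfer t).1) (unitv (r_transfer t).2)).

(** A fresh variable has zero input, whereas the three variables of a transfer each take a unit
    vector. *)
Lemma rx_standard t v : v \in nu_vars (r_net' N) t -> ~~ is_fresh v.
Proof.
have [p2 [p3 [p4 [p5 [_ _ [h0 _] [h1 _] [h2 _]]]]]] := r_shape t.
have aux w p : nu_in_vec (r_net' N) w t = unitv p -> ~~ is_fresh w.
  move=> h; apply/negP => fr; have := in_vec_fresh (r_net' N) t fr; rewrite h.
  by move/ffunP/(_ p); rewrite !ffunE eqxx.
rewrite r_vars !inE => /orP[/orP[]|] /eqP->; [exact: aux h0|exact: aux h1|exact: aux h2].
Qed.

(** The three input vectors are units at distinct places. *)
Lemma rx_uniq t : uniq [:: rx0 t; rx1 t; rx2 t].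
Proof.
have [p2 [p3 [p4 [p5 [hu _ [h0 _] [h1 _] [h2 _]]]]]] := r_shape t.
have aux v w p q : nu_in_vec (r_net' N) v t = unitv p ->
    nu_in_vec (r_net' N) w t = unitv q -> p != q -> v != w.
  move=> e1 e2; apply: contra => /eqP e; move: e2; rewrite -e e1.
  by move/ffunP/(_ p); rewrite !ffunE eqxx; case: (p == q).
move: hu; rewrite /= !inE !negb_or => /and4P[/and3P[n1 n2 _] /andP[n3 _] _ _].
by rewrite (aux _ _ _ _ h0 h1 n1) (aux _ _ _ _ h0 h2 n2) (aux _ _ _ _ h1 h2 n3).
Qed.

Lemma rx_stds t : perm_eq (stds (r_net' N) t) [:: rx0 t; rx1 t; rx2 t].
Proof.
apply: uniq_perm; [exact: fset_uniq|exact: rx_uniq|] => v.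
rewrite mem_stds.
have -> : (v \in nu_vars (r_net' N) t) = (v \in [:: rx0 t; rx1 t; rx2 t]).
  by rewrite r_vars !inE orbA.
apply: andb_idr => hv; apply: (@rx_standard t).
by rewrite r_vars !inE -orbA; rewrite !inE in hv.
Qed.

Lemma rx_freshs t : freshs (r_net' N) t = [::].
Proof.
apply/eqP; rewrite -size_eq0 -leqn0 leqNgt -has_predT; apply/hasPn => v.
by rewrite mem_freshs => /andP[/rx_standard /negbTE ->].
Qed.

Definition transferred t f (X : config P) : config P :=
  X `+` [mset gain (r_net' N) t f (rx0 t)] `+`
  [mset tr1 t (gain (r_net' N) t f (rx1 t))] `+`
  [mset tr2 t (gain (r_net' N) t f (rx1 t)) (gain (r_net' N) t f (rx2 t))].

Lemma mset3 (I : Type) (f : I -> vec P) (a b c : I) :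
  seq_mset [seq f v | v <- [:: a; b; c]] = [mset f a] `+` [mset f b] `+` [mset f c].
Proof. by rewrite /= !seq_mset_cons seq_mset_nil msetD0 msetDA. Qed.

Lemma transfer_result t f X :
  ((X `+` seq_mset [seq gain (r_net' N) t f v | v <- stds (r_net' N) t]) `\`
    ([mset gain (r_net' N) t f (rx1 t)] `+` [mset gain (r_net' N) t f (rx2 t)]))
  `+` [mset tr1 t (gain (r_net' N) t f (rx1 t))]
  `+` [mset tr2 t (gain (r_net' N) t f (rx1 t)) (gain (r_net' N) t f (rx2 t))]
  = transferred t f X.
Proof.
rewrite (mset_map_perm _ (rx_stds t)) mset3; congr (_ `+` _ `+` _).
by apply/msetP => m; rewrite !(msetBE, msetDE); lia.
Qed.

Lemma transfer_inv t M M' : transfer_fires t M M' -> exists X f,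
  [/\ forall v, v \in stds (r_net' N) t -> vle (nu_in_vec (r_net' N) v t) (f v),
      M = X `+` seq_mset [seq f v | v <- stds (r_net' N) t] &
      M' = transferred t f X].
Proof.
case=> k [ms [e [M'' [y1 [y2 [hf e1 e2 ->]]]]]].
have [X [f [hin hu -> eM'']]] := nu_fires_inv hf.
exists X, f; split=> //; rewrite -transfer_result eM'' rx_freshs /= seq_mset_nil msetD0.
by rewrite !hu e1 e2.
Qed.

(** Emptying a place is monotone although it subtracts, since it leaves 0 there in both tuples; the
    receiving tuple can only get more from a larger source. *)
Lemma transfer_mono t f (Y M : config P) :
  (forall v, v \in stds (r_net' N) t -> vle (nu_in_vec (r_net' N) v t) (f v)) ->
  cle (Y `+` seq_mset [seq f v | v <- stds (r_net' N) t]) M ->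
  exists M', transfer_fires t M M' /\ cle (transferred t f Y) M'.
Proof.
move=> hin hle; have [Z [g [k [ms [e [hY hg hu hf]]]]]] := nu_fires_mono hin hle.
have m1 : rx1 t \in stds (r_net' N) t by rewrite (perm_mem (rx_stds t)) !inE eqxx orbT.
have m2 : rx2 t \in stds (r_net' N) t by rewrite (perm_mem (rx_stds t)) !inE eqxx !orbT.
have m0 : rx0 t \in stds (r_net' N) t by rewrite (perm_mem (rx_stds t)) !inE eqxx.
have l0 := gain_le (r_net' N) t (hg _ m0).
have l1 := gain_le (r_net' N) t (hg _ m1).
have l2 := gain_le (r_net' N) t (hg _ m2).
exists (transferred t g Z); split.
  exists k, ms, e; eexists; exists (FSetSub m1), (FSetSub m2); split; [exact: hf| | |] => //.
  by rewrite -transfer_result rx_freshs /= seq_mset_nil msetD0 !hu.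
apply: cleD; first apply: cleD; first apply: cleD => //.
- exact: cle1.
- apply: cle1 => p; have := l1 p; rewrite !ffunE; case: eqP => [->|_] /=; lia.
apply: cle1 => p; have := l1 (r_transfer t).1; have := l2 p; rewrite !ffunE.
by case: eqP => _ /=; lia.
Qed.

End TransferNet.

(** * The simulation *)

Section States.
Variable n : nat.

(** The last phase is 6, and [n] will be the length of the input. Powers of two compare like their
    exponents, and their numerals are easy to print: zeros followed by a one. *)
Definition st (c i j : nat) : vec slot :=
  [ffun k : slot => nth 0 [:: c; 6 - c; 2 ^ i; 2 ^ (n - i); 2 ^ j; 2 ^ (n - j)] k].

(* The components of [st] come in pairs that grow in opposite directions. *)
Lemma st_le c i j c' i' j' : vle (st c i j) (st c' i' j') -> c' <= 6 -> i' <= n -> j' <= n ->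
  [/\ c = c', i = i' & j = j'].
Proof.
move=> h cb ib jb; have h' k (lk : k < 6) := h (Ordinal lk).
have [h0 h1 h2] := And3 (h' 0 isT) (h' 1 isT) (h' 2 isT).
have [h3 h4 h5] := And3 (h' 3 isT) (h' 4 isT) (h' 5 isT).
rewrite !ffunE /= in h0 h1; move: h2 h3 h4 h5; rewrite !ffunE /= !leq_exp2l //.
by move=> h2 h3 h4 h5; split; lia.
Qed.

Lemma st_inj c i j c' i' j' : st c i j = st c' i' j' -> c' <= 6 -> i' <= n -> j' <= n ->
  [/\ c = c', i = i' & j = j'].
Proof. by move=> e; apply: st_le; rewrite e. Qed.

End States.

(** [s_sim] holds the tuples that may still be bound, [s_sel] those already updated. Keeping them
    apart prevents a tuple from being bound to two variables of one firing, as injectivity of modes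
    demands. *)
Definition s_sim : slot := @Ordinal 6 0 isT.
Definition s_sel : slot := @Ordinal 6 1 isT.
Definition s_src : slot := @Ordinal 6 2 isT.
Definition s_dst : slot := @Ordinal 6 3 isT.
Definition s_new : slot := @Ordinal 6 4 isT.
Definition s_trash : slot := @Ordinal 6 5 isT.

Definition rk (T : finType) (t : T) : nat := enum_rank t.

Lemma rk_lt (T : finType) (t : T) : rk t < #|T|.
Proof. exact: ltn_ord. Qed.

Lemma rk_inj (T : finType) : injective (@rk T).
Proof. by move=> t t' /val_inj /enum_rank_inj. Qed.

Section Rules.
Variables (N : rnuPN) (n : nat).
Notation P := (r_place N).
Variables (occ1 : r_trans N -> nat -> option var) (occ2 : r_trans' N -> nat -> option var).

Definition rl (a b : option slot) (s s' : vec slot) (x y : vec P) : rule P :=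
  ((a, b), (s, s'), (x, y)).

(* The first component of [st] is the phase: 0 is the idle phase; 1 and 2 walk through
   the entries of a transition of [r_net] and [r_net']; 3 and 4 remove a token from the
   tuple on [s_src] and add it to another tuple; 5 and 6 return the new tuple and the
   one on [s_dst].  The second component is the transition, the third one the position
   [j] of the walk, or the place of the removed token.  [occ t j] is the variable of [t]
   whose first occurrence is at the position [j]. *)
Definition walk_rule (T : finType) (Nt : nuPN P T) (dst : T -> var -> slot)
    (occ : T -> nat -> option var) (c : nat) (t : T) (j : nat) : rule P :=
  if occ t j is Some v then
    rl (if is_fresh v then None else Some s_sim) (Some (dst t v))
      (st n c (rk t) j) (st n c (rk t) j.+1) (nu_in_vec Nt v t) (nu_out_vec Nt v t)
  else rl None None (st n c (rk t) j) (st n c (rk t) j.+1) (vec0 P) (vec0 P).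

Definition dst1 (t : r_trans N) (v : var) : slot := s_sel.
Definition dst2 (t : r_trans' N) (v : var) : slot :=
  if v == rx1 t then s_src else if v == rx2 t then s_dst else s_sel.

Definition back_rule (t : r_trans' N) (p : P) : rule P :=
  if p == (r_transfer t).1 then
    rl (Some s_dst) (Some s_dst) (st n 4 (rk t) (rk p)) (st n 3 (rk t) 0)
      (vec0 P) (unitv (r_transfer t).2)
  else rl (Some s_new) (Some s_new) (st n 4 (rk t) (rk p)) (st n 3 (rk t) 0)
      (vec0 P) (unitv p).

Definition idle_st : vec slot := st n 0 0 0.

Definition rules : seq (rule P) :=
  [:: rl (Some s_sel) (Some s_sim) idle_st idle_st (vec0 P) (vec0 P)] ++
  [seq rl None None idle_st (st n 1 (rk t) 0) (vec0 P) (vec0 P) | t <- enum (r_trans N)] ++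
  [seq walk_rule (r_net N) dst1 occ1 1 t j | t <- enum (r_trans N), j <- iota 0 n] ++
  [seq rl None None (st n 1 (rk t) n) idle_st (vec0 P) (vec0 P) | t <- enum (r_trans N)] ++
  [seq rl None (Some s_new) idle_st (st n 2 (rk t) 0) (vec0 P) (vec0 P)
    | t <- enum (r_trans' N)] ++
  [seq walk_rule (r_net' N) dst2 occ2 2 t j | t <- enum (r_trans' N), j <- iota 0 n] ++
  [seq rl None None (st n 2 (rk t) n) (st n 3 (rk t) 0) (vec0 P) (vec0 P)
    | t <- enum (r_trans' N)] ++
  [seq rl (Some s_src) (Some s_src) (st n 3 (rk t) 0) (st n 4 (rk t) (rk p))
    (unitv p) (vec0 P) | t <- enum (r_trans' N), p <- enum P] ++
  [seq back_rule t p | t <- enum (r_trans' N), p <- enum P] ++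
  [seq rl (Some s_src) (Some s_trash) (st n 3 (rk t) 0) (st n 5 0 0) (vec0 P) (vec0 P)
    | t <- enum (r_trans' N)] ++
  [:: rl (Some s_new) (Some s_sel) (st n 5 0 0) (st n 6 0 0) (vec0 P) (vec0 P);
      rl (Some s_dst) (Some s_sel) (st n 6 0 0) idle_st (vec0 P) (vec0 P)].

Variant rule_spec : rule P -> Prop :=
| RuleReturn : rule_spec (rl (Some s_sel) (Some s_sim) idle_st idle_st (vec0 P) (vec0 P))
| RuleStart1 (t : r_trans N) : rule_spec (rl None None idle_st (st n 1 (rk t) 0) (vec0 P) (vec0 P))
| RuleWalk1 (t : r_trans N) j of j < n : rule_spec (walk_rule (r_net N) dst1 occ1 1 t j)
| RuleEnd1 (t : r_trans N) : rule_spec (rl None None (st n 1 (rk t) n) idle_st (vec0 P) (vec0 P))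
| RuleStart2 (t : r_trans' N) :
    rule_spec (rl None (Some s_new) idle_st (st n 2 (rk t) 0) (vec0 P) (vec0 P))
| RuleWalk2 (t : r_trans' N) j of j < n : rule_spec (walk_rule (r_net' N) dst2 occ2 2 t j)
| RuleEnd2 (t : r_trans' N) :
    rule_spec (rl None None (st n 2 (rk t) n) (st n 3 (rk t) 0) (vec0 P) (vec0 P))
| RuleTake (t : r_trans' N) (p : P) : rule_spec (rl (Some s_src) (Some s_src) (st n 3 (rk t) 0)
    (st n 4 (rk t) (rk p)) (unitv p) (vec0 P))
| RuleBack (t : r_trans' N) (p : P) : rule_spec (back_rule t p)
| RuleTrash (t : r_trans' N) : rule_spec (rl (Some s_src) (Some s_trash) (st n 3 (rk t) 0)
    (st n 5 0 0) (vec0 P) (vec0 P))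
| RuleNew : rule_spec (rl (Some s_new) (Some s_sel) (st n 5 0 0) (st n 6 0 0)
    (vec0 P) (vec0 P))
| RuleDst : rule_spec (rl (Some s_dst) (Some s_sel) (st n 6 0 0) idle_st
    (vec0 P) (vec0 P)).

Lemma rulesP r : r \in rules <-> rule_spec r.
Proof.
split; last first.
  case=> [|t|t j lj|t|t|t j lj|t|t p|t p|t||]; rewrite /rules !mem_cat ?inE ?eqxx ?orbT //;
  do ?[apply/orP; first [left; (apply: map_f; by rewrite mem_enum)
    | left; (apply: allpairs_f; by rewrite ?mem_enum ?mem_iota) | right]].
rewrite /rules !mem_cat !inE => h.
do ?[case/orP: h => h].
- by rewrite (eqP h); constructor.
- by case/mapP: h => t _ ->; constructor.
- by case/allpairsP: h => -[t j] [_ + ->]; rewrite mem_iota => lj; constructor.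
- by case/mapP: h => t _ ->; constructor.
- by case/mapP: h => t _ ->; constructor.
- by case/allpairsP: h => -[t j] [_ + ->]; rewrite mem_iota => lj; constructor.
- by case/mapP: h => t _ ->; constructor.
- by case/allpairsP: h => -[t p] [_ _ ->]; constructor.
- by case/allpairsP: h => -[t p] [_ _ ->]; constructor.
- by case/mapP: h => t _ ->; constructor.
- by rewrite (eqP h); constructor.
- by rewrite (eqP h); constructor.
Qed.

Notation E := (sim_eos rules).
Notation store := (store P).
Implicit Types (A : store) (s : vec slot) (X : config P) (m : vec P).

Lemma step_noop s s' A : rule_spec (rl None None s s' (vec0 P) (vec0 P)) ->
  @eos_step E (mk rules s A) (mk rules s' A).
Proof.
move=> /rulesP hr; have := @eos_step_fire _ rules _ A (vec0 P) (vec0 P) hr; apply=> //.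
by apply/ffunP => p; rewrite !ffunE.
Qed.

Lemma step_create q s s' x y A : rule_spec (rl None (Some q) s s' x y) -> x = vec0 P ->
  @eos_step E (mk rules s A) (mk rules s' (put A (Some q) y)).
Proof.
move=> /rulesP hr x0; have := @eos_step_fire _ rules _ A (vec0 P) y hr; apply=> //.
  by rewrite /r_take /= x0.
by rewrite /r_take /= x0; apply/ffunP => p; rewrite !ffunE.
Qed.

Lemma step_move q q' s s' x y m A : rule_spec (rl (Some q) (Some q') s s' x y) ->
  m \in A q -> vle x m ->
  @eos_step E (mk rules s A) (mk rules s' (put (rem A (Some q) m) (Some q') (fire x y m))).
Proof.
by move=> /rulesP hr hm xm; have := @eos_step_fire _ rules _ A m (fire x y m) hr; apply.
Qed.

Definition reach (x y : marking E) : Prop := clos_refl_trans _ (@eos_step E) x y.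

Lemma reach_refl x : reach x x. Proof. exact: rt_refl. Qed.

Lemma reach_trans x y z : reach x y -> reach y z -> reach x z.
Proof. exact: rt_trans. Qed.

Lemma reach_step x y : @eos_step E x y -> reach x y.
Proof. exact: rt_step. Qed.

(** Slots beyond the list are empty, so [stor [:: X]] has [X] on [s_sim] and nothing elsewhere. *)
Definition stor (l : seq (config P)) : store := fun q => nth mset0 l q.

Lemma put_stor l (q : slot) m : size l = 6 ->
  put (stor l) (Some q) m = stor (set_nth mset0 l q (m +` nth mset0 l q)).
Proof.
move=> sz; apply: functional_extensionality => q'; rewrite /stor nth_set_nth /=.
by rewrite val_eqE; case: eqP => // ->.
Qed.

Lemma rem_stor l (q : slot) m : size l = 6 ->
  rem (stor l) (Some q) m = stor (set_nth mset0 l q (nth mset0 l q `\ m)).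
Proof.
move=> sz; apply: functional_extensionality => q'; rewrite /stor nth_set_nth /=.
by rewrite val_eqE; case: eqP => // ->.
Qed.

Lemma fire0 m : fire (vec0 P) (vec0 P) m = m.
Proof. by apply/ffunP => p; rewrite !ffunE subn0 addn0. Qed.

Lemma vle0 m : vle (vec0 P) m.
Proof. by move=> p; rewrite ffunE. Qed.

Section Walk.
Variables (T : finType) (Nt : nuPN P T) (dst : T -> var -> slot).
Variables (occ : T -> nat -> option var) (c : nat) (t : T).
Hypothesis Hrule : forall j, j < n -> rule_spec (walk_rule Nt dst occ c t j).
Hypothesis Hdst : forall v, dst t v != s_sim.

Definition seen (j : nat) : seq var := pmap (occ t) (iota 0 j).
Definition unseen (j : nat) : seq var := pmap (occ t) (iota j (n - j)).

Lemma seenS j : seen j.+1 = seen j ++ seq_of_opt (occ t j).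
Proof.
by rewrite /seen -addn1 iotaD pmap_cat add0n /=; case: (occ t j).
Qed.

Lemma unseenS j : j < n -> unseen j = seq_of_opt (occ t j) ++ unseen j.+1.
Proof.
move=> lj; rewrite /unseen; have -> : n - j = (n - j.+1).+1 by lia.
by rewrite /=; case: (occ t j).
Qed.

(** The variables are bound in the order of their first occurrences, one step per position; fresh
    ones obey the convention of being bound to the zero tuple. *)
Lemma reach_walk (f : var -> vec P) X A :
  (forall v, v \in seen n -> ~~ is_fresh v -> vle (nu_in_vec Nt v t) (f v)) ->
  (forall v, is_fresh v -> f v = vec0 P) ->
  A s_sim = X `+` seq_mset [seq f v | v <- seen n & ~~ is_fresh v] ->
  reach (mk rules (st n c (rk t) 0) A) (mk rules (st n c (rk t) n)
    (fun q => if q == s_sim then X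
       else A q `+` seq_mset [seq gain Nt t f v | v <- seen n & dst t v == q])).
Proof.
move=> hin hfr hA.
(* The store after [j] positions: tuples of variables to come are still on [s_sim], the updated ones
   of past variables are on their destinations. *)
pose B j : store := fun q =>
  if q == s_sim then X `+` seq_mset [seq f v | v <- unseen j & ~~ is_fresh v]
  else A q `+` seq_mset [seq gain Nt t f v | v <- seen j & dst t v == q].
have eB0 : A = B 0.
  apply: functional_extensionality => q; rewrite /B; case: eqP => [->|_].
    by rewrite hA /unseen subn0.
  by rewrite /seen /= seq_mset_nil msetD0.
have eBn : B n = (fun q => if q == s_sim then X
       else A q `+` seq_mset [seq gain Nt t f v | v <- seen n & dst t v == q]).
  apply: functional_extensionality => q; rewrite /B; case: eqP => // _.
  by rewrite /unseen subnn /= seq_mset_nil msetD0.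
rewrite {1}eB0 -eBn.
have : forall j, j <= n -> reach (mk rules (st n c (rk t) 0) (B 0)) (mk rules (st n c (rk t) j) (B j)).
  elim=> [|j IH] lj; first exact: reach_refl.
  apply: reach_trans (IH (ltnW lj)) _; apply: reach_step.
  have := Hrule lj; rewrite /walk_rule.
  case eo : (occ t j) => [v|] hr; last first.
    have -> : B j = B j.+1; last exact: step_noop.
    by apply: functional_extensionality => q; rewrite /B unseenS // seenS eo /= cats0.
  have Bg q : q != s_sim -> B j.+1 q = B j q `+` (if dst t v == q then [mset gain Nt t f v] else mset0).
    move=> /negbTE nq; rewrite /B nq seenS eo filter_cat map_cat seq_mset_cat msetDA /=.
    by case: ifP => _; rewrite /= ?seq_mset1 ?seq_mset_nil.
  have vs : v \in seen n.
    by rewrite mem_pmap -eo map_f // mem_iota.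
  case fr : (is_fresh v) hr => hr.
    have -> : B j.+1 = put (B j) (Some (dst t v)) (nu_out_vec Nt v t).
      apply: functional_extensionality => q; rewrite /put.
      have [->|nq] := eqVneq q s_sim.
        by rewrite eq_sym (negbTE (Hdst v)) /B ?eqxx (unseenS lj) eo /= fr.
      rewrite Bg // eq_sym; case: eqP => _; last by rewrite msetD0.
      by rewrite msetDC gain_fresh // hfr.
    by apply: step_create hr _; apply: in_vec_fresh.
  have Bs : B j s_sim = f v +` B j.+1 s_sim.
    by rewrite /B ?eqxx (unseenS lj) eo /= fr /= seq_mset_cons msetDCA.
  have -> : B j.+1 = put (rem (B j) (Some s_sim) (f v)) (Some (dst t v)) (gain Nt t f v).
    apply: functional_extensionality => q; rewrite /put /rem.
    have [->|nq] := eqVneq q s_sim.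
      by rewrite eq_sym (negbTE (Hdst v)) ?eqxx Bs msetD1K.
    rewrite Bg // eq_sym; case: eqP => _; last by rewrite msetD0.
    by rewrite msetDC.
  apply: step_move hr _ _; first by rewrite Bs mset1D1.
  by apply: hin; rewrite ?fr.
by apply.
Qed.

End Walk.
End Rules.

(** * Completeness: runs of the net are simulated *)

Section Completeness.
Variables (N : rnuPN) (n : nat).
Notation P := (r_place N).
Variables (occ1 : r_trans N -> nat -> option var) (occ2 : r_trans' N -> nat -> option var).
Hypothesis occ1P : forall t, lists_vars (r_net N) t (seen occ1 t n).
Hypothesis occ2P : forall t, lists_vars (r_net' N) t (seen occ2 t n).

Notation L := (rules n occ1 occ2).
Notation reach := (@reach N n occ1 occ2).
Implicit Types (X B G M : config P) (m : vec P).

Lemma reach_return X B c d e G :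
  reach (mk L (idle_st n) (stor [:: X; B; c; d; e; G]))
        (mk L (idle_st n) (stor [:: X `+` B; mset0; c; d; e; G])).
Proof.
elim/config_ind: B X => [|m B IH] X; first by rewrite msetD0; exact: reach_refl.
rewrite msetDCA msetDA; apply: reach_trans (IH _); apply: reach_step.
have := step_move (A := stor [:: X; m +` B; c; d; e; G]) (m := m) (RuleReturn n occ1 occ2).
rewrite fire0 rem_stor // put_stor //= msetD1K; apply; first exact: mset1D1.
exact: vle0.
Qed.

(** Forces an assignment to respect the convention on fresh variables; on standard ones it changes
    nothing. *)
Definition std_part (f : var -> vec P) (v : var) : vec P :=
  if is_fresh v then vec0 P else f v.

Section OneNet.
Variables (T : finType) (Nt : nuPN P T) (t : T).

Lemma std_part_std f v : v \in stds Nt t -> std_part f v = f v.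
Proof. by rewrite mem_stds /std_part => /andP[_ /negbTE ->]. Qed.

Lemma map_std_part f : [seq std_part f v | v <- stds Nt t] = [seq f v | v <- stds Nt t].
Proof. by apply/eq_in_map => v hv; rewrite (std_part_std _ hv). Qed.

Lemma map_gain_std_part f :
  [seq gain Nt t (std_part f) v | v <- stds Nt t] = [seq gain Nt t f v | v <- stds Nt t].
Proof. by apply/eq_in_map => v hv; rewrite /gain (std_part_std _ hv). Qed.
End OneNet.

Lemma sim_nu t f X G :
  (forall v, v \in stds (r_net N) t -> vle (nu_in_vec (r_net N) v t) (f v)) ->
  reach (mk L (idle_st n) (stor [:: X `+` seq_mset [seq f v | v <- stds (r_net N) t];
                               mset0; mset0; mset0; mset0; G]))
        (mk L (idle_st n) (stor [:: X
            `+` seq_mset [seq nu_out_vec (r_net N) v t | v <- freshs (r_net N) t]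
            `+` seq_mset [seq gain (r_net N) t f v | v <- stds (r_net N) t];
          mset0; mset0; mset0; mset0; G])).
Proof.
move=> hin; have hv := occ1P t.
apply: reach_trans (reach_step (step_noop _ (RuleStart1 n occ1 occ2 t))) _.
have := @reach_walk N n occ1 occ2 _ (r_net N) (@dst1 N) occ1 1 t
  (fun j lj => RuleWalk1 occ1 occ2 t lj) (fun _ => isT) (std_part f) X
  (stor [:: X `+` seq_mset [seq f v | v <- stds (r_net N) t]; mset0; mset0; mset0; mset0; G]).
have -> : seq_mset [seq std_part f v | v <- seen occ1 t n & ~~ is_fresh v] =
    seq_mset [seq f v | v <- stds (r_net N) t].
  by rewrite (mset_map_perm _ (perm_stds hv)) map_std_part.
move=> H; apply: reach_trans (H _ _ _) _ => //.
- move=> v vs fr; have hs : v \in stds (r_net N) t by rewrite mem_stds fr -hv.2 vs.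
  by rewrite (std_part_std _ hs); exact: hin.
- by move=> v fr; rewrite /std_part fr.
apply: reach_trans (reach_step (step_noop _ (RuleEnd1 n occ1 occ2 t))) _.
set A := (fun q : slot => _).
have -> : A = stor [:: X; seq_mset [seq gain (r_net N) t (std_part f) v | v <- seen occ1 t n];
    mset0; mset0; mset0; G].
  apply: functional_extensionality => q; rewrite /A /dst1.
  have fT : [seq v <- seen occ1 t n | true] = seen occ1 t n := filter_predT _.
  have fF : [seq v <- seen occ1 t n | false] = [::] := filter_pred0 _.
  by case: q => -[|[|[|[|[|[|//]]]]]] lq; rewrite /stor /= ?fT ?fF ?mset0D
    //= seq_mset_nil ?msetD0.
have := reach_return X (seq_mset [seq gain (r_net N) t (std_part f) v | v <- seen occ1 t n])
  mset0 mset0 mset0 G.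
rewrite (mset_gain_split hv) ?msetDA ?map_gain_std_part //.
by move=> v fr; rewrite /std_part fr.
Qed.

(** Induction on the number of tokens in [a]. One round moves one token out of [a] and changes
    neither [tr2 t a c] nor [vadd b (tr1 t a)], so emptying [a] completely yields the exact
    transfer. *)
Lemma reach_drain t X B a b c G :
  reach (mk L (st n 3 (rk t) 0) (stor [:: X; B; [mset a]; [mset c]; [mset b]; G]))
        (mk L (st n 3 (rk t) 0) (stor [:: X; B; [mset vec0 P]; [mset tr2 t a c];
           [mset vadd b (tr1 t a)]; G])).
Proof.
have [k] := ubnP (\sum_p a p); elim: k a b c => // k IH a b c lk.
have [/existsP[p ap]|] := boolP [exists p, 0 < a p]; last first.
  rewrite negb_exists => /forallP h; have -> : a = vec0 P.
    by apply/ffunP => p; rewrite ffunE; have := h p; case: (a p).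
  have -> : tr1 t (vec0 P) = vec0 P by apply/ffunP => p; rewrite !ffunE; lia.
  have -> : tr2 t (vec0 P) c = c by apply/ffunP => p; rewrite !ffunE; lia.
  have -> : vadd b (vec0 P) = b by apply/ffunP => p; rewrite !ffunE; lia.
  exact: reach_refl.
pose a' := fire (unitv p) (vec0 P) a.
have ap' : vle (unitv p) a by move=> q; rewrite ffunE; case: eqP => [->|].
have lk' : \sum_q a' q < k.
  rewrite (bigD1 p) //= in lk; rewrite (bigD1 p) //=.
  have -> : \sum_(i | i != p) a' i = \sum_(i | i != p) a i.
    by apply: eq_bigr => q /negbTE nq; rewrite !ffunE nq subn0 addn0.
  rewrite !ffunE eqxx addn0 /=; move: lk ap.
  by move: (\sum_(i | i != p) a i) (a p) => S x; lia.
have ma : a \in stor [:: X; B; [mset a]; [mset c]; [mset b]; G] s_src by rewrite /stor /= in_mset1.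
have := step_move (RuleTake n occ1 occ2 t p) ma ap'.
rewrite rem_stor // put_stor //= -[_ `\ a]msetD0 -/a' => /reach_step st1.
have e0 (x : vec P) : [mset x] `\ x = mset0.
  by apply/msetP => y; rewrite msetB1E msetnE mset0E; case: eqP.
rewrite msetD0 e0 msetD0 in st1; apply: reach_trans st1 _.
have := RuleBack n occ1 occ2 t p; rewrite /back_rule.
have [ep|np] := eqVneq p (r_transfer t).1 => hr.
  have mc : c \in stor [:: X; B; [mset a']; [mset c]; [mset b]; G] s_dst.
    by rewrite /stor /= in_mset1.
  have := step_move hr mc (@vle0 _ c).
  rewrite rem_stor // put_stor //= e0 msetD0 => /reach_step st2; apply: reach_trans st2 _.
  have -> : tr1 t a = tr1 t a'.
    by apply/ffunP => q; rewrite !ffunE -ep eqxx; case: eqP => [->|_]; lia.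
  have -> : tr2 t a c = tr2 t a' (fire (vec0 P) (unitv (r_transfer t).2) c).
    apply/ffunP => q; rewrite !ffunE -ep eqxx; move: ap; case: eqP => _; lia.
  exact: IH.
have mb : b \in stor [:: X; B; [mset a']; [mset c]; [mset b]; G] s_new.
  by rewrite /stor /= in_mset1.
have := step_move hr mb (@vle0 _ b).
rewrite rem_stor // put_stor //= e0 msetD0 => /reach_step st2; apply: reach_trans st2 _.
have -> : tr2 t a c = tr2 t a' c.
  apply/ffunP => q; rewrite !ffunE (_ : (_ == p) = false) ?subn0 ?addn0 //.
  by rewrite eq_sym (negbTE np).
have -> : vadd b (tr1 t a) = vadd (fire (vec0 P) (unitv p) b) (tr1 t a').
  apply/ffunP => q; rewrite !ffunE; move: ap; rewrite eq_sym in np.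
  rewrite (negbTE np).
  case: (eqVneq q (r_transfer t).1) => [->|_]; first by rewrite (negbTE np); lia.
  by case: (eqVneq q p) => [->|_]; lia.
exact: IH.
Qed.

Lemma sim_transfer t f X G :
  (forall v, v \in stds (r_net' N) t -> vle (nu_in_vec (r_net' N) v t) (f v)) ->
  exists G', reach (mk L (idle_st n)
      (stor [:: X `+` seq_mset [seq f v | v <- stds (r_net' N) t]; mset0; mset0; mset0; mset0; G]))
    (mk L (idle_st n) (stor [:: transferred t f X; mset0; mset0; mset0; mset0; G'])).
Proof.
(* The source is drained completely before it is discarded, so the trash receives a zero tuple. *)
move=> hin; have hv := occ2P t; exists (vec0 P +` G).
have z0 : [mset vec0 P] = vec0 P +` mset0 by rewrite msetD0.
apply: reach_trans (reach_step (step_create _ (RuleStart2 n occ1 occ2 t) erefl)) _.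
rewrite put_stor //= -z0.
have dst0 v : dst2 t v != s_sim by rewrite /dst2; case: ifP => //; case: ifP.
have := @reach_walk N n occ1 occ2 _ (r_net' N) (@dst2 N) occ2 2 t
  (fun j lj => RuleWalk2 occ1 occ2 t lj) dst0 (std_part f) X
  (stor [:: X `+` seq_mset [seq f v | v <- stds (r_net' N) t]; mset0; mset0; mset0; [mset vec0 P]; G]).
have -> : seq_mset [seq std_part f v | v <- seen occ2 t n & ~~ is_fresh v] =
    seq_mset [seq f v | v <- stds (r_net' N) t].
  by rewrite (mset_map_perm _ (perm_stds hv)) map_std_part.
move=> H; apply: reach_trans (H _ _ _) _ => //.
- move=> v vs fr; have hs : v \in stds (r_net' N) t by rewrite mem_stds fr -hv.2 vs.
  by rewrite (std_part_std _ hs); exact: hin.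
- by move=> v fr; rewrite /std_part fr.
apply: reach_trans (reach_step (step_noop _ (RuleEnd2 n occ1 occ2 t))) _.
set A := (fun q : slot => _).
pose g := gain (r_net' N) t f.
have pv : perm_eq (seen occ2 t n) [:: rx0 t; rx1 t; rx2 t].
  rewrite -(perm_filterC is_fresh (seen occ2 t n)) perm_sym.
  have -> : [seq v <- seen occ2 t n | is_fresh v] = [::].
    by apply/eqP; rewrite -size_eq0 (perm_size (perm_freshs hv)) rx_freshs.
  rewrite perm_sym; exact: perm_trans (perm_stds hv) (rx_stds t).
have fs : [seq gain (r_net' N) t (std_part f) v | v <- [:: rx0 t; rx1 t; rx2 t]] =
    [seq g v | v <- [:: rx0 t; rx1 t; rx2 t]].
  apply/eq_in_map => v hv'; rewrite /g /gain (@std_part_std _ (r_net' N) t) //.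
  by rewrite (perm_mem (rx_stds t)).
have fl q : seq_mset [seq gain (r_net' N) t (std_part f) v | v <- seen occ2 t n & dst2 t v == q] =
    seq_mset [seq g v | v <- [:: rx0 t; rx1 t; rx2 t] & dst2 t v == q].
  rewrite (mset_map_perm _ (perm_filter _ pv)); congr seq_mset.
  apply/eq_in_map => v; rewrite mem_filter => /andP[_ hv'].
  rewrite /g /gain (@std_part_std _ (r_net' N) t) //.
  by rewrite (perm_mem (rx_stds t)).
have d0 : dst2 t (rx0 t) = s_sel.
  have := rx_uniq t; rewrite /= !inE negb_or => /and3P[/andP[n1 n2] _ _].
  by rewrite /dst2 (negbTE n1) (negbTE n2).
have d1 : dst2 t (rx1 t) = s_src by rewrite /dst2 eqxx.
have d2 : dst2 t (rx2 t) = s_dst.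
  have := rx_uniq t; rewrite /= !inE negb_or => /and3P[_ n1 _].
  by rewrite /dst2 eq_sym (negbTE n1) eqxx.
have -> : A = stor [:: X; [mset g (rx0 t)]; [mset g (rx1 t)]; [mset g (rx2 t)]; [mset vec0 P]; G].
  apply: functional_extensionality => q; rewrite /A fl /= d0 d1 d2.
  by case: q => -[|[|[|[|[|[|//]]]]]] lq; rewrite /stor /= ?seq_mset1 ?seq_mset_nil ?mset0D ?msetD0.
apply: reach_trans (reach_drain _ _ _ _ _ _ _) _.
have e0 (x : vec P) : [mset x] `\ x = mset0.
  by apply/msetP => y; rewrite msetB1E msetnE mset0E; case: eqP.
have mh (x : vec P) : x \in [mset x] by rewrite in_mset1.
have r1 := step_move (RuleTrash n occ1 occ2 t) (m := vec0 P)
  (A := stor [:: X; [mset g (rx0 t)]; [mset vec0 P]; [mset tr2 t (g (rx1 t)) (g (rx2 t))];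
    [mset vadd (vec0 P) (tr1 t (g (rx1 t)))]; G]) (mh _) (@vle0 _ _).
apply: reach_trans (reach_step r1) _.
rewrite rem_stor // put_stor //= e0 fire0.
have -> : vadd (vec0 P) (tr1 t (g (rx1 t))) = tr1 t (g (rx1 t)).
  by apply/ffunP => q; rewrite !ffunE.
have r2 := step_move (RuleNew n occ1 occ2) (m := tr1 t (g (rx1 t)))
  (A := stor [:: X; [mset g (rx0 t)]; mset0; [mset tr2 t (g (rx1 t)) (g (rx2 t))];
    [mset tr1 t (g (rx1 t))]; vec0 P +` G]) (mh _) (@vle0 _ _).
apply: reach_trans (reach_step r2) _.
rewrite rem_stor // put_stor //= e0 fire0.
have r3 := step_move (RuleDst n occ1 occ2) (m := tr2 t (g (rx1 t)) (g (rx2 t)))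
  (A := stor [:: X; tr1 t (g (rx1 t)) +` [mset g (rx0 t)]; mset0;
    [mset tr2 t (g (rx1 t)) (g (rx2 t))]; mset0; vec0 P +` G]) (mh _) (@vle0 _ _).
apply: reach_trans (reach_step r3) _.
rewrite rem_stor // put_stor //= e0 fire0.
have := reach_return X (tr2 t (g (rx1 t)) (g (rx2 t)) +` (tr1 t (g (rx1 t)) +` [mset g (rx0 t)]))
  mset0 mset0 mset0 (vec0 P +` G).
congr (reach _ (mk _ _ (stor (_ :: _)))).
by apply/msetP => m; rewrite /transferred -/g !msetDE; lia.
Qed.

Lemma sim_steps M M' G : clos_refl_trans _ (@r_step N) M M' ->
  exists G', reach (mk L (idle_st n) (stor [:: M; mset0; mset0; mset0; mset0; G]))
    (mk L (idle_st n) (stor [:: M'; mset0; mset0; mset0; mset0; G'])).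
Proof.
move=> h; elim: h G => {M M'} [M M' [[t [k [ms [e hf]]]]|[t ht]]|M|M1 M2 M3 _ IH1 _ IH2] G.
- have [X [f [hin _ -> ->]]] := nu_fires_inv hf.
  by exists G; exact: sim_nu.
- by have [X [f [hin -> ->]]] := transfer_inv ht; exact: sim_transfer.
- by exists G; exact: reach_refl.
have [G1 r1] := IH1 G; have [G2 r2] := IH2 G1.
by exists G2; exact: reach_trans r1 r2.
Qed.

End Completeness.

(** * Soundness: runs of the object system stay below coverable configurations *)

Section Soundness.
Variables (N : rnuPN) (n : nat).
Notation P := (r_place N).
Variables (occ1 : r_trans N -> nat -> option var) (occ2 : r_trans' N -> nat -> option var).
Hypothesis occ1P : forall t, lists_vars (r_net N) t (seen occ1 t n).
Hypothesis occ2P : forall t, lists_vars (r_net' N) t (seen occ2 t n).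
Hypothesis T_le : #|r_trans N| <= n.
Hypothesis T'_le : #|r_trans' N| <= n.
Hypothesis P_le : #|P| <= n.
Variable init : config P.

Notation L := (rules n occ1 occ2).
Notation E := (sim_eos L).
Notation store := (store P).
Implicit Types (X : config P) (m : vec P) (A : store).

(** The invariant claims domination only, not reachability: this is what makes losses during a
    transfer harmless. *)
Definition Cov X : Prop := exists M, clos_refl_trans _ (@r_step N) init M /\ cle X M.

Lemma Cov_le X Y : cle X Y -> Cov Y -> Cov X.
Proof. by move=> h [M [r hM]]; exists M; split=> //; exact: cle_trans h hM. Qed.

(** During a walk the net has not fired yet, so [Cov] counts the bound tuples with their old values
    [f v]. [A0] is the store without the updated tuples, and [K] the content that [s_new] had before
    the walk. *)
Definition Walk (T : finType) (Nt : nuPN P T) (dst : T -> var -> slot)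
    (occ : T -> nat -> option var) (K : config P) (t : T) (j : nat) (A : store) : Prop :=
  exists (A0 : store) (f : var -> vec P),
    [/\ [/\ A0 s_src = mset0, A0 s_dst = mset0 & A0 s_new = K],
        forall v, is_fresh v -> f v = vec0 P,
        forall v, v \in seen occ t j -> ~~ is_fresh v -> vle (nu_in_vec Nt v t) (f v),
        forall q, q != s_sim ->
          A q = A0 q `+` seq_mset [seq gain Nt t f v | v <- seen occ t j & dst t v == q] &
        Cov (A s_sim `+` A0 s_sel `+` seq_mset [seq f v | v <- seen occ t j & ~~ is_fresh v])].

(* [u] and [v] are the tuples that the exact transfer produces. *)
Definition Moving (t : r_trans' N) (a b c u v : vec P) : Prop :=
  [/\ forall p, p != (r_transfer t).1 -> a p + b p <= u p,
      b (r_transfer t).1 <= u (r_transfer t).1 &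
      forall p, c p + (p == (r_transfer t).2) * a (r_transfer t).1 <= v p].

Definition Held A (a b c u v : vec P) : Prop :=
  [/\ A s_src = [mset a], A s_new = [mset b], A s_dst = [mset c] &
      Cov (A s_sim `+` A s_sel `+` [mset u] `+` [mset v])].

(** In phases 3 and 4 the net has already performed the whole transfer, and its exact results [u]
    and [v] dominate whatever the partial draining produces. In phase 4 the token in transit on [p]
    is counted as still lying on the source. Tuples on [s_sel] count as present, those on [s_trash]
    do not. *)
Inductive Inv : vec slot -> store -> Prop :=
| InvIdle A : [/\ A s_src = mset0, A s_dst = mset0 & A s_new = mset0] ->
    Cov (A s_sim `+` A s_sel) -> Inv (idle_st n) A
| InvWalk1 t j A : j <= n -> Walk (r_net N) (@dst1 N) occ1 mset0 t j A ->
    Inv (st n 1 (rk t) j) A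
| InvWalk2 t j A : j <= n -> Walk (r_net' N) (@dst2 N) occ2 [mset vec0 P] t j A ->
    Inv (st n 2 (rk t) j) A
| InvMove t a b c u v A : Held A a b c u v -> Moving t a b c u v -> Inv (st n 3 (rk t) 0) A
| InvBack t p a b c u v A : Held A a b c u v -> Moving t (vadd a (unitv p)) b c u v ->
    Inv (st n 4 (rk t) (rk p)) A
| InvNew b c A : [/\ A s_src = mset0, A s_new = [mset b] & A s_dst = [mset c]] ->
    Cov (A s_sim `+` A s_sel `+` [mset b] `+` [mset c]) -> Inv (st n 5 0 0) A
| InvDst c A : [/\ A s_src = mset0, A s_new = mset0 & A s_dst = [mset c]] ->
    Cov (A s_sim `+` A s_sel `+` [mset c]) -> Inv (st n 6 0 0) A.

Lemma rkT (t : r_trans N) : rk t <= n. Proof. by apply: leq_trans T_le; exact: ltnW (rk_lt t). Qed.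
Lemma rkT' (t : r_trans' N) : rk t <= n. Proof. by apply: leq_trans T'_le; exact: ltnW (rk_lt t). Qed.
Lemma rkP (p : P) : rk p <= n. Proof. by apply: leq_trans P_le; exact: ltnW (rk_lt p). Qed.

(** This and the next six inversions rest on [st_le]: the required and the actual control marking
    are both states, and domination between states is equality. The ranks must not exceed [n], since
    otherwise the truncated complements would no longer separate them. *)
Lemma Inv_idle s A : Inv s A -> vle (idle_st n) s ->
  [/\ s = idle_st n, [/\ A s_src = mset0, A s_dst = mset0 & A s_new = mset0] &
      Cov (A s_sim `+` A s_sel)].
Proof.
case=> [{}A h1 h2 _|t j {}A lj _ h|t j {}A lj _ h|t a b c u v {}A _ _ h|t p a b c u v {}A _ _ h
  |b c {}A _ _ h|c {}A _ _ h] //.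
all: by have := st_le h isT; rewrite ?rkT ?rkT' ?rkP ?lj => /(_ isT isT)[].
Qed.

Lemma Inv_walk1 s A t j : Inv s A -> vle (st n 1 (rk t) j) s ->
  s = st n 1 (rk t) j /\ Walk (r_net N) (@dst1 N) occ1 mset0 t j A.
Proof.
case=> [{}A _ _ h|t' j' {}A lj hW h|t' j' {}A lj _ h|t' a b c u v {}A _ _ h
  |t' p a b c u v {}A _ _ h|b c {}A _ _ h|c {}A _ _ h].
all: have := st_le h isT; rewrite ?rkT ?rkT' ?rkP ?lj => /(_ isT isT)[] //.
by move=> _ /rk_inj -> ->.
Qed.

Lemma Inv_walk2 s A t j : Inv s A -> vle (st n 2 (rk t) j) s ->
  s = st n 2 (rk t) j /\ Walk (r_net' N) (@dst2 N) occ2 [mset vec0 P] t j A.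
Proof.
case=> [{}A _ _ h|t' j' {}A lj _ h|t' j' {}A lj hW h|t' a b c u v {}A _ _ h
  |t' p a b c u v {}A _ _ h|b c {}A _ _ h|c {}A _ _ h].
all: have := st_le h isT; rewrite ?rkT ?rkT' ?rkP ?lj => /(_ isT isT)[] //.
by move=> _ /rk_inj -> ->.
Qed.

Lemma Inv_move s A t : Inv s A -> vle (st n 3 (rk t) 0) s ->
  s = st n 3 (rk t) 0 /\ exists a b c u v, Held A a b c u v /\ Moving t a b c u v.
Proof.
case=> [{}A _ _ h|t' j' {}A lj _ h|t' j' {}A lj _ h|t' a b c u v {}A h1 h2 h
  |t' p a b c u v {}A _ _ h|b c {}A _ _ h|c {}A _ _ h].
all: have := st_le h isT; rewrite ?rkT ?rkT' ?rkP ?lj => /(_ isT isT)[] //.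
by move=> _ /rk_inj -> _; split=> //; exists a, b, c, u, v.
Qed.

Lemma Inv_back s A t p : Inv s A -> vle (st n 4 (rk t) (rk p)) s ->
  s = st n 4 (rk t) (rk p) /\
  exists a b c u v, Held A a b c u v /\ Moving t (vadd a (unitv p)) b c u v.
Proof.
case=> [{}A _ _ h|t' j' {}A lj _ h|t' j' {}A lj _ h|t' a b c u v {}A _ _ h
  |t' p' a b c u v {}A h1 h2 h|b c {}A _ _ h|c {}A _ _ h].
all: have := st_le h isT; rewrite ?rkT ?rkT' ?rkP ?lj => /(_ isT isT)[] //.
by move=> _ /rk_inj -> /rk_inj ->; split=> //; exists a, b, c, u, v.
Qed.

Lemma Inv_new s A : Inv s A -> vle (st n 5 0 0) s ->
  s = st n 5 0 0 /\ exists b c, [/\ A s_src = mset0, A s_new = [mset b] & A s_dst = [mset c]] /\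
    Cov (A s_sim `+` A s_sel `+` [mset b] `+` [mset c]).
Proof.
case=> [{}A _ _ h|t' j' {}A lj _ h|t' j' {}A lj _ h|t' a b c u v {}A _ _ h
  |t' p' a b c u v {}A _ _ h|b c {}A h1 h2 h|c {}A _ _ h].
all: have := st_le h isT; rewrite ?rkT ?rkT' ?rkP ?lj => /(_ isT isT)[] //.
by split=> //; exists b, c.
Qed.

Lemma Inv_dst s A : Inv s A -> vle (st n 6 0 0) s ->
  s = st n 6 0 0 /\ exists c, [/\ A s_src = mset0, A s_new = mset0 & A s_dst = [mset c]] /\
    Cov (A s_sim `+` A s_sel `+` [mset c]).
Proof.
case=> [{}A _ _ h|t' j' {}A lj _ h|t' j' {}A lj _ h|t' a b c u v {}A _ _ h
  |t' p' a b c u v {}A _ _ h|b c {}A _ _ h|c {}A h1 h2 h].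
all: have := st_le h isT; rewrite ?rkT ?rkT' ?rkP ?lj => /(_ isT isT)[] //.
by split=> //; exists c.
Qed.

Definition after (A : store) (r : rule P) (m m' : vec P) : store :=
  put (rem A (r_kind r).1 m) (dest (r_kind r)) m'.

Definition ready (A : store) (r : rule P) (m m' : vec P) : Prop :=
  [/\ present A (r_kind r).1 m, vle (r_take r) (somev (r_kind r).1 m) &
    somev (dest (r_kind r)) m' = fire (r_take r) (r_give r) (somev (r_kind r).1 m)].

Section WalkStep.
Variables (T : finType) (Nt : nuPN P T) (dst : T -> var -> slot).
Variables (occ : T -> nat -> option var) (c : nat) (t : T) (K : config P).
Hypothesis Hdst : forall v, dst t v != s_sim.
Hypothesis Huniq : uniq (seen occ t n).

Lemma seen_split j : j <= n -> seen occ t n = seen occ t j ++ unseen n occ t j.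
Proof. by move=> lj; rewrite /seen /unseen -pmap_cat -{2}(add0n j) -iotaD subnKC. Qed.

Lemma walk_step j A m m' : j < n -> Walk Nt dst occ K t j A ->
  ready A (walk_rule n Nt dst occ c t j) m m' ->
  Walk Nt dst occ K t j.+1 (after A (walk_rule n Nt dst occ c t j) m m').
Proof.
move=> lj [A0 [f [hA0 hfr hin hA hC]]]; rewrite /ready /after /walk_rule.
case eo : (occ t j) => [v|] /=; last first.
  by move=> _; exists A0, f; rewrite seenS eo /= cats0.
rewrite /r_take /r_give /r_kind /dest /=; case fr : (is_fresh v) => /= -[hp ht hm].
  have em : m' = gain Nt t f v.
    rewrite hm gain_fresh ?hfr //; apply/ffunP => p; rewrite !ffunE sub0n add0n //.
  exists A0, f; split=> //.
  - move=> w; rewrite seenS eo mem_cat => /orP[/hin //|]; rewrite inE => /eqP-> .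
    by rewrite fr.
  - move=> q nq; rewrite seenS eo filter_cat map_cat seq_mset_cat msetDA -hA //=.
    rewrite em eq_sym; case: eqP => _ /=; last by rewrite seq_mset_nil msetD0.
    by rewrite seq_mset1 msetDC.
  rewrite eq_sym (negbTE (Hdst v)) seenS eo filter_cat /= fr /= cats0; exact: hC.
(* As [v] has not been met before, the assignment can be redefined at [v] as the tuple just taken
   without affecting earlier variables. *)
have vn : v \notin seen occ t j.
  move: Huniq; rewrite (seen_split (ltnW lj)) unseenS // eo cat_uniq => /and3P[_ + _].
  by rewrite /= negb_or => /andP[].
pose f' w := if w == v then m else f w.
have ef w : w \in seen occ t j -> f' w = f w.
  by rewrite /f'; case: eqP => // -> h; rewrite h in vn.
have eg w : w \in seen occ t j -> gain Nt t f' w = gain Nt t f w.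
  by move=> hw; rewrite /gain ef.
have fv : f' v = m by rewrite /f' eqxx.
exists A0, f'; split=> //.
- by move=> w fw; rewrite /f'; case: eqP => [ew|_]; [rewrite ew fr in fw|exact: hfr].
- move=> w; rewrite seenS eo mem_cat => /orP[hw|]; first by rewrite ef //; exact: hin.
  by rewrite inE => /eqP-> _; rewrite fv.
- move=> q nq; rewrite seenS eo filter_cat map_cat seq_mset_cat msetDA.
  have -> : [seq gain Nt t f' w | w <- seen occ t j & dst t w == q] =
      [seq gain Nt t f w | w <- seen occ t j & dst t w == q].
    by apply/eq_in_map => w; rewrite mem_filter => /andP[_ /eg].
  rewrite -hA // eq_sym (negbTE nq) /=; case: eqP => _ /=; last by rewrite seq_mset_nil msetD0.
  by rewrite seq_mset1 msetDC /gain fv hm.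
rewrite eq_sym (negbTE (Hdst v)) seenS eo filter_cat /= fr /= map_cat seq_mset_cat.
have -> : [seq f' w | w <- seen occ t j & ~~ is_fresh w] =
    [seq f w | w <- seen occ t j & ~~ is_fresh w].
  by apply/eq_in_map => w; rewrite mem_filter => /andP[_ /ef].
rewrite seq_mset1 fv; move: hC; rewrite -{1}(@msetB1K (vec P) _ _ hp).
by congr Cov; apply/msetP => x; rewrite !msetDE; lia.
Qed.

End WalkStep.

Lemma vsubvK (s to : vec slot) : vadd (vsub s s) to = to.
Proof. by apply/ffunP => q; rewrite !ffunE subnn. Qed.

Lemma fireE (x y m : vec P) p : fire x y m p = m p - x p + y p.
Proof. by rewrite !ffunE. Qed.

Lemma dst2_sim t v : @dst2 N t v != s_sim.
Proof. by rewrite /dst2; case: ifP => //; case: ifP. Qed.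

(** Only now does the net fire: the covering configuration dominates all bound tuples, so by
    monotonicity it can fire the same transition. *)
Lemma end_walk1 t A : Walk (r_net N) (@dst1 N) occ1 mset0 t n A -> Inv (idle_st n) A.
Proof.
move=> [A0 [f [[z1 z2 z3] hfr hin hA hC]]].
have hv := occ1P t.
have fF : [seq v <- seen occ1 t n | false] = [::] := filter_pred0 _.
have fT : [seq v <- seen occ1 t n | true] = seen occ1 t n := filter_predT _.
constructor; first by split; rewrite hA //= ?fF /= seq_mset_nil msetD0.
rewrite (hA s_sel) //= fT (mset_gain_split hv hfr).
have [M [rM hM]] := hC.
rewrite (mset_map_perm _ (perm_stds hv)) in hM.
have [|Z [g [k [ms [e [hZ hg hu hf]]]]]] := nu_fires_mono _ hM.
  by move=> v; rewrite mem_stds -hv.2 => /andP[h1 h2]; exact: hin.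
exists (Z `+` seq_mset [seq nu_out_vec (r_net N) v t | v <- freshs (r_net N) t]
         `+` seq_mset [seq gain (r_net N) t g v | v <- stds (r_net N) t]).
split.
  apply: rt_trans rM (rt_step _ _ _ _ _); left; exists t, k, ms, e; exact: hf.
rewrite msetDA msetDA; apply: cleD; first by apply: cleD => //; exact: cle_refl.
by apply: cle_map2 => v hvs; apply: gain_le; exact: hg.
Qed.

(** Here the net fires the exact transfer at once, before the draining starts; [u] and [v] are its
    two results. *)
Lemma end_walk2 t A : Walk (r_net' N) (@dst2 N) occ2 [mset vec0 P] t n A ->
  Inv (st n 3 (rk t) 0) A.
Proof.
move=> [A0 [f [[z1 z2 z3] hfr hin hA hC]]].
have hv := occ2P t.
pose g := gain (r_net' N) t f.
have pv : perm_eq (seen occ2 t n) [:: rx0 t; rx1 t; rx2 t].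
  rewrite -(perm_filterC is_fresh (seen occ2 t n)) perm_sym.
  have -> : [seq v <- seen occ2 t n | is_fresh v] = [::].
    by apply/eqP; rewrite -size_eq0 (perm_size (perm_freshs hv)) rx_freshs.
  rewrite perm_sym; exact: perm_trans (perm_stds hv) (rx_stds t).
have fl q : seq_mset [seq gain (r_net' N) t f v | v <- seen occ2 t n & dst2 t v == q] =
    seq_mset [seq g v | v <- [:: rx0 t; rx1 t; rx2 t] & dst2 t v == q].
  by rewrite (mset_map_perm _ (perm_filter _ pv)).
have d0 : dst2 t (rx0 t) = s_sel.
  have := rx_uniq t; rewrite /= !inE negb_or => /and3P[/andP[n1 n2] _ _].
  by rewrite /dst2 (negbTE n1) (negbTE n2).
have d1 : dst2 t (rx1 t) = s_src by rewrite /dst2 eqxx.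
have d2 : dst2 t (rx2 t) = s_dst.
  have := rx_uniq t; rewrite /= !inE negb_or => /and3P[_ n1 _].
  by rewrite /dst2 eq_sym (negbTE n1) eqxx.
have [M [rM hM]] := hC; rewrite (mset_map_perm _ (perm_stds hv)) in hM.
have [|M' [hf hM']] := transfer_mono _ hM.
  by move=> v; rewrite mem_stds -hv.2 => /andP[h1 h2]; exact: hin.
have cov : Cov (transferred t f (A s_sim `+` A0 s_sel)).
  exists M'; split=> //; apply: rt_trans rM (rt_step _ _ _ _ _); right; exists t; exact: hf.
apply: (@InvMove t (g (rx1 t)) (vec0 P) (g (rx2 t)) (tr1 t (g (rx1 t)))
  (tr2 t (g (rx1 t)) (g (rx2 t)))).
  split; rewrite ?(hA s_src) ?(hA s_new) ?(hA s_dst) ?(hA s_sel) // ?fl ?z1 ?z2 ?z3 /= ?d0 ?d1 ?d2 /= ?seq_mset1 ?seq_mset_nil ?mset0D ?msetD0 //.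
  move: cov; congr Cov; rewrite /transferred -/g.
  by apply/msetP => x; rewrite !msetDE; lia.
split=> [p np||p].
- by rewrite !ffunE (negbTE np) muln0 subn0 addn0.
- by rewrite ffunE.
by rewrite !ffunE mulnC.
Qed.

Lemma Inv_step s A r m m' : Inv s A -> rule_spec n occ1 occ2 r -> vle (r_from r) s ->
  ready A r m m' -> Inv (vadd (vsub s (r_from r)) (r_to r)) (after A r m m').
Proof.
move=> hI hr; case: hr => [|t|t j lj|t|t|t j lj|t|t p|t p|t||].
- move=> /(Inv_idle hI)[-> [q1 q2 q3] hC] [/= hm _ em].
  rewrite vsubvK; apply: InvIdle => //=; move: hC; rewrite em /r_take /r_give /= fire0.
  rewrite -{1}(@msetB1K (vec P) _ _ hm); congr Cov; apply/msetP => x; rewrite /after /put /rem /= !msetDE; lia.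
- move=> /(Inv_idle hI)[-> [q1 q2 q3] hC] _.
  rewrite vsubvK; apply: InvWalk1 => //; exists A, (fun _ => vec0 P); split=> //.
    by move=> q _; rewrite /seen /= seq_mset_nil msetD0.
  by rewrite /seen /= seq_mset_nil msetD0.
- have -> : r_from (walk_rule n (r_net N) (@dst1 N) occ1 1 t j) = st n 1 (rk t) j.
    by rewrite /walk_rule; case: (occ1 t j).
  have -> : r_to (walk_rule n (r_net N) (@dst1 N) occ1 1 t j) = st n 1 (rk t) j.+1.
    by rewrite /walk_rule; case: (occ1 t j).
  move=> /(Inv_walk1 hI)[-> hW] hR; rewrite vsubvK; apply: InvWalk1 => //.
  by apply: walk_step => //; case: (occ1P t).
- move=> /(Inv_walk1 hI)[-> hW] _; rewrite vsubvK; exact: end_walk1 hW.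
- move=> /(Inv_idle hI)[-> [q1 q2 q3] hC] [_ _ em].
  rewrite vsubvK; apply: InvWalk2 => //.
  exists (after A (rl None (Some s_new) (idle_st n) (st n 2 (rk t) 0) (vec0 P) (vec0 P)) m m'),
    (fun _ => vec0 P); split=> //=.
  + split=> //=; rewrite /after /put /rem /= q3 msetD0; congr [mset _]; rewrite /= in em; rewrite em /r_take /r_give /=.
    by apply/ffunP => p; rewrite !ffunE.
  + by move=> q _; rewrite /seen /= seq_mset_nil msetD0.
  by rewrite /seen /= seq_mset_nil msetD0.
- have -> : r_from (walk_rule n (r_net' N) (@dst2 N) occ2 2 t j) = st n 2 (rk t) j.
    by rewrite /walk_rule; case: (occ2 t j).
  have -> : r_to (walk_rule n (r_net' N) (@dst2 N) occ2 2 t j) = st n 2 (rk t) j.+1.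
    by rewrite /walk_rule; case: (occ2 t j).
  move=> /(Inv_walk2 hI)[-> hW] hR; rewrite vsubvK; apply: InvWalk2 => //.
  by apply: walk_step => //; [exact: dst2_sim|case: (occ2P t)].
- move=> /(Inv_walk2 hI)[-> hW] _; rewrite vsubvK; exact: end_walk2 hW.
(* With the token in transit added back the source is [a] again, so the bounds do not change. *)
- move=> /(Inv_move hI)[-> [a [b [c [u [v [[ha hb hc hC] [m1 m2 m3]]]]]]]] [/= hm ht em].
  have ea : m = a by move: hm; rewrite ha in_mset1 => /eqP.
  subst m; have e0 : [mset a] `\ a = mset0.
    by apply/msetP => y; rewrite msetB1E msetnE mset0E; case: eqP.
  rewrite vsubvK; apply: (@InvBack t p m' b c u v); first by split; rewrite // /after /put /rem /= ha e0 msetD0.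
  have ap : vadd m' (unitv p) = a.
    rewrite em /r_take /r_give /=; apply/ffunP => q; have := ht q.
    by rewrite !ffunE addn0 => h; rewrite subnK.
  by rewrite ap; split.
(* A token from the transfer place may raise the target at the receiving place, because [a] together
   with its token in transit had reserved this amount; any other token raises [b] within the bound
   [u]. *)
- rewrite /back_rule; have [->|np] := eqVneq p (r_transfer t).1.
    move=> /(Inv_back hI)[-> [a [b [c [u [v [[ha hb hc hC] [m1 m2 m3]]]]]]]] [/= hm ht em].
    have ec : m = c by move: hm; rewrite hc in_mset1 => /eqP.
    subst m; have e0 : [mset c] `\ c = mset0.
      by apply/msetP => y; rewrite msetB1E msetnE mset0E; case: eqP.
    rewrite vsubvK; apply: (@InvMove t a b m' u v); first by split; rewrite // /after /put /rem /= hc e0 msetD0.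
    split=> // q; first by move=> nq; have := m1 q nq; rewrite !ffunE (negbTE nq) addn0.
    by have := m3 q; rewrite em fireE !ffunE eqxx; case: (q == _); rewrite ?mul1n ?mul0n; lia.
  move=> /(Inv_back hI)[-> [a [b [c [u [v [[ha hb hc hC] [m1 m2 m3]]]]]]]] [/= hm ht em].
  have eb : m = b by move: hm; rewrite hb in_mset1 => /eqP.
  subst m; have e0 : [mset b] `\ b = mset0.
    by apply/msetP => y; rewrite msetB1E msetnE mset0E; case: eqP.
  rewrite vsubvK; apply: (@InvMove t a m' c u v); first by split; rewrite // /after /put /rem /= hb e0 msetD0.
  rewrite eq_sym in np; split=> [q nq||q].
  + by have := m1 q nq; rewrite em fireE !ffunE; lia.
  + by rewrite em fireE !ffunE (negbTE np); lia.
  by have := m3 q; rewrite !ffunE (negbTE np) addn0.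
- move=> /(Inv_move hI)[-> [a [b [c [u [v [[ha hb hc hC] [m1 m2 m3]]]]]]]] [/= hm ht em].
  have ea : m = a by move: hm; rewrite ha in_mset1 => /eqP.
  subst m; have e0 : [mset a] `\ a = mset0.
    by apply/msetP => y; rewrite msetB1E msetnE mset0E; case: eqP.
  rewrite vsubvK; apply: (@InvNew b c); rewrite /after /put /rem /= ?ha ?e0 //.
  (* Whatever is left of [a] is lost here. The bounds give [b] below [u] and [c] below [v], so the
     remainder is dominated by the exact result. *)
  apply: Cov_le hC; apply: cleD; first apply: cleD; first exact: cle_refl.
    apply: cle1 => p; have [->|np] := eqVneq p (r_transfer t).1; first exact: m2.
    by apply: leq_trans (m1 p np); rewrite leq_addl.
  by apply: cle1 => p; apply: leq_trans (m3 p); rewrite leq_addr.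
- move=> /(Inv_new hI)[-> [b [c [[ha hb hc] hC]]]] [/= hm ht em].
  have eb : m = b by move: hm; rewrite hb in_mset1 => /eqP.
  subst m; have e0 : [mset b] `\ b = mset0.
    by apply/msetP => y; rewrite msetB1E msetnE mset0E; case: eqP.
  rewrite vsubvK; apply: (@InvDst c); rewrite /after /put /rem /= ?hb ?e0 //.
  move: hC; rewrite em /r_take /r_give /= fire0; congr Cov.
  by apply/msetP => x; rewrite /after /put /rem /= !msetDE; lia.
move=> /(Inv_dst hI)[-> [c [[ha hb hc] hC]]] [/= hm ht em].
have ec : m = c by move: hm; rewrite hc in_mset1 => /eqP.
subst m; have e0 : [mset c] `\ c = mset0.
  by apply/msetP => y; rewrite msetB1E msetnE mset0E; case: eqP.
rewrite vsubvK; apply: InvIdle; rewrite /after /put /rem /= ?hc ?e0 //.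
move: hC; rewrite em /r_take /r_give /= fire0; congr Cov.
by apply/msetP => x; rewrite /after /put /rem /= !msetDE; lia.
Qed.

Lemma reach_Inv mu mu' : reach mu mu' -> (exists s A, mu = mk L s A /\ Inv s A) ->
  exists s A, mu' = mk L s A /\ Inv s A.
Proof.
elim=> {mu mu'} [mu mu' hs [s [A [emu hI]]]|//|mu1 mu2 mu3 _ IH1 _ IH2 /IH1/IH2 //].
rewrite emu in hs; have [r [m [m' [hr hle hp [ht hm] ->]]]] := eos_step_inv hs.
eexists _, _; split; first by reflexivity.
by apply: Inv_step => //; apply/rulesP.
Qed.

End Soundness.

(** * The two coverability questions agree *)

Section Coverability.
Variables (N : rnuPN) (n : nat).
Notation P := (r_place N).
Variables (occ1 : r_trans N -> nat -> option var) (occ2 : r_trans' N -> nat -> option var).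

Notation L := (rules n occ1 occ2).
Notation E := (sim_eos L).
Implicit Types (X : config P) (m : vec P) (A : store P).

Lemma marking_leP (mu mu' : marking E) : marking_le mu mu' <-> mle (@nested_le E) mu mu'.
Proof.
split=> [[k [xs [ys [added [-> -> h]]]]]|[l [X [-> -> h]]]].
  exists [seq (tnth xs i, tnth ys i) | i <- enum 'I_k], added; split.
  - by rewrite /unzip1 -map_comp map_tnth_enum.
  - by rewrite /unzip2 -map_comp map_tnth_enum.
  by move=> x /mapP[i _ ->]; exact: h.
exists (size l), (map_tuple fst (in_tuple l)), (map_tuple snd (in_tuple l)), X.
by split=> // i; rewrite !tnth_map; apply: h; exact: mem_tnth.
Qed.

Lemma nested_le_ctl s y : nested_le (ctl L s) y -> exists2 s', y = ctl L s' & vle s s'.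
Proof.
move e : (ctl L s) => x hx; case: hx e => -[q|] m m' le e.
  by move/(congr1 tag): e.
exists m' => //; suff -> : s = m by [].
by apply/eqP; rewrite -(ctl_inj L); apply/eqP.
Qed.

Lemma nested_le_tok q m y : nested_le (tok L q m) y -> exists2 m', y = tok L q m' & vle m m'.
Proof.
move e : (tok L q m) => x hx; case: hx e => -[q'|] m1 m' le e; last by move/(congr1 tag): e.
have eq : q = q' by move/(congr1 tag): e => -[].
subst q'; exists m' => //; suff -> : m = m1 by [].
by apply/eqP; rewrite -(tok_inj L q); apply/eqP.
Qed.

Definition toks (X : config P) : marking E :=
  seq_mset [seq tok L s_sim m | m <- enum_mset X].

Lemma toks_cons m X : toks (m +` X) = tok L s_sim m +` toks X.
Proof.
rewrite /toks -seq_mset_cons -map_cons; apply/eq_seq_msetP; apply: perm_map.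
by apply: perm_trans (perm_msetD _ _) _; rewrite enum_mset1.
Qed.

Lemma toks0 : toks mset0 = mset0.
Proof. by rewrite /toks enum_mset0 seq_mset_nil. Qed.

(** Since comparable nested tokens lie on the same place, only the multiplicities on [s_sim]
    matter. *)
Lemma toks_elim X (B : marking E) (C : config P) : (forall m, B (tok L s_sim m) = C m) ->
  mle (@nested_le E) (toks X) B -> cle X C.
Proof.
elim/config_ind: X B C => [|m X IH] B C hBC; first by move=> _; exact: cle0.
rewrite toks_cons => /mle_cons[u [B' [eB /nested_le_tok[m' eu mm'] hB']]].
have hm' : m' \in C by rewrite in_mset -hBC eB eu msetDE msetnxx.
apply/cle_cons; exists m', (C `\ m'); split=> //; first by rewrite (@msetB1K (vec P)).
by apply: IH hB' => x; rewrite msetB1E -hBC eB eu msetDE msetnE tok_inj; case: eqP; lia.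
Qed.

Lemma toks_intro X (B : marking E) (C : config P) : (forall m, C m <= B (tok L s_sim m)) ->
  cle X C -> mle (@nested_le E) (toks X) B.
Proof.
elim/config_ind: X B C => [|m X IH] B C hBC; first by rewrite toks0 => _; exact: mle0.
move=> /cle_cons[u [C' [eC mu hC']]]; rewrite toks_cons; apply/mle_cons.
have hu : tok L s_sim u \in B.
  by rewrite in_mset; apply: leq_trans (hBC u); rewrite eC msetDE msetnxx.
exists (tok L s_sim u), (B `\ tok L s_sim u); split; first by rewrite msetB1K.
- exact: (@NestedLe E (Some s_sim)).
apply: IH hC' => x; have := hBC x; rewrite eC msetB1E msetDE msetnE tok_inj.
by case: eqP; lia.
Qed.

Definition load (X : config P) : marking E := mk L (idle_st n) (stor [:: X]).

Lemma load_toks X : load X = ctl L (idle_st n) +` toks X.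
Proof.
apply/esym/mkP => [s|q m].
  rewrite msetDE msetnE ctl_inj /toks mset_seqE (_ : count_mem _ _ = 0) ?addn0; first by case: eqP.
  by apply/count_memPn/mapP => -[m _ /(congr1 tag)].
rewrite msetDE msetnE (_ : (tok L q m == _) = false); last by apply/eqP => /(congr1 tag).
rewrite add0n /toks mset_seqE count_map.
have [->|nq] := eqVneq q s_sim.
  by rewrite -[RHS]count_mem_mset; apply: eq_count => m' /=; rewrite tok_inj.
rewrite (eq_count (a2 := pred0)) ?count_pred0 => [|m' /=]; last by rewrite tok_neq // eq_sym.
by rewrite /stor nth_default ?mset0E //; case: q nq => -[].
Qed.

(** The target contains the idle control token, so covering it also tests that no firing is in
    progress; together with the invariant this makes the control state idle. *)
Lemma load_le X s A : marking_le (load X) (mk L s A) <->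
  vle (idle_st n) s /\ cle X (A s_sim).
Proof.
rewrite marking_leP load_toks; split=> [/mle_cons[u [C [e /nested_le_ctl[s' eu hs'] hC]]]|[hs hX]].
  have es : s' = s.
    by have := mk_ctl L s A s'; rewrite e eu msetDE msetnxx; case: eqP.
  split; first by rewrite -es.
  apply: toks_elim hC => m; rewrite -(mk_tok L s) e eu msetDE msetnE.
  by case: eqP => // /(congr1 tag).
apply/mle_cons; exists (ctl L s), (mk L s A `\ ctl L s); split.
- by rewrite msetB1K // in_mset mk_ctl eqxx.
- exact: (@NestedLe E None).
apply: toks_intro hX => m; rewrite msetB1E mk_tok.
by case: eqP => [/(congr1 tag)//|_]; rewrite subn0.
Qed.

Hypothesis occ1P : forall t, lists_vars (r_net N) t (seen occ1 t n).
Hypothesis occ2P : forall t, lists_vars (r_net' N) t (seen occ2 t n).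
Hypothesis T_le : #|r_trans N| <= n.
Hypothesis T'_le : #|r_trans' N| <= n.
Hypothesis P_le : #|P| <= n.

Theorem sim_coverable (init target : config P) :
  rnuPN_coverable (RnuPNInstance init target) <->
  cEOS_coverable (CEOSInstance (@sim_conservative P L) (load init) (load target)).
Proof.
have eload X : load X = mk L (idle_st n) (stor [:: X; mset0; mset0; mset0; mset0; mset0]).
  congr mk; apply: functional_extensionality => q.
  by case: q => -[|[|[|[|[|[|//]]]]]] lq; rewrite /stor /=.
split=> [[M [hr /config_leP hM]]|[mu [hr hmu]]].
  have [G r] := sim_steps occ1P occ2P mset0 hr.
  exists (mk L (idle_st n) (stor [:: M; mset0; mset0; mset0; mset0; G])).
  by split; [rewrite /= eload; exact: r|apply/load_le; split].
have hI : Inv n occ1 occ2 init (idle_st n) (stor [:: init]).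
  constructor => //; exists init; split; first exact: rt_refl.
  by rewrite /stor /= msetD0; exact: cle_refl.
have [|s [A [emu hA]]] := reach_Inv occ1P occ2P T_le T'_le P_le (init := init) hr.
  by exists (idle_st n), (stor [:: init]).
rewrite emu /= in hmu; have [hs hX] := (load_le _ _ _).1 hmu.
(* The covered target forces the idle phase, where everything on [s_sim] and [s_sel] is dominated by
   a reachable configuration; the part on [s_sel] is then dropped. *)
have [_ _ [M [rM hM]]] := Inv_idle T_le T'_le P_le hA hs.
exists M; split=> //; apply/config_leP; apply: cle_trans hX _; apply: cle_trans hM.
by rewrite -[A s_sim in X in cle X]msetD0; apply: cleD; [exact: cle_refl|exact: cle0].
Qed.

End Coverability.

(** * Random access to encoded terms *)

Definition is_l (x : option symb) : bool := if x is Some LPar then true else false.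
Definition is_r (x : option symb) : bool := if x is Some RPar then true else false.
Definition is_bit (x : option symb) : bool := if x is Some (Bit _) then true else false.

Definition is_one (x : option symb) : bool := if x is Some (Bit true) then true else false.

Definition cnt (q : pred (option symb)) (w : word) (a b : nat) : nat :=
  count (fun i => (a <= i) && q (sym w i)) (iota 0 b).

(* If a sequence of terms starts at [a], one of them ends before [b]. *)
Definition endb (w : word) (a b : nat) : bool :=
  [&& a < b, ~~ is_bit (sym w b.-1) & cnt is_l w a b == cnt is_r w a b].

(** A maximum written as a count: the condition holds on an initial segment of positions, whose
    length minus one is its last element. That element is where the [i]-th term ends and the next
    one starts. *)
Definition nthpos (w : word) (a i : nat) : nat :=
  (count (fun q => (q <= a) || (count (endb w a) (iota 0 q) < i))
    (iota 0 (size w).+1)).-1.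

Definition endpos (w : word) (a : nat) : nat := nthpos w a 1.

Definition child (w : word) (a i : nat) : nat :=
  nthpos w (minn a.+1 (size w).+1) i.

Definition arity (w : word) (a : nat) : nat :=
  count (fun q => endb w (minn a.+1 (size w).+1) q && (q < endpos w a)) (iota 0 (size w).+1).

Definition at_plus (w : word) (a k : nat) : option symb := sym w (minn (a + k) (size w).+1).

Definition eqd (w : word) (a b : nat) : bool :=
  (endpos w a - a == endpos w b - b) &&
  all (fun k => at_plus w a k == at_plus w b k) (iota 0 (endpos w a - a)).

Definition val_step (w : word) (a i acc : nat) : nat :=
  if is_bit (at_plus w a i) then
    if is_one (at_plus w a i)
    then minn (minn (acc + acc) (size w).+1).+1 (size w).+1
    else minn (acc + acc) (size w).+1
  else acc.

(** Horner's rule. The fold starts at the last symbol, which suits numerals with the least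
    significant bit first; the separator leaves the accumulator unchanged. *)
Definition value (w : word) (a : nat) : nat :=
  foldr (val_step w a) 0 (iota 0 (endpos w a - a)).

Definition emit_sym (x : option symb) : word := if x is Some s then [:: s] else [::].

Definition copy (w : word) (a : nat) : word :=
  flatten [seq emit_sym (at_plus w a k) | k <- iota 0 (endpos w a - a)].

(** The separator is left out because 0 is the empty word: a missing entry of a multiset then prints
    correctly once a single separator is appended. *)
Definition copy_bits (w : word) (a : nat) : word :=
  flatten [seq (if is_bit (at_plus w a k) then emit_sym (at_plus w a k) else [::])
    | k <- iota 0 (endpos w a - a)].

(** The nested recursion supplies a hypothesis for each element of a list. *)
Fixpoint data_rect' (Q : data -> Prop) (hn : forall n, Q (Num n))
    (hl : forall l, (forall i, i < size l -> Q (nth (Num 0) l i)) -> Q (Lst l)) (d : data) : Q d :=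
  match d with
  | Num n => hn n
  | Lst l => hl l ((fix f (l : seq data) : forall i, i < size l -> Q (nth (Num 0) l i) :=
      match l return forall i, i < size l -> Q (nth (Num 0) l i) with
      | [::] => fun i h => False_ind _ (notF h)
      | x :: l' => fun i => match i return i < size (x :: l') -> Q (nth (Num 0) (x :: l') i) with
                   | 0 => fun _ => data_rect' hn hl x
                   | i'.+1 => fun h => f l' i' h
                   end
      end) l)
  end.

Notation nl u := (count (is_l \o Some) u).
Notation nr u := (count (is_r \o Some) u).

Definition sers (l : seq data) : word := flatten [seq serialize d | d <- l].

Lemma serialize_Lst l : serialize (Lst l) = LPar :: rcons (sers l) RPar.
Proof. by []. Qed.

Lemma nl_bits (s : seq bool) : nl [seq Bit b | b <- s] = 0.
Proof. by elim: s. Qed.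

Lemma nr_bits (s : seq bool) : nr [seq Bit b | b <- s] = 0.
Proof. by elim: s. Qed.

Lemma nat_bits_nl n : nl (rcons [seq Bit b | b <- nat_bits n] Sep) = 0 /\
  nr (rcons [seq Bit b | b <- nat_bits n] Sep) = 0.
Proof. by rewrite -cats1; split; rewrite count_cat ?nl_bits ?nr_bits. Qed.

Lemma serialize_prefix d k : nr (take k (serialize d)) <= nl (take k (serialize d)) /\
  nr (serialize d) = nl (serialize d).
Proof.
elim/data_rect': d k => [n|l IH] k.
  have [e1 e2] := nat_bits_nl n; rewrite /serialize -/(serialize) e1 e2; split=> //.
  have := count_cat (is_r \o Some) (take k (rcons [seq Bit b | b <- nat_bits n] Sep))
    (drop k (rcons [seq Bit b | b <- nat_bits n] Sep)).
  by rewrite cat_take_drop e2; lia.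
rewrite serialize_Lst.
have [hp he] : (forall k, nr (take k (sers l)) <= nl (take k (sers l))) /\ nr (sers l) = nl (sers l).
  elim: l IH {k} => [|d l IHl] IH; first by split=> // k.
  have [hp he] := IHl (fun i li => IH i.+1 li).
  have hd k : nr (take k (serialize d)) <= nl (take k (serialize d)) by have [] := IH 0 isT k.
  have [_ hd'] := IH 0 isT 0; rewrite /= in hd'.
  rewrite /sers /= -/(sers l); split=> [k|]; last by rewrite !count_cat he hd'.
  rewrite take_cat; case: ltnP => _; first exact: hd.
  by rewrite !count_cat hd' leq_add2l.
split; last by rewrite /= -cats1 !count_cat /= he; lia.
case: k => // k; rewrite /= -cats1 take_cat; case: ltnP => _.
  by rewrite add0n add1n; apply: leqW.
by rewrite !count_cat he add0n add1n; case: (k - _) => [|k'] /=; lia.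
Qed.

Lemma sers_prefix l k : nr (take k (sers l)) <= nl (take k (sers l)) /\
  nr (sers l) = nl (sers l).
Proof.
have [h1 h2] := serialize_prefix (Lst l) k.+1; move: h2.
rewrite serialize_Lst /= -cats1 !count_cat /= => h2.
split; last by lia.
elim: l k {h1 h2} => // d l IH k; rewrite /sers /= -/(sers l) take_cat.
case: ltnP => _; first by have [] := serialize_prefix d k.
by rewrite !count_cat; have [_ ->] := serialize_prefix d 0; rewrite leq_add2l.
Qed.

Lemma serialize_gt0 d : 0 < size (serialize d).
Proof. by case: d => [n|l]; rewrite /= ?size_rcons. Qed.

(* Hence the end of a term can be found by counting parentheses. *)
Lemma serialize_ends d k : 0 < k <= size (serialize d) ->
  (~~ is_bit (onth (serialize d) k.-1) &&
    (nl (take k (serialize d)) == nr (take k (serialize d)))) = (k == size (serialize d)).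
Proof.
case: d => [n|l].
  set b := [seq Bit x | x <- nat_bits n]; rewrite /= -/b size_rcons => /andP[k0].
  rewrite leq_eqVlt => /predU1P[->|lk].
    rewrite eqxx /= -cats1 take_oversize ?size_cat ?addn1 // !count_cat nl_bits nr_bits.
    by rewrite onth_cat ltnn subnn.
  have lb : k.-1 < size b by lia.
  rewrite (ltn_eqF lk) -cats1 onth_cat lb; rewrite size_map in lb.
  by rewrite onthE (nth_map (Bit true)) ?size_map // (nth_map true).
rewrite serialize_Lst; case: k => // k /=; rewrite size_rcons ltnS => lk.
move: lk; rewrite leq_eqVlt => /predU1P[->|lk].
  rewrite eqxx -cats1 take_oversize ?size_cat ?addn1 // !count_cat /=.
  by rewrite onth_cat ltnn subnn /=; have [_ ->] := sers_prefix l 0; apply/eqP; lia.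
rewrite eqSS (ltn_eqF lk) -cats1 takel_cat //; have [h _] := sers_prefix l k.
by apply/negbTE; rewrite negb_and; apply/orP; right; lia.
Qed.

Definition At (w : word) (a : nat) (s : word) : Prop :=
  exists pre post, w = pre ++ s ++ post /\ size pre = a.

Lemma At_sym w a s i : At w a s -> i < size s -> sym w (a + i) = onth s i.
Proof.
case=> pre [post [-> <-]] li.
by rewrite /sym onth_cat ltnNge leq_addr /= addKn onth_cat li.
Qed.

Lemma At_le w a s : At w a s -> a + size s <= size w.
Proof. by case=> pre [post [-> <-]]; rewrite !size_cat; lia. Qed.

Lemma At_cat w a s1 s2 : At w a (s1 ++ s2) -> At w a s1 /\ At w (a + size s1) s2.
Proof.
case=> pre [post [-> <-]]; split; first by exists pre, (s2 ++ post); rewrite !catA.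
by exists (pre ++ s1), post; rewrite size_cat !catA.
Qed.

Lemma iotaSr a k : iota a k.+1 = iota a k ++ [:: a + k].
Proof. by rewrite -addn1 iotaD. Qed.

Lemma cnt_At q w a s k : At w a s -> k <= size s ->
  cnt q w a (a + k) = count (q \o Some) (take k s).
Proof.
move=> hA; rewrite /cnt iotaD count_cat add0n.
rewrite (_ : count _ (iota 0 a) = 0) ?add0n; last first.
  rewrite (eq_in_count (a2 := pred0)) ?count_pred0 // => i; rewrite mem_iota add0n => /andP[_ li].
  by rewrite leqNgt li.
elim: k => [|k IH] lk; first by rewrite take0.
rewrite iotaSr count_cat IH 1?ltnW // (take_nth LPar lk) -cats1 count_cat /=.
by rewrite leq_addr (At_sym hA lk) onthE (nth_map LPar).
Qed.

Lemma size_sers_take l i : i < size l ->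
  size (sers (take i.+1 l)) = size (sers (take i l)) + size (serialize (nth (Num 0) l i)).
Proof.
by move=> li; rewrite (take_nth (Num 0) li) /sers map_rcons flatten_rcons size_cat.
Qed.

Lemma sers_take_le l i : size (sers (take i l)) <= size (sers l).
Proof. by rewrite -{2}(cat_take_drop i l) /sers map_cat flatten_cat size_cat leq_addr. Qed.

(** The terms before the [i]-th are balanced, so counting parentheses from the start of the sequence
    amounts to counting from the start of that term. *)
Lemma endb_step w a l i k : At w a (sers l) -> i < size l ->
  0 < k <= size (serialize (nth (Num 0) l i)) ->
  endb w a (a + size (sers (take i l)) + k) = (k == size (serialize (nth (Num 0) l i))).
Proof.
move=> hA li hk; set d := nth _ l i in hk *.
have el : sers l = sers (take i l) ++ serialize d ++ sers (drop i.+1 l).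
  rewrite -{1}(cat_take_drop i l) (drop_nth (Num 0) li) /sers map_cat flatten_cat /=.
  by [].
have [hA1 hA2] : At w a (sers (take i l) ++ serialize d) /\ At w (a + size (sers (take i l))) (serialize d).
  rewrite el catA in hA; have [h1 _] := At_cat hA; split=> //.
  by have [_ h2] := At_cat h1.
rewrite -(serialize_ends hk) /endb; case/andP: hk => k0 lk.
have -> : a < a + size (sers (take i l)) + k by lia.
have -> : (a + size (sers (take i l)) + k).-1 = a + size (sers (take i l)) + k.-1 by lia.
rewrite (At_sym hA2); last by lia.
rewrite -addnA !(cnt_At _ hA1) ?size_cat ?leq_add2l //.
have tk : take (size (sers (take i l)) + k) (sers (take i l) ++ serialize d) =
    sers (take i l) ++ take k (serialize d).
  by rewrite take_cat ltnNge leq_addr /= addKn.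
rewrite tk !count_cat; have [_ ->] := sers_prefix (take i l) 0.
by rewrite eqn_add2l.
Qed.

Lemma count_endb w a l i : At w a (sers l) -> i <= size l ->
  count (endb w a) (iota 0 (a + size (sers (take i l))).+1) = i.
Proof.
move=> hA; elim: i => [|i IH] li.
  rewrite take0 addn0 (eq_in_count (a2 := pred0)) ?count_pred0 // => q.
  by rewrite mem_iota add0n ltnS => /andP[_ lq]; rewrite /endb ltnNge lq.
rewrite (size_sers_take li).
have -> (x y : nat) : (a + (x + y)).+1 = (a + x).+1 + y by lia.
rewrite iotaD count_cat IH 1?ltnW // add0n.
have h0 := serialize_gt0 (nth (Num 0) l i); case es : (size _) h0 => [//|m] _.
rewrite iotaSr count_cat /= addn0 (eq_in_count (a2 := pred0)) ?count_pred0; last first.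
  move=> q; rewrite mem_iota => /andP[q1 q2].
  have -> : q = a + size (sers (take i l)) + (q - (a + size (sers (take i l)))) by lia.
  by rewrite (endb_step hA li) ?es /=; lia.
have -> : (a + size (sers (take i l))).+1 + m = a + size (sers (take i l)) + m.+1 by lia.
by rewrite (endb_step hA li) ?es ?eqxx ?leqnn //; lia.
Qed.

Lemma endb_sers w a l i : At w a (sers l) -> 0 < i <= size l ->
  endb w a (a + size (sers (take i l))).
Proof.
case: i => // i hA /= li; rewrite (size_sers_take li) addnA (endb_step hA li) ?eqxx //.
by rewrite serialize_gt0 leqnn.
Qed.

Lemma count_leq m n : m <= n -> count (fun q => q <= m) (iota 0 n.+1) = m.+1.
Proof.
move=> le; have -> : n.+1 = m.+1 + (n - m) by lia.
rewrite iotaD count_cat -[RHS](size_iota 0) -[RHS]addn0; congr (_ + _).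
  by rewrite (eq_in_count (a2 := predT)) ?count_predT // => q; rewrite mem_iota add0n ltnS.
rewrite (eq_in_count (a2 := pred0)) ?count_pred0 // => q.
by rewrite mem_iota add0n => /andP[lq _]; rewrite leqNgt lq.
Qed.

Lemma leq_count_iota (p : pred nat) m n : m <= n -> count p (iota 0 m) <= count p (iota 0 n).
Proof. by move=> le; rewrite -(subnKC le) iotaD count_cat leq_addr. Qed.

Lemma nthposP w a l i : At w a (sers l) -> i <= size l ->
  nthpos w a i = a + size (sers (take i l)).
Proof.
move=> hA li; rewrite /nthpos (eq_count (a2 := fun q => q <= a + size (sers (take i l)))).
  by rewrite count_leq //; apply: leq_trans (At_le hA); rewrite leq_add2l sers_take_le.
move=> q; have ce := count_endb hA li.
case: (ltnP (a + size (sers (take i l))) q) => lq.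
  have -> : (q <= a) = false by lia.
  by apply/negbTE; rewrite -leqNgt -{1}ce; exact: leq_count_iota.
case: (leqP q a) => //= la; case: i li ce lq => [|i] li ce lq.
  by rewrite take0 /= in lq; lia.
move: ce; rewrite iotaSr count_cat /= addn0 add0n endb_sers // => ce.
by have := leq_count_iota (endb w a) lq; lia.
Qed.

Lemma At_nth w a l i : At w a (sers l) -> i < size l ->
  At w (nthpos w a i) (serialize (nth (Num 0) l i)).
Proof.
move=> hA li; rewrite (nthposP hA (ltnW li)); move: hA.
rewrite -{1}(cat_take_drop i l) (drop_nth (Num 0) li) /sers map_cat flatten_cat /=.
by move=> /At_cat[_ /At_cat[]].
Qed.

Definition AtD (w : word) (a : nat) (d : data) : Prop := At w a (serialize d).

Lemma AtD_Lst w a l : AtD w a (Lst l) -> At w a.+1 (sers l).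
Proof.
rewrite /AtD serialize_Lst -cats1 -cat1s => /At_cat[_]; rewrite addn1.
by case/At_cat.
Qed.

Lemma endposP w a d : AtD w a d -> endpos w a = a + size (serialize d).
Proof.
move=> h; rewrite /endpos (@nthposP w a [:: d]) //= /sers /= ?cats0 //.
Qed.

Lemma AtD_lt w a d : AtD w a d -> a < size w.
Proof. by move=> /At_le; have := serialize_gt0 d; lia. Qed.

Lemma childP w a l i : AtD w a (Lst l) -> i < size l ->
  AtD w (child w a i) (nth (Num 0) l i).
Proof.
move=> h li; rewrite /child (minn_idPl _); last by apply: ltnW; have := AtD_lt h; lia.
exact: At_nth (AtD_Lst h) li.
Qed.

Lemma childE w a l i : AtD w a (Lst l) -> i <= size l ->
  child w a i = a.+1 + size (sers (take i l)).
Proof.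
move=> h li; rewrite /child (minn_idPl _); last by apply: ltnW; have := AtD_lt h; lia.
exact: nthposP (AtD_Lst h) li.
Qed.

Lemma arityP w a l : AtD w a (Lst l) -> arity w a = size l.
Proof.
move=> h; rewrite /arity (minn_idPl _); last by apply: ltnW; have := AtD_lt h; lia.
have es : size (serialize (Lst l)) = (size (sers l)).+2 by rewrite serialize_Lst /= size_rcons.
rewrite (endposP h) es.
rewrite -[RHS](count_endb (AtD_Lst h) (leqnn _)) take_size.
have le := At_le h; rewrite es in le.
have -> : (size w).+1 = (a.+1 + size (sers l)).+1 + (size w - (a.+1 + size (sers l))) by lia.
rewrite iotaD count_cat -[RHS]addn0; congr (_ + _).
  apply: eq_in_count => q; rewrite mem_iota add0n => /andP[_ lq].
  have -> : q < a + (size (sers l)).+2 by lia.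
  by rewrite andbT.
rewrite (eq_in_count (a2 := pred0)) ?count_pred0 // => q.
rewrite mem_iota => /andP[lq _]; apply/negbTE; rewrite negb_and; apply/orP; right; lia.
Qed.

Lemma at_plusP w a d k : AtD w a d -> k < size (serialize d) ->
  at_plus w a k = onth (serialize d) k.
Proof.
move=> h lk; rewrite /at_plus (minn_idPl _); first exact: At_sym.
by have := At_le h; lia.
Qed.

Lemma eqdP w a b d d' : AtD w a d -> AtD w b d' -> eqd w a b = (serialize d == serialize d').
Proof.
move=> ha hb; rewrite /eqd !(endposP ha) !(endposP hb) !addKn.
apply/andP/eqP => [[/eqP es /allP h]|e].
  apply: eq_from_onth => k; have [lk|lk] := ltnP k (size (serialize d)).
    have := h k; rewrite mem_iota /= add0n => /(_ lk)/eqP.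
    by rewrite (at_plusP ha) // (at_plusP hb) -?es.
  by rewrite !onth_default -?es.
rewrite e eqxx; split=> //; apply/allP => k; rewrite mem_iota add0n => /andP[_ lk].
by rewrite (at_plusP ha) ?e // (at_plusP hb).
Qed.

Lemma flatten_nth (T : Type) (x0 : T) s : flatten [seq [:: nth x0 s k] | k <- iota 0 (size s)] = s.
Proof. by rewrite -[RHS](mkseq_nth x0) /mkseq; elim: (iota _ _) => //= k t ->. Qed.

Lemma copyP w a d : AtD w a d -> copy w a = serialize d.
Proof.
move=> h; rewrite /copy (endposP h) addKn -[RHS](flatten_nth LPar); congr flatten.
apply/eq_in_map => k; rewrite mem_iota add0n => /andP[_ lk].
by rewrite (at_plusP h) // onthE (nth_map LPar).
Qed.

Definition bits (n : nat) : word := [seq Bit b | b <- nat_bits n].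

Lemma size_Num n : size (serialize (Num n)) = (size (bits n)).+1.
Proof. by rewrite /= size_rcons. Qed.

Lemma at_bit w a n k : AtD w a (Num n) -> k < size (nat_bits n) ->
  at_plus w a k = Some (Bit (nth true (nat_bits n) k)).
Proof.
move=> h lk; rewrite (at_plusP h) ?size_Num ?size_map; last by lia.
by rewrite /= onthE map_rcons nth_rcons !size_map lk (nth_map LPar) ?size_map // (nth_map true).
Qed.

Lemma at_sep w a n : AtD w a (Num n) -> at_plus w a (size (nat_bits n)) = Some Sep.
Proof.
move=> h; rewrite (at_plusP h) ?size_Num ?size_map //.
by rewrite /= onthE map_rcons nth_rcons !size_map ltnn eqxx.
Qed.

Lemma copy_bitsP w a n : AtD w a (Num n) -> copy_bits w a = bits n.
Proof.
move=> h; rewrite /copy_bits (endposP h) addKn size_Num size_map iotaSr map_cat flatten_cat /=.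
rewrite add0n (at_sep h) /= cats0 -[RHS](flatten_nth LPar) size_map; congr flatten.
apply/eq_in_map => k; rewrite mem_iota add0n => /andP[_ lk].
by rewrite (at_bit h lk) /= (nth_map true).
Qed.

Definition bitval (s : seq bool) : nat := foldr (fun (b : bool) v => b + v.*2) 0 s.

Lemma bitval_pos p : bitval (pos_bits p) = nat_of_pos p.
Proof. by elim: p => //= p ->; rewrite ?add1n ?add0n NatTrec.doubleE. Qed.

Lemma nat_bitsK n : bitval (nat_bits n) = n.
Proof.
by rewrite /nat_bits -{2}(bin_of_natK n); case: (bin_of_nat n) => //= p; exact: bitval_pos.
Qed.

Lemma nat_bits_pos p : nat_bits (nat_of_pos p) = pos_bits p.
Proof. by rewrite /nat_bits (nat_of_binK (BinNums.Npos p)). Qed.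

Lemma valueP w a n : AtD w a (Num n) -> n <= (size w).+1 -> value w a = n.
Proof.
move=> h le; rewrite /value (endposP h) addKn size_Num size_map iotaSr foldr_cat /=.
rewrite add0n {2}/val_step at_sep //=.
suff aux t u : nat_bits n = t ++ u -> bitval u <= (size w).+1 ->
    foldr (val_step w a) 0 (iota (size t) (size u)) = bitval u.
  by rewrite (aux [::] (nat_bits n)) ?nat_bitsK.
elim: u t => //= b u IH t e lv.
have := IH (rcons t b); rewrite cat_rcons size_rcons => -> //; last by lia.
have lt : size t < size (nat_bits n) by rewrite e size_cat /=; lia.
rewrite /val_step (at_bit h lt) e nth_cat ltnn subnn /=.
have m1 : minn (bitval u + bitval u) (size w).+1 = bitval u + bitval u by lia.
by rewrite m1; case: b lv {e IH} => /= lv; lia.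
Qed.

Lemma bits_expn i : bits (2 ^ i) = nseq i (Bit false) ++ [:: Bit true].
Proof.
have -> : 2 ^ i = nat_of_pos (iter i BinNums.xO BinNums.xH).
  by elim: i => //= i <-; rewrite NatTrec.doubleE expnS mul2n.
rewrite /bits nat_bits_pos; elim: i => //= i IH.
by rewrite IH.
Qed.

(** The counter net on [m] places has [2 m + 1] transitions; with the least significant bit first,
    this numeral is that of [m] behind an additional one. *)
Lemma bits_double1 m : bits m.*2.+1 = Bit true :: bits m.
Proof.
rewrite /bits -{2}(bin_of_natK m) -{1}(bin_of_natK m); case: (bin_of_nat m) => [|p] //=.
have -> : (nat_of_pos p).*2.+1 = nat_of_pos (BinNums.xI p) by rewrite /= NatTrec.doubleE.
by rewrite !nat_bits_pos.
Qed.

(** * Computability of the access functions *)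

Lemma Comp_add G (wd : G -> word) rs a b : Comp wd rs a -> Comp wd rs b ->
  Comp wd rs (fun g => minn (a g + b g) (size (wd g)).+1).
Proof.
move=> ha hb.
have hv : Comp (fun x => wd x.1.1) (lift2 rs) (fun x : G * nat * nat => x.2).
  have := @Comp_var _ (fun x => wd x.1.1) (lift2 rs) (size rs).+1.
  rewrite /lift2 !size_lift1 ltnSn => /(_ isT); apply: Comp_ext => x.
  by rewrite nth_lift1_last ?size_lift1.
apply: (Comp_bounded ha) (Comp_fold hb ha
  (F := fun g _ acc => minn acc.+1 (size (wd g)).+1) (Comp_succ hv)) => g lb.
elim: (b g) 0 => [|k IH] i /=; first by rewrite addn0 (minn_idPl lb).
by rewrite IH; lia.
Qed.

Lemma Comp_length G (wd : G -> word) rs : Comp wd rs (fun g => size (wd g)).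
Proof. exact: Comp_pred (@Comp_size G wd rs). Qed.

(** A test looks at one register and compares with constants, so equality of two scanned symbols is
    a finite disjunction over the alphabet. *)
Lemma Comp_symeq G (wd : G -> word) rs a b : Comp wd rs a -> Comp wd rs b ->
  Comp wd rs (fun g => sym (wd g) (a g) == sym (wd g) (b g)).
Proof.
move=> ha hb; pose h o := Comp_and (Comp_sym (pred1 o) ha) (Comp_sym (pred1 o) hb).
pose os : seq (option symb) := [:: None; Some LPar; Some RPar; Some Sep; Some (Bit true); Some (Bit false)].
have : Comp wd rs (fun g => has (fun o => (sym (wd g) (a g) == o) && (sym (wd g) (b g) == o)) os).
  by rewrite /os /=; do ?[apply: Comp_or; first exact: h]; exact: Comp_false.
apply: Comp_ext => g; congr nat_of_bool; apply/hasP/eqP => [[o _ /andP[/eqP-> /eqP->]] //|e].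
exists (sym (wd g) (a g)); last by rewrite e eqxx.
by case: (sym _ _) => [[||[]|]|]; rewrite /os !inE !eqxx ?orbT.
Qed.

Lemma Emits_sym G (wd : G -> word) rs a : Comp wd rs a ->
  Emits wd rs (fun g => emit_sym (sym (wd g) (a g))).
Proof.
move=> ha; pose os : seq symb := [:: LPar; RPar; Sep; Bit true; Bit false].
have : Emits wd rs (fun g => flatten
    [seq (if sym (wd g) (a g) == Some s then [:: s] else [::]) | s <- os]).
  rewrite /os /=; do ?[apply: Emits_cat; first (apply: Emits_if;
    [exact: Comp_sym (pred1 (Some _)) ha|exact: Emits_const|exact: Emits_const])].
  exact: Emits_const.
apply: Emits_ext => g; case: (sym _ _) => [[||[]|]|]; rewrite /os /=;
  do ?[case: eqP => ?]; by [|congruence].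
Qed.

Definition Fun0 (F : word -> nat) : Prop := Comp (fun w : word => w) [::] F.
Definition Out0 (p : word -> word) : Prop := Emits (fun w : word => w) [::] p.

Lemma Comp_app0 G (wd : G -> word) rs F : Fun0 F -> Comp wd rs (fun g => F (wd g)).
Proof. exact: (@Comp_sub_context _ _ _ wd _ _ [::]). Qed.

Lemma Emits_app0 G (wd : G -> word) rs p : Out0 p -> Emits wd rs (fun g => p (wd g)).
Proof. exact: (@Emits_sub_context _ _ _ wd _ _ [::]). Qed.

Ltac comp_var_at k :=
  lazymatch goal with |- @Comp ?G ?wd ?rs ?f => exact (@Comp_var G wd rs k isT) end.
Ltac comp_var :=
  first [comp_var_at 0 | comp_var_at 1 | comp_var_at 2 | comp_var_at 3 | comp_var_at 4
       | comp_var_at 5].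

Create HintDb funs discriminated.
#[export] Hint Constants Opaque : funs.

Ltac comp_app := match goal with
  | |- Comp _ _ (fun g => nat_of_bool (?F _ (_ : nat) (_ : nat))) =>
      apply: (@Comp_app2 _ _ _ _ _ _ _ (fun w a b => nat_of_bool (F w a b))); last by auto with funs nocore
  | |- Comp _ _ (fun g => nat_of_bool (?F _ (_ : nat))) =>
      apply: (@Comp_app1 _ _ _ _ _ (fun w a => nat_of_bool (F w a))); last by auto with funs nocore
  | |- Comp _ _ (fun g => ?F _ (_ : nat) (_ : nat)) =>
      apply: (@Comp_app2 _ _ _ _ _ _ _ F); last by auto with funs nocore
  | |- Comp _ _ (fun g => ?F _ (_ : nat)) =>
      apply: (@Comp_app1 _ _ _ _ _ F); last by auto with funs nocore
  | |- Comp _ _ (fun g => ?F _) =>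
      apply: (@Comp_app0 _ _ _ F); by auto with funs nocore
  | |- Comp _ _ ?F => apply: (@Comp_app0 _ _ _ F); by auto with funs nocore
  end.

Ltac emits_app := match goal with
  | |- Emits _ _ (fun g => ?p _ (_ : nat) (_ : nat)) =>
      apply: (@Emits_app2 _ _ _ _ _ _ _ p); last by auto with funs nocore
  | |- Emits _ _ (fun g => ?p _ (_ : nat)) =>
      apply: (@Emits_app1 _ _ _ _ _ p); last by auto with funs nocore
  | |- Emits _ _ (fun g => ?p _) =>
      apply: (@Emits_app0 _ _ _ p); by auto with funs nocore
  | |- Emits _ _ ?p => apply: (@Emits_app0 _ _ _ p); by auto with funs nocore
  end.

(** Closure lemmas are chosen by the head of the term, hints providing the functions proved
    computable before. An unfolded definition thus serves as its own program. *)
Ltac comp1 := cbv beta; lazymatch goal with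
  | |- Comp _ _ (fun g => nat_of_bool (_ && _)) => apply: Comp_and
  | |- Comp _ _ (fun g => nat_of_bool (_ || _)) => apply: Comp_or
  | |- Comp _ _ (fun g => nat_of_bool (~~ _)) => apply: Comp_not
  | |- Comp _ _ (fun g => nat_of_bool (has _ _)) => apply: Comp_has
  | |- Comp _ _ (fun g => nat_of_bool (all _ _)) => apply: Comp_all
  | |- Comp _ _ (fun g => nat_of_bool (leq (S _) _)) => apply: Comp_ltn
  | |- Comp _ _ (fun g => nat_of_bool (leq _ _)) => apply: Comp_leq
  | |- Comp _ _ (fun g => nat_of_bool (sym _ _ == sym _ _)) => apply: Comp_symeq
  | |- Comp _ _ (fun g => nat_of_bool (_ == _)) => apply: Comp_eq
  | |- Comp _ _ (fun g => nat_of_bool (is_l _)) => apply: Comp_sym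
  | |- Comp _ _ (fun g => nat_of_bool (is_r _)) => apply: Comp_sym
  | |- Comp _ _ (fun g => nat_of_bool (is_bit _)) => apply: Comp_sym
  | |- Comp _ _ (fun g => nat_of_bool (is_one _)) => apply: Comp_sym
  | |- Comp _ _ (fun g => if _ then _ else _) => apply: Comp_if
  | |- Comp _ _ (fun g => count _ _) => apply: Comp_count
  | |- Comp _ _ (fun g => foldr _ _ _) => apply: Comp_fold
  | |- Comp _ _ (fun g => subn _ _) => apply: Comp_sub
  | |- Comp _ _ (fun g => minn (S _) _) => apply: Comp_succ
  | |- Comp _ _ (fun g => minn (addn _ _) _) => apply: Comp_add
  | |- Comp _ _ (fun g => predn _) => apply: Comp_pred
  | |- Comp _ _ (fun g => S (size _)) => exact: Comp_size
  | |- Comp _ _ (fun g => size _) => exact: Comp_length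
  | |- Comp _ _ (fun g => 0) => exact: Comp0
  | |- Comp _ _ (fun g => S 0) => exact: Comp_true
  | |- Comp _ _ _ => first [comp_var | comp_app]
  | |- Emits _ _ (fun _ => ?s) => exact: Emits_const
  | |- Emits _ _ (fun g => emit_sym _) => apply: Emits_sym
  | |- Emits _ _ (fun g => _ ++ _) => apply: Emits_cat
  | |- Emits _ _ (fun g => if _ then _ else _) => apply: Emits_if
  | |- Emits _ _ (fun g => flatten _) => apply: Emits_for
  | |- Emits _ _ _ => emits_app
  end.
Ltac comp := repeat comp1.

Lemma Fun2_cnt_l : Fun2 (cnt is_l). Proof. rewrite /Fun2 /cnt; comp. Qed.
Lemma Fun2_cnt_r : Fun2 (cnt is_r). Proof. rewrite /Fun2 /cnt; comp. Qed.
#[export] Hint Resolve Fun2_cnt_l Fun2_cnt_r : funs.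

Lemma Fun2_endb : Fun2 endb. Proof. rewrite /Fun2 /endb; comp. Qed.
#[export] Hint Resolve Fun2_endb : funs.
Lemma Fun2_nthpos : Fun2 nthpos. Proof. rewrite /Fun2 /nthpos; comp. Qed.
#[export] Hint Resolve Fun2_nthpos : funs.
Lemma Fun1_endpos : Fun1 endpos. Proof. rewrite /Fun1 /endpos; comp. Qed.
#[export] Hint Resolve Fun1_endpos : funs.
Lemma Fun2_child : Fun2 child. Proof. rewrite /Fun2 /child; comp. Qed.
#[export] Hint Resolve Fun2_child : funs.
Lemma Fun1_arity : Fun1 arity. Proof. rewrite /Fun1 /arity; comp. Qed.
#[export] Hint Resolve Fun1_arity : funs.
Lemma Fun2_eqd : Fun2 eqd. Proof. rewrite /Fun2 /eqd /at_plus; comp. Qed.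
#[export] Hint Resolve Fun2_eqd : funs.
Lemma Fun1_value : Fun1 value. Proof. rewrite /Fun1 /value /val_step /at_plus; comp. Qed.
#[export] Hint Resolve Fun1_value : funs.

Lemma Out1_copy : Out1 copy. Proof. rewrite /Out1 /copy /at_plus; comp. Qed.
#[export] Hint Resolve Out1_copy : funs.
Lemma Out1_copy_bits : Out1 copy_bits. Proof. rewrite /Out1 /copy_bits /at_plus; comp. Qed.
#[export] Hint Resolve Out1_copy_bits : funs.

(** * The printer *)

(* [kid k] is [child] for a constant index: numerals are not registers. *)
Definition kid (k : nat) (w : word) (a : nat) : nat :=
  iter k (endpos w) (minn a.+1 (size w).+1).

Lemma Fun1_kid k : Fun1 (kid k).
Proof. rewrite /Fun1 /kid; elim: k => [|k IH] /=; comp; exact: IH. Qed.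
#[export] Hint Resolve Fun1_kid : funs.

(* Below, [b] is the position of a net in the encoding of the r-nu-PN: 3 for
   [r_net], 4 for [r_net']. *)
Definition net_pos (w : word) : nat := kid 0 w 0.
Definition in_pos b (w : word) (i p : nat) : nat :=
  child w (child w (kid 0 w (kid b w (net_pos w))) p) i.
Definition out_pos b (w : word) (i p : nat) : nat :=
  child w (child w (kid 1 w (kid b w (net_pos w))) i) p.
Definition n_place (w : word) : nat := arity w (kid 0 w (kid 3 w (net_pos w))).
Definition n_trans b (w : word) : nat := arity w (kid 1 w (kid b w (net_pos w))).

Definition in_cell (w : word) (c j : nat) : bool :=
  has (fun e => child w c e == j) (iota 0 (arity w c)).

(* [j] is the position of an entry (variable, multiplicity) of the transition [i]. *)
Definition is_occ b (w : word) (i j : nat) : bool :=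
  has (fun p => in_cell w (in_pos b w i p) j || in_cell w (out_pos b w i p) j)
    (iota 0 (n_place w)).
Definition first_occ b (w : word) (i j : nat) : bool :=
  is_occ b w i j &&
  all (fun j' => ~~ (is_occ b w i j' && eqd w (kid 0 w j') (kid 0 w j))) (iota 0 j).
(** The flag of a variable is the numeral 1 or 0, and 0 has no digits, so its first symbol
    decides. *)
Definition fresh_at (w : word) (j : nat) : bool := is_bit (sym w (kid 0 w (kid 0 w j))).

Lemma Fun0_net_pos : Fun0 net_pos. Proof. rewrite /Fun0 /net_pos; comp. Qed.
#[export] Hint Resolve Fun0_net_pos : funs.
Lemma Fun2_in_pos b : Fun2 (in_pos b). Proof. rewrite /Fun2 /in_pos; comp. Qed.
#[export] Hint Resolve Fun2_in_pos : funs.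
Lemma Fun2_out_pos b : Fun2 (out_pos b). Proof. rewrite /Fun2 /out_pos; comp. Qed.
#[export] Hint Resolve Fun2_out_pos : funs.
Lemma Fun0_n_place : Fun0 n_place. Proof. rewrite /Fun0 /n_place; comp. Qed.
#[export] Hint Resolve Fun0_n_place : funs.
Lemma Fun0_n_trans b : Fun0 (n_trans b). Proof. rewrite /Fun0 /n_trans; comp. Qed.
#[export] Hint Resolve Fun0_n_trans : funs.
Lemma Fun2_in_cell : Fun2 in_cell. Proof. rewrite /Fun2 /in_cell; comp. Qed.
#[export] Hint Resolve Fun2_in_cell : funs.
Lemma Fun2_is_occ b : Fun2 (is_occ b). Proof. rewrite /Fun2 /is_occ; comp. Qed.
#[export] Hint Resolve Fun2_is_occ : funs.
Lemma Fun2_first_occ b : Fun2 (first_occ b). Proof. rewrite /Fun2 /first_occ; comp. Qed.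
#[export] Hint Resolve Fun2_first_occ : funs.
Lemma Fun1_fresh_at : Fun1 fresh_at. Proof. rewrite /Fun1 /fresh_at; comp. Qed.
#[export] Hint Resolve Fun1_fresh_at : funs.

Definition bit1 : word := [:: Bit true; Sep].
Definition sep : word := [:: Sep].
Definition par (u : word) : word := [:: LPar] ++ u ++ [:: RPar].

Definition cell_str (w : word) (c j : nat) : word :=
  flatten [seq (if eqd w (kid 0 w (child w c e)) (kid 0 w j)
                then copy_bits w (kid 1 w (child w c e)) else [::]) | e <- iota 0 (arity w c)]
  ++ sep.
Definition in_str b (w : word) (i j : nat) : word :=
  flatten [seq cell_str w (in_pos b w i p) j | p <- iota 0 (n_place w)].
Definition out_str b (w : word) (i j : nat) : word :=
  flatten [seq cell_str w (out_pos b w i p) j | p <- iota 0 (n_place w)].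
Definition zero_str (w : word) : word := flatten [seq sep | p <- iota 0 (n_place w)].
Definition unit_str (w : word) (q : nat) : word :=
  flatten [seq (if p == q then bit1 else sep) | p <- iota 0 (n_place w)].

Definition pow_str (w : word) (i : nat) : word :=
  flatten [seq [:: Bit false] | _ <- iota 0 i] ++ bit1.
Definition st_str c (w : word) (i j : nat) : word :=
  serialize (Num c) ++ serialize (Num (6 - c)) ++ pow_str w i ++ pow_str w (size w - i) ++
  pow_str w j ++ pow_str w (size w - j).

(** The three inner lists follow the enumeration of [option bool]: the empty net, the net of the
    tuples and that of the control token. Each leading [sep] is the multiplicity 0 of the isolated
    transition. *)
Definition ev_str (ks x y s s' : word) : word :=
  par (ks ++ par (par [::] ++ par (sep ++ x ++ y) ++ par (sep ++ s ++ s'))).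

Lemma Emits_par G (wd : G -> word) rs u : Emits wd rs u -> Emits wd rs (fun g => par (u g)).
Proof. by move=> hu; rewrite /par; apply: Emits_cat; [exact: Emits_const|comp]. Qed.

Lemma Emits_ev G (wd : G -> word) rs ks x y s s' :
  Emits wd rs ks -> Emits wd rs x -> Emits wd rs y -> Emits wd rs s -> Emits wd rs s' ->
  Emits wd rs (fun g => ev_str (ks g) (x g) (y g) (s g) (s' g)).
Proof.
move=> h1 h2 h3 h4 h5; apply: Emits_par; apply: Emits_cat => //; apply: Emits_par.
apply: Emits_cat; first exact: Emits_const.
by apply: Emits_cat; apply: Emits_par; do ?apply: Emits_cat => //; exact: Emits_const.
Qed.

Ltac emits := repeat (cbv beta; lazymatch goal with
  | |- Emits _ _ (fun g => par _) => apply: Emits_par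
  | |- Emits _ _ (fun g => ev_str _ _ _ _ _) => apply: Emits_ev
  | |- _ => comp1
  end).

Lemma Out2_cell_str : Out2 cell_str. Proof. rewrite /Out2 /cell_str; comp. Qed.
#[export] Hint Resolve Out2_cell_str : funs.
Lemma Out2_in_str b : Out2 (in_str b). Proof. rewrite /Out2 /in_str; comp. Qed.
#[export] Hint Resolve Out2_in_str : funs.
Lemma Out2_out_str b : Out2 (out_str b). Proof. rewrite /Out2 /out_str; comp. Qed.
#[export] Hint Resolve Out2_out_str : funs.
Lemma Out0_zero_str : Out0 zero_str. Proof. rewrite /Out0 /zero_str; comp. Qed.
#[export] Hint Resolve Out0_zero_str : funs.
Lemma Out1_unit_str : Out1 unit_str. Proof. rewrite /Out1 /unit_str; comp. Qed.
#[export] Hint Resolve Out1_unit_str : funs.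
Lemma Out1_pow_str : Out1 pow_str. Proof. rewrite /Out1 /pow_str; comp. Qed.
#[export] Hint Resolve Out1_pow_str : funs.
Lemma Out2_st_str c : Out2 (st_str c). Proof. rewrite /Out2 /st_str; comp. Qed.
#[export] Hint Resolve Out2_st_str : funs.

Definition d_cnet (m : nat) : data :=
  let zeros := [seq Num 0 | _ <- iota 0 m] in
  let unit q := [seq Num (p == q) | p <- iota 0 m] in
  Lst [:: Num m; Num m.*2.+1;
    Lst [seq Lst (Num 0 :: unit q ++ zeros) | q <- iota 0 m];
    Lst (Lst zeros :: [seq Lst zeros | _ <- iota 0 m] ++ [seq Lst (unit q) | q <- iota 0 m])].

Definition d_sysnet : data :=
  Lst [:: Num #|place sysnet|; Num #|trans sysnet|;
    Lst [seq Lst [seq Num (arc_in p t) | t <- enum (trans sysnet)] | p <- enum (place sysnet)];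
    Lst [seq Lst [seq Num (arc_out t p) | p <- enum (place sysnet)] | t <- enum (trans sysnet)]].

Definition d_typing : data := Lst [seq Num (rk (styping p)) | p <- enum (place sysnet)].
Definition d_idle : data := Lst [seq Num (rk (sidle p)) | p <- enum (place sysnet)].
Definition d_kind (a b : option slot) : data := Num (rk (inr (a, b) : trans sysnet)).
Definition d_ctl : data := Num (rk (None : place sysnet)).
Definition d_sim : data := Num (rk (Some s_sim : place sysnet)).

Definition kstr (a b : option slot) : word := serialize (d_kind a b).

Definition ret_str (w : word) : word :=
  ev_str (kstr (Some s_sel) (Some s_sim)) (zero_str w) (zero_str w)
    (st_str 0 w 0 0) (st_str 0 w 0 0).
Definition start1_str (w : word) (i : nat) : word :=
  ev_str (kstr None None) (zero_str w) (zero_str w) (st_str 0 w 0 0) (st_str 1 w i 0).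
Definition walk1_str (w : word) (i j : nat) : word :=
  ev_str (if first_occ 3 w i j then
            if fresh_at w j then kstr None (Some s_sel) else kstr (Some s_sim) (Some s_sel)
          else kstr None None)
    (if first_occ 3 w i j then in_str 3 w i j else zero_str w)
    (if first_occ 3 w i j then out_str 3 w i j else zero_str w)
    (st_str 1 w i j) (st_str 1 w i (minn j.+1 (size w).+1)).
Definition end1_str (w : word) (i : nat) : word :=
  ev_str (kstr None None) (zero_str w) (zero_str w) (st_str 1 w i (size w)) (st_str 0 w 0 0).
Definition start2_str (w : word) (i : nat) : word :=
  ev_str (kstr None (Some s_new)) (zero_str w) (zero_str w) (st_str 0 w 0 0) (st_str 2 w i 0).
(** There is no test for freshness, as all variables of a transfer transition are standard. *)
Definition walk2_str (w : word) (i j : nat) : word :=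
  ev_str (if first_occ 4 w i j then
            if eqd w (kid 0 w j) (child w (kid 7 w (net_pos w)) i)
            then kstr (Some s_sim) (Some s_src)
            else if eqd w (kid 0 w j) (child w (kid 8 w (net_pos w)) i)
            then kstr (Some s_sim) (Some s_dst)
            else kstr (Some s_sim) (Some s_sel)
          else kstr None None)
    (if first_occ 4 w i j then in_str 4 w i j else zero_str w)
    (if first_occ 4 w i j then out_str 4 w i j else zero_str w)
    (st_str 2 w i j) (st_str 2 w i (minn j.+1 (size w).+1)).
Definition end2_str (w : word) (i : nat) : word :=
  ev_str (kstr None None) (zero_str w) (zero_str w) (st_str 2 w i (size w)) (st_str 3 w i 0).
Definition take_str (w : word) (i q : nat) : word :=
  ev_str (kstr (Some s_src) (Some s_src)) (unit_str w q) (zero_str w)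
    (st_str 3 w i 0) (st_str 4 w i q).
(** Only the numbers of the two transfer places are ever evaluated; they are smaller than the number
    of places, hence within the range of a register. *)
Definition source (w : word) (i : nat) : nat :=
  value w (kid 0 w (child w (kid 5 w (net_pos w)) i)).
Definition sink (w : word) (i : nat) : nat :=
  value w (kid 1 w (child w (kid 5 w (net_pos w)) i)).
Definition back_str (w : word) (i q : nat) : word :=
  ev_str (if q == source w i then kstr (Some s_dst) (Some s_dst)
          else kstr (Some s_new) (Some s_new))
    (zero_str w) (if q == source w i then unit_str w (sink w i) else unit_str w q)
    (st_str 4 w i q) (st_str 3 w i 0).
Definition trash_str (w : word) (i : nat) : word :=
  ev_str (kstr (Some s_src) (Some s_trash)) (zero_str w) (zero_str w)
    (st_str 3 w i 0) (st_str 5 w 0 0).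
Definition new_str (w : word) : word :=
  ev_str (kstr (Some s_new) (Some s_sel)) (zero_str w) (zero_str w)
    (st_str 5 w 0 0) (st_str 6 w 0 0).
Definition dst_str (w : word) : word :=
  ev_str (kstr (Some s_dst) (Some s_sel)) (zero_str w) (zero_str w)
    (st_str 6 w 0 0) (st_str 0 w 0 0).

Definition events_str (w : word) : word :=
  ret_str w ++
  flatten [seq start1_str w i | i <- iota 0 (n_trans 3 w)] ++
  flatten [seq flatten [seq walk1_str w i j | j <- iota 0 (size w)] | i <- iota 0 (n_trans 3 w)] ++
  flatten [seq end1_str w i | i <- iota 0 (n_trans 3 w)] ++
  flatten [seq start2_str w i | i <- iota 0 (n_trans 4 w)] ++
  flatten [seq flatten [seq walk2_str w i j | j <- iota 0 (size w)] | i <- iota 0 (n_trans 4 w)] ++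
  flatten [seq end2_str w i | i <- iota 0 (n_trans 4 w)] ++
  flatten [seq flatten [seq take_str w i q | q <- iota 0 (n_place w)] | i <- iota 0 (n_trans 4 w)] ++
  flatten [seq flatten [seq back_str w i q | q <- iota 0 (n_place w)] | i <- iota 0 (n_trans 4 w)] ++
  flatten [seq trash_str w i | i <- iota 0 (n_trans 4 w)] ++
  new_str w ++ dst_str w.

Definition cnet_str (w : word) : word :=
  par (copy w (kid 0 w (net_pos w)) ++
    ([:: Bit true] ++ copy w (kid 0 w (net_pos w))) ++
    par (flatten [seq par (sep ++ unit_str w q ++ zero_str w) | q <- iota 0 (n_place w)]) ++
    par (par (zero_str w) ++ flatten [seq par (zero_str w) | q <- iota 0 (n_place w)] ++
      flatten [seq par (unit_str w q) | q <- iota 0 (n_place w)])).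

Definition entry_str (w : word) (a : nat) : word :=
  par (par (serialize d_sim ++ copy w (kid 0 w a)) ++ copy w (kid 1 w a)).
Definition marking_str k (w : word) : word :=
  par (par (par (serialize d_ctl ++ par (st_str 0 w 0 0)) ++ serialize (Num 1)) ++
    flatten [seq entry_str w (child w (kid k w 0) e) | e <- iota 0 (arity w (kid k w 0))]).

Definition out (w : word) : word :=
  par (par (serialize d_sysnet ++ par (cnet_str w ++ serialize (d_cnet 6)) ++
    serialize d_typing ++ serialize d_idle ++ par (events_str w)) ++
    marking_str 1 w ++ marking_str 2 w).

Lemma Out0_ret : Out0 ret_str. Proof. rewrite /Out0 /ret_str; emits. Qed.
#[export] Hint Resolve Out0_ret : funs.
Lemma Out1_start1 : Out1 start1_str. Proof. rewrite /Out1 /start1_str; emits. Qed.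
#[export] Hint Resolve Out1_start1 : funs.
Lemma Out2_walk1 : Out2 walk1_str. Proof. rewrite /Out2 /walk1_str; emits. Qed.
#[export] Hint Resolve Out2_walk1 : funs.
Lemma Out1_end1 : Out1 end1_str. Proof. rewrite /Out1 /end1_str; emits. Qed.
#[export] Hint Resolve Out1_end1 : funs.
Lemma Out1_start2 : Out1 start2_str. Proof. rewrite /Out1 /start2_str; emits. Qed.
#[export] Hint Resolve Out1_start2 : funs.
Lemma Out2_walk2 : Out2 walk2_str. Proof. rewrite /Out2 /walk2_str; emits. Qed.
#[export] Hint Resolve Out2_walk2 : funs.
Lemma Out1_end2 : Out1 end2_str. Proof. rewrite /Out1 /end2_str; emits. Qed.
#[export] Hint Resolve Out1_end2 : funs.
Lemma Out2_take : Out2 take_str. Proof. rewrite /Out2 /take_str; emits. Qed.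
#[export] Hint Resolve Out2_take : funs.
Lemma Fun1_source : Fun1 source. Proof. rewrite /Fun1 /source; comp. Qed.
#[export] Hint Resolve Fun1_source : funs.
Lemma Fun1_sink : Fun1 sink. Proof. rewrite /Fun1 /sink; comp. Qed.
#[export] Hint Resolve Fun1_sink : funs.
Lemma Out2_back : Out2 back_str. Proof. rewrite /Out2 /back_str; emits. Qed.
#[export] Hint Resolve Out2_back : funs.
Lemma Out1_trash : Out1 trash_str. Proof. rewrite /Out1 /trash_str; emits. Qed.
#[export] Hint Resolve Out1_trash : funs.
Lemma Out0_new : Out0 new_str. Proof. rewrite /Out0 /new_str; emits. Qed.
#[export] Hint Resolve Out0_new : funs.
Lemma Out0_dst : Out0 dst_str. Proof. rewrite /Out0 /dst_str; emits. Qed.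
#[export] Hint Resolve Out0_dst : funs.
Lemma Out0_events : Out0 events_str. Proof. rewrite /Out0 /events_str; emits. Qed.
#[export] Hint Resolve Out0_events : funs.
Lemma Out0_cnet : Out0 cnet_str. Proof. rewrite /Out0 /cnet_str; emits. Qed.
#[export] Hint Resolve Out0_cnet : funs.
Lemma Out1_entry : Out1 entry_str. Proof. rewrite /Out1 /entry_str; emits. Qed.
#[export] Hint Resolve Out1_entry : funs.
Lemma Out0_marking k : Out0 (marking_str k). Proof. rewrite /Out0 /marking_str; emits. Qed.
#[export] Hint Resolve Out0_marking : funs.
Lemma Out0_out : Out0 out. Proof. rewrite /Out0 /out; emits. Qed.

(** * The printer outputs an encoding of the object system *)

Lemma rk_nth (T : finType) x0 i : i < #|T| -> rk (nth x0 (enum T) i) = i.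
Proof.
move=> li; have lt : i < size (enum T) by rewrite -cardE.
apply/eqP; rewrite -(nth_uniq x0 _ lt (enum_uniq T)); last by rewrite -cardE rk_lt.
by rewrite /rk nth_enum_rank.
Qed.

Lemma map_rk (T : finType) : [seq rk t | t <- enum T] = iota 0 #|T|.
Proof.
have [x0 _|T0] := pickP T; last first.
  by rewrite (eq_card0 T0) (size0nil (s := enum T)) // -cardE (eq_card0 T0).
apply: (@eq_from_nth _ 0); rewrite size_map -cardE ?size_iota // => i li.
by rewrite (nth_map x0) -?cardE // rk_nth // nth_iota.
Qed.

Lemma map_iota_rk (T : finType) (A : Type) (f : nat -> A) :
  [seq f i | i <- iota 0 #|T|] = [seq f (rk t) | t <- enum T].
Proof. by rewrite -map_rk -map_comp. Qed.

Lemma enum_optionE (T : finType) : enum {: option T} = None :: [seq Some t | t <- enum T].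
Proof. by rewrite !enumT [in LHS]unlock. Qed.

Lemma enum_sumE (A B : finType) : enum {: A + B} = [seq inl a | a <- enum A] ++ [seq inr b | b <- enum B].
Proof. by rewrite !enumT [in LHS]unlock. Qed.

Lemma enum_boolE : enum {: bool} = [:: true; false].
Proof. by rewrite enumT unlock. Qed.

Lemma enum_voidE : enum {: void} = [::].
Proof. by rewrite enumT unlock. Qed.

Lemma kidP w a l i : AtD w a (Lst l) -> i < size l -> AtD w (kid i w a) (nth (Num 0) l i).
Proof.
move=> h li; suff -> : kid i w a = child w a i by exact: childP.
rewrite (childE h (ltnW li)); elim: i li => [|i IH] li.
  by rewrite take0 addn0 /kid /= (minn_idPl _) //; apply: ltnW; have := AtD_lt h; lia.
have e := IH (ltnW li); rewrite /kid /= -/(kid i w a) (endposP (d := nth (Num 0) l i)).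
  by rewrite e size_sers_take ?addnA // ltnW.
by rewrite e -(childE h (ltnW (ltnW li))); apply: childP; rewrite // ltnW.
Qed.
(** Encodings are relations only on account of sets and multisets; this and the next lemma turn the
    functional ones into equations. *)
Lemma c_seqP A (cA : coding A) (gA : A -> data) s d :
  (forall x d, cA x d <-> d = gA x) -> c_seq cA s d <-> d = Lst [seq gA a | a <- s].
Proof.
move=> h; split=> [[l hl ->]|->].
  by congr Lst; elim: hl => //= x y s' l' /h -> _ ->.
exists [seq gA a | a <- s] => //; elim: s => //= x s IH.
by constructor=> //; apply/h.
Qed.

Lemma c_funP (T : finType) (B : T -> Type) (cB : forall x, coding (B x))
    (gB : forall x, B x -> data) (f : forall x, B x) d :
  (forall x y d, cB x y d <-> d = gB x y) -> c_fun cB f d <-> d = Lst [seq gB x (f x) | x <- enum T].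
Proof.
move=> h; split=> [[g hg ->]|->]; last by exists (fun x => gB x (f x)) => // x; apply/h.
by congr Lst; apply: eq_map => x; apply/h.
Qed.

Lemma c_fun_nth (T : finType) (B : T -> Type) (cB : forall x, coding (B x)) (f : forall x, B x) d :
  c_fun cB f d -> exists l, [/\ d = Lst l, size l = #|T| &
    forall x, cB x (f x) (nth (Num 0) l (rk x))].
Proof.
case=> g hg ->; exists [seq g x | x <- enum T]; rewrite size_map -cardE; split=> // x.
rewrite (nth_map x) -?cardE ?rk_lt // [nth x _ _]nth_enum_rank; exact: hg.
Qed.

Lemma c_msetP (A : choiceType) (cA : coding A) (gA : A -> data) (M : {mset A}) d :
  (forall x d, cA x d <-> d = gA x) -> c_mset cA M d <->
  exists2 s, perm_eq s (finsupp M) & d = Lst [seq Lst [:: gA a; Num (M a)] | a <- s].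
Proof.
move=> h; have h' (x : A * nat) e : c_pair cA c_nat x e <-> e = Lst [:: gA x.1; Num x.2].
  split=> [[dA [dB [/h -> -> ->]]]//|->]; exists (gA x.1), (Num x.2); split=> //.
  by apply/h.
by split=> -[s hs] => [/(c_seqP _ _ h') ->|->]; exists s => //;
  [rewrite -map_comp|apply/(c_seqP _ _ h'); rewrite -map_comp].
Qed.

Definition dvar (v : var) : data :=
  Lst [:: Num (is_fresh v); Num match v with inl n | inr n => n end].

Lemma serialize_Num_inj m n : serialize (Num m) = serialize (Num n) -> m = n.
Proof.
move=> e; have h k : AtD (serialize (Num k)) 0 (Num k).
  by exists [::], [::]; rewrite cats0.
have := copy_bitsP (h m); rewrite e (copy_bitsP (h n)) => /inj_map eb.
by rewrite -(nat_bitsK m) -(nat_bitsK n) eb // => b b' [].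
Qed.

Lemma serialize_dvar_inj u v : serialize (dvar u) = serialize (dvar v) -> u = v.
Proof.
have h x : AtD (serialize (dvar x)) 0 (dvar x) by exists [::], [::]; rewrite cats0.
move=> e; have hu := h u; have hv := h v; rewrite -e in hv.
have k0 := copyP (kidP hu (isT : 0 < 2)); rewrite (copyP (kidP hv (isT : 0 < 2))) in k0.
have k1 := copyP (kidP hu (isT : 1 < 2)); rewrite (copyP (kidP hv (isT : 1 < 2))) in k1.
by have := serialize_Num_inj k0; have := serialize_Num_inj k1; case: (u) (v) => [?|?] [?|?] //= ->.
Qed.

Lemma size_le_sers l : size l <= size (sers l).
Proof.
elim: l => //= d l IH; rewrite /sers /= size_cat -/(sers l); have := serialize_gt0 d; lia.
Qed.

(** The numbers of places and transitions are written in binary, but the flow tables list every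
    place and every transition, and each entry takes at least one symbol. Hence both numbers are at
    most the length of the input. *)
Lemma AtD_size w a l : AtD w a (Lst l) -> size l <= size w.
Proof. by move=> /AtD_Lst /At_le; have := size_le_sers l; lia. Qed.

Definition dvec (Q : finType) (v : vec Q) : data := Lst [seq Num (v q) | q <- enum Q].

Lemma c_vecP (Q : finType) (v : vec Q) d : c_vec v d <-> d = dvec v.
Proof. exact: (c_funP (gB := fun _ => Num)). Qed.

Definition mset_at (A : choiceType) (gA : A -> data) (w : word) (a : nat) (M : {mset A}) : Prop :=
  exists2 s, perm_eq s (finsupp M) & AtD w a (Lst [seq Lst [:: gA x; Num (M x)] | x <- s]).

Record net_at (w : word) (P T : finType) (b : nat) (Nt : nuPN P T) : Prop := NetAt {
  net_at_trans : n_trans b w = #|T|;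
  net_at_le : #|T| <= size w;
  net_at_in : forall p t, mset_at dvar w (in_pos b w (rk t) (rk p)) (nu_in Nt p t);
  net_at_out : forall p t, mset_at dvar w (out_pos b w (rk t) (rk p)) (nu_out Nt t p)
}.

(** The interface between reading and printing: after [input_specP] the concrete layout of the input
    is not inspected again. *)
Record input_spec (N : rnuPN) (init target : config (r_place N)) (w : word) : Prop := InputSpec {
  is_place : n_place w = #|r_place N|;
  is_place_le : #|r_place N| <= size w;
  is_place_at : AtD w (kid 0 w (net_pos w)) (Num #|r_place N|);
  is_net : net_at w 3 (r_net N);
  is_net' : net_at w 4 (r_net' N);
  is_rx1 : forall t, AtD w (child w (kid 7 w (net_pos w)) (rk t)) (dvar (@rx1 N t));
  is_rx2 : forall t, AtD w (child w (kid 8 w (net_pos w)) (rk t)) (dvar (@rx2 N t));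
  is_source : forall t : r_trans' N, source w (rk t) = rk (r_transfer t).1;
  is_sink : forall t : r_trans' N, sink w (rk t) = rk (r_transfer t).2;
  is_init : mset_at (@dvec _) w (kid 1 w 0) init;
  is_target : mset_at (@dvec _) w (kid 2 w 0) target
}.

Lemma net_atP w (P T : finType) b (Nt : nuPN P T) dn :
  c_nuPN Nt dn -> AtD w (kid b w (net_pos w)) dn ->
  net_at w b Nt /\
  arity w (kid 0 w (kid b w (net_pos w))) = #|P| /\ #|P| <= size w.
Proof.
case=> d1 [d2 [/c_fun_nth[l1 [-> s1 h1]] /c_fun_nth[l2 [-> s2 h2]] ->]] h.
have k0 := kidP h (isT : 0 < 2); have k1 := kidP h (isT : 1 < 2); rewrite /= in k0 k1.
have cell (F : {mset var}) a e : c_mset c_var F e -> AtD w a e -> mset_at dvar w a F.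
  by move=> /(c_msetP (gA := dvar) _ _ (fun _ _ => iff_refl _)) [s hs ->]; exists s.
split; last by rewrite (arityP k0) s1; split=> //; rewrite -s1; exact: AtD_size k0.
split.
- by rewrite /n_trans (arityP k1).
- by rewrite -s2; exact: AtD_size k1.
- move=> p t; have lp := rk_lt p; rewrite -s1 in lp.
  have [l [el sl hl]] := c_fun_nth (h1 p); have := childP k0 lp; rewrite el => kp.
  have lt := rk_lt t; rewrite -sl in lt.
  by apply: cell (hl t) _; rewrite /in_pos; exact: childP kp lt.
move=> p t; have lt := rk_lt t; rewrite -s2 in lt.
have [l [el sl hl]] := c_fun_nth (h2 t); have := childP k1 lt; rewrite el => kt.
have lp := rk_lt p; rewrite -sl in lp.
by apply: cell (hl p) _; rewrite /out_pos; exact: childP kt lp.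
Qed.

Lemma input_specP (N : rnuPN) (init target : config (r_place N)) d :
  c_rnuPN_instance (RnuPNInstance init target) d -> input_spec init target (serialize d).
Proof.
set w := serialize d => -[dN [d0 [d1 [/= hN h0 h1 ed]]]].
have hd : AtD w 0 (Lst [:: dN; d0; d1]) by exists [::], [::]; rewrite cats0 /w ed.
have [k0 k1 k2] := And3 (kidP hd (isT : 0 < 3)) (kidP hd (isT : 1 < 3)) (kidP hd (isT : 2 < 3)).
rewrite /= -/(net_pos w) in k0 k1 k2.
case: hN => c1 [c2 [c3 [c4 [c5 [c6 [[n1 n2] h3 _ [h5 h6] eN]]]]]].
rewrite eN in k0; have K i (li : i < 9) := kidP k0 li.
have [net [ep lp]] := net_atP n1 (K 3 isT); have [net' _] := net_atP n2 (K 4 isT).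
have rx (f : r_trans' N -> var) k e : c_fun (fun => c_var) f e -> AtD w (kid k w (net_pos w)) e ->
    forall t, AtD w (child w (kid k w (net_pos w)) (rk t)) (dvar (f t)).
  move=> /c_fun_nth[l [-> sl hl]] hk t; have lt := rk_lt t; rewrite -sl in lt.
  by have := childP hk lt; rewrite (hl t).
have [l [el sl hl]] := c_fun_nth h3; have hk := K 5 isT; rewrite /= el in hk.
have tr (t : r_trans' N) : AtD w (child w (kid 5 w (net_pos w)) (rk t))
    (Lst [:: Num (rk (r_transfer t).1); Num (rk (r_transfer t).2)]).
  have := rk_lt t; rewrite -[X in _ < X]sl => lt; have := childP hk lt.
  by have [dA [dB [-> -> ->]]] := hl t.
have msp X a e : c_mset (@c_vec _) X e -> AtD w a e -> mset_at (@dvec _) w a X.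
  by move=> /(c_msetP (gA := @dvec _) _ _ (@c_vecP _)) [s hs ->]; exists s.
split; [exact: ep|exact: lp|exact: (K 0 isT)|exact: net|exact: net'|exact: rx h5 (K 7 isT)|
  exact: rx h6 (K 8 isT)| | |exact: msp h0 k1|exact: msp h1 k2].
- move=> t; rewrite /source (valueP (kidP (tr t) (isT : 0 < 2))) //.
  by have := rk_lt (r_transfer t).1; lia.
- move=> t; rewrite /sink (valueP (kidP (tr t) (isT : 1 < 2))) //.
  by have := rk_lt (r_transfer t).2; lia.
Qed.

(** * Variables found through their first occurrences in the input *)

Section Occurrences.
Variables (w : word) (P T : finType) (b : nat) (Nt : nuPN P T).
Hypothesis net : net_at w b Nt.
Hypothesis places : n_place w = #|P|.

Definition entry (v : var) (k : nat) : data := Lst [:: dvar v; Num k].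

Lemma entry_var j v k : AtD w j (entry v k) -> AtD w (kid 0 w j) (dvar v).
Proof. by move=> h; exact: (kidP h (isT : 0 < 2)). Qed.

Lemma in_cellP c F j : mset_at dvar w c F ->
  in_cell w c j -> exists2 v, v \in finsupp F & AtD w j (entry v (F v)).
Proof.
case=> s hs h; rewrite /in_cell (arityP h) size_map => /hasP[e]; rewrite mem_iota add0n => /andP[_ le] /eqP ej.
have le' : e < size [seq Lst [:: dvar v; Num (F v)] | v <- s] by rewrite size_map.
have := childP h le'; rewrite ej (nth_map (inl 0)) // => he; exists (nth (inl 0) s e) => //.
by rewrite -(perm_mem hs) mem_nth.
Qed.

Lemma in_cell_mem c F v : mset_at dvar w c F -> v \in finsupp F ->
  exists2 j, in_cell w c j & AtD w j (entry v (F v)).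
Proof.
case=> s hs h; rewrite -(perm_mem hs) => hv; have li : index v s < size s by rewrite index_mem.
have le' : index v s < size [seq Lst [:: dvar v; Num (F v)] | v <- s] by rewrite size_map.
exists (child w c (index v s)).
  rewrite /in_cell (arityP h) size_map; apply/hasP; exists (index v s) => //.
  by rewrite mem_iota.
by have := childP h le'; rewrite (nth_map v) // nth_index.
Qed.

Lemma mem_nu_vars t v : v \in nu_vars Nt t <->
  exists p, (v \in finsupp (nu_in Nt p t)) || (v \in finsupp (nu_out Nt t p)).
Proof.
rewrite /nu_vars inE; split.
  case/orP => /bigfcupP[p _ hp]; exists p; rewrite hp ?orbT //.
by case=> p /orP[h|h]; apply/orP; [left|right]; apply/bigfcupP; exists p; rewrite ?mem_enum.
Qed.

Lemma has_place (q : pred nat) : has q (iota 0 (n_place w)) <-> exists p : P, q (rk p).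
Proof.
rewrite places -map_rk has_map; split=> [/hasP[p _ hp]|[p hp]]; first by exists p.
by apply/hasP; exists p; rewrite ?mem_enum.
Qed.

Lemma is_occ_var t j : is_occ b w (rk t) j -> exists2 v, v \in nu_vars Nt t & exists k, AtD w j (entry v k).
Proof.
move=> /has_place[p] /orP[] hj.
  have [v hv h] := in_cellP (net_at_in net p t) hj.
  by exists v; [apply/mem_nu_vars; exists p; rewrite hv|exists (nu_in Nt p t v)].
have [v hv h] := in_cellP (net_at_out net p t) hj.
by exists v; [apply/mem_nu_vars; exists p; rewrite hv orbT|exists (nu_out Nt t p v)].
Qed.

Lemma is_occ_mem t v : v \in nu_vars Nt t -> exists2 j, is_occ b w (rk t) j &
  exists k, AtD w j (entry v k).
Proof.
case/mem_nu_vars => p /orP[] hv.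
  have [j hj h] := in_cell_mem (net_at_in net p t) hv.
  by exists j; [apply/has_place; exists p; rewrite hj|exists (nu_in Nt p t v)].
have [j hj h] := in_cell_mem (net_at_out net p t) hv.
by exists j; [apply/has_place; exists p; rewrite hj orbT|exists (nu_out Nt t p v)].
Qed.

Definition occ (t : T) (j : nat) : option var :=
  if first_occ b w (rk t) j then
    ohead [seq v <- nu_vars Nt t | copy w (kid 0 w j) == serialize (dvar v)]
  else None.

Lemma occP t j : first_occ b w (rk t) j ->
  exists v, [/\ occ t j = Some v, v \in nu_vars Nt t & AtD w (kid 0 w j) (dvar v)].
Proof.
move=> hj; have /is_occ_var[v hv [k hk]] : is_occ b w (rk t) j by case/andP: hj.
have ha := entry_var hk; exists v; split=> //; rewrite /occ hj (copyP ha).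
have : v \in [seq u <- nu_vars Nt t | serialize (dvar v) == serialize (dvar u)].
  by rewrite mem_filter eqxx.
case es : [seq u <- _ | _] => [//|u s] _ /=.
have : u \in [seq u <- nu_vars Nt t | serialize (dvar v) == serialize (dvar u)].
  by rewrite es inE eqxx.
by rewrite mem_filter => /andP[/eqP/serialize_dvar_inj -> _].
Qed.

Lemma occ_some t j v : occ t j = Some v ->
  [/\ first_occ b w (rk t) j, v \in nu_vars Nt t & AtD w (kid 0 w j) (dvar v)].
Proof.
case hj : (first_occ b w (rk t) j); last by rewrite /occ hj.
by have [u [-> hu ha]] := occP hj => -[<-].
Qed.

(** No variable is listed twice, since a later position with the same variable is not a first
    occurrence; none is missed, since the least position of a variable is one. *)
Lemma occ_lists t : lists_vars Nt t (seen occ t (size w)).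
Proof.
split=> [|v].
  elim: (size w) => // j IH; rewrite seenS cat_uniq IH /=.
  case ej : (occ t j) => [v|] //=; rewrite orbF andbT mem_pmap.
  apply/negP => /mapP[j' hj' ej']; have lj : j' < j by move: hj'; rewrite mem_iota.
  have [/andP[o' _] _ a'] := occ_some (esym ej').
  have [/andP[_ /allP/(_ j')]] := occ_some ej.
  by rewrite mem_iota lj o' => /(_ isT) /= h _ a; rewrite (eqdP a' a) eqxx in h.
rewrite mem_pmap; apply/mapP/idP => [[j _ /esym/occ_some[]//]|/is_occ_mem[j hj [k hk]]].
pose q i := is_occ b w (rk t) i && (copy w (kid 0 w i) == serialize (dvar v)).
have ex : exists i, q i by exists j; rewrite /q hj (copyP (entry_var hk)) eqxx.
case: (ex_minnP ex) => i /andP[oi ci] mi.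
have [u hu [k' hk']] := is_occ_var oi; have ai := entry_var hk'.
have eu : u = v by apply: serialize_dvar_inj; rewrite -(copyP ai); exact: eqP.
have fi : first_occ b w (rk t) i.
  rewrite /first_occ oi; apply/allP => i'; rewrite mem_iota add0n => /andP[_ li].
  apply/negP => /andP[oi' ei']; have [u' hu' [k'' hk'']] := is_occ_var oi'.
  have := mi i'; rewrite /q oi' (copyP (entry_var hk'')) -(eqP ci) (copyP ai).
  by rewrite -(eqdP (entry_var hk'') ai) ei' leqNgt li => /(_ isT).
exists i; first by rewrite mem_iota add0n; exact: AtD_lt hk'.
have [u' [-> hu' ha']] := occP fi; congr Some; rewrite -eu.
by apply: serialize_dvar_inj; rewrite -(copyP ai) (copyP ha').
Qed.

Lemma map_nth_iota_size (A B : Type) (x0 : A) (f : A -> B) (s : seq A) :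
  [seq f (nth x0 s e) | e <- iota 0 (size s)] = [seq f x | x <- s].
Proof. by rewrite -[in RHS](mkseq_nth x0 s) -map_comp. Qed.

Lemma flatten_pick (A : eqType) (B : Type) (f : A -> seq B) s v : uniq s ->
  flatten [seq (if u == v then f u else [::]) | u <- s] = if v \in s then f v else [::].
Proof.
elim: s => //= u s IH /andP[us /IH ->]; rewrite inE eq_sym; case: eqP => [->|] //=.
by rewrite (negbTE us) cats0.
Qed.

Lemma cell_strP c j F v : mset_at dvar w c F -> AtD w (kid 0 w j) (dvar v) ->
  cell_str w c j = serialize (Num (F v)).
Proof.
case=> s hs h hj; have us : uniq s by rewrite (perm_uniq hs) fset_uniq.
have -> : serialize (Num (F v)) = (if v \in s then bits (F v) else [::]) ++ sep.
  case: ifPn => hv; first by rewrite /= cats1.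
  by rewrite (perm_mem hs) memNfinsupp in hv; rewrite (eqP hv).
rewrite -(flatten_pick (fun u => bits (F u))) // /cell_str (arityP h) size_map.
rewrite -[in RHS](map_nth_iota_size v); congr (flatten _ ++ _).
apply/eq_in_map => e; rewrite mem_iota add0n => /andP[_ le].
have le' : e < size [seq Lst [:: dvar x; Num (F x)] | x <- s] by rewrite size_map.
have := childP h le'; rewrite (nth_map v) // => he.
rewrite (eqdP (kidP he (isT : 0 < 2)) hj) (copy_bitsP (kidP he (isT : 1 < 2))) /=.
by congr (if _ then _ else _); apply/eqP/eqP => [/serialize_dvar_inj|->].
Qed.

Definition vnums (Q : finType) (v : vec Q) : seq data := [seq Num (v q) | q <- enum Q].

Lemma in_strP t j v : AtD w (kid 0 w j) (dvar v) ->
  in_str b w (rk t) j = sers (vnums (nu_in_vec Nt v t)).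
Proof.
move=> hj; rewrite /in_str places map_iota_rk /sers /vnums -map_comp; congr flatten.
by apply: eq_map => p /=; rewrite (cell_strP (net_at_in net p t) hj) ffunE.
Qed.

Lemma out_strP t j v : AtD w (kid 0 w j) (dvar v) ->
  out_str b w (rk t) j = sers (vnums (nu_out_vec Nt v t)).
Proof.
move=> hj; rewrite /out_str places map_iota_rk /sers /vnums -map_comp; congr flatten.
by apply: eq_map => p /=; rewrite (cell_strP (net_at_out net p t) hj) ffunE.
Qed.

Lemma fresh_atP j v : AtD w (kid 0 w j) (dvar v) -> fresh_at w j = is_fresh v.
Proof.
move=> hj; have h := kidP hj (isT : 0 < 2); rewrite /fresh_at -[kid 0 w (kid 0 w j)]addn0.
by rewrite (At_sym h) ?serialize_gt0 //=; case: (is_fresh v).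
Qed.

Lemma zero_strE : zero_str w = sers (vnums (vec0 P)).
Proof.
rewrite /zero_str places map_iota_rk /sers /vnums -map_comp; congr flatten.
by apply: eq_map => p /=; rewrite ffunE.
Qed.

Lemma unit_strE q : unit_str w (rk q) = sers (vnums (unitv q : vec P)).
Proof.
rewrite /unit_str places map_iota_rk /sers /vnums -map_comp; congr flatten.
by apply: eq_map => p /=; rewrite ffunE (inj_eq (@rk_inj P)); case: eqP.
Qed.

End Occurrences.

Lemma pow_strE w i : pow_str w i = serialize (Num (2 ^ i)).
Proof.
rewrite /pow_str /= -/(bits _) bits_expn -cats1 -catA; congr (_ ++ _).
by rewrite -[in RHS](size_iota 0 i); elim: (iota 0 i) => //= k s ->.
Qed.

Lemma enum_slotE : [seq nat_of_ord q | q <- enum slot] = [:: 0; 1; 2; 3; 4; 5].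
Proof. exact: val_enum_ord. Qed.

Lemma st_strE c w i j : st_str c w i j = sers (vnums (st (size w) c i j)).
Proof.
rewrite /vnums (_ : [seq _ | q <- enum slot] =
  [seq Num (nth 0 [:: c; 6 - c; 2 ^ i; 2 ^ (size w - i); 2 ^ j; 2 ^ (size w - j)] k)
    | k <- [seq nat_of_ord q | q <- enum slot]]).
  by rewrite enum_slotE /st_str !pow_strE /sers /= cats0.
by rewrite -map_comp; apply: eq_map => q /=; rewrite ffunE.
Qed.

Lemma sers_cat s t : sers (s ++ t) = sers s ++ sers t.
Proof. by rewrite /sers map_cat flatten_cat. Qed.

Lemma par_sers l : par (sers l) = serialize (Lst l).
Proof. by rewrite serialize_Lst /par cats1. Qed.

Section Events.
Variable P : finType.

Definition d_event (k : data) (x y : vec P) (s s' : vec slot) : data :=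
  Lst [:: k; Lst [:: Lst [::]; Lst (Num 0 :: vnums x ++ vnums y);
    Lst (Num 0 :: vnums s ++ vnums s')]].

Definition d_ev (r : rule P) : data :=
  d_event (d_kind (r_kind r).1 (r_kind r).2) (r_take r) (r_give r) (r_from r) (r_to r).

Lemma ev_strE k x y s s' : ev_str (serialize k) (sers (vnums x)) (sers (vnums y))
  (sers (vnums s)) (sers (vnums s')) = serialize (d_event k x y s s').
Proof.
have sep0 l : sep ++ sers l = sers (Num 0 :: l) by [].
have e0 : par [::] = serialize (Lst [::]) by [].
rewrite /ev_str -!sers_cat !sep0 !par_sers e0.
have s1 d : serialize d = sers [:: d] by rewrite /sers /= cats0.
by rewrite ![in LHS]s1 -!sers_cat par_sers [in LHS]s1 -sers_cat par_sers.
Qed.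

Lemma map_enum_cnet (Q : finType) (A : Type) (f : trans (cnet Q) -> A) :
  [seq f t | t <- enum (trans (cnet Q))] =
  f None :: [seq f (Some (inl q)) | q <- enum Q] ++ [seq f (Some (inr q)) | q <- enum Q].
Proof.
rewrite enum_optionE enum_sumE /= !map_cat.
by congr (_ :: _ ++ _); elim: (enum Q) => //= q s ->.
Qed.

Lemma c_vecE (Q : finType) (a b : vec Q) d :
  @c_vec (trans (cnet Q)) (theta a b) d <-> d = Lst (Num 0 :: vnums a ++ vnums b).
Proof.
suff <- : dvec (theta a b : vec (trans (cnet Q))) = Lst (Num 0 :: vnums a ++ vnums b) by exact: c_vecP.
rewrite /dvec map_enum_cnet ffunE.
by congr (Lst (_ :: _ ++ _)); apply: eq_map => q /=; rewrite ffunE.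
Qed.

Lemma c_eventP (L : seq (rule P)) r d : @c_event (sim_eos L) (ev_of r) d <-> d = d_ev r.
Proof.
have hk (k : option bool) (v : {ffun trans (obj_family (nets P) k) -> nat}) e :
    c_vec v e <-> e = dvec v by exact: c_vecP.
have dvE (Q : finType) (a b : vec Q) :
    dvec (theta a b : vec (trans (cnet Q))) = Lst (Num 0 :: vnums a ++ vnums b).
  exact/c_vecE/c_vecP.
have e : Lst [:: Num (enum_rank (ev_of r).1);
    Lst [seq dvec ((ev_of r).2 k) | k <- enum {: option bool}]] = d_ev r.
  rewrite enum_optionE enum_boolE /= !ffunE /ev_theta !dvE.
  by rewrite /d_ev /d_kind /d_event /dvec enum_voidE; case: (r) => [[[x y] ?] ?].
split=> [[dth /(c_funP _ _ hk) -> ->]|->]; first exact: e.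
exists (Lst [seq dvec ((ev_of r).2 k) | k <- enum {: option bool}]); first exact/(c_funP _ _ hk).
by rewrite -e.
Qed.

End Events.
Lemma if_if (A : Type) (a a' b b' : bool) (x y z : A) : a = a' -> b = b' ->
  (if a then x else if b then y else z) = (if a' then x else if b' then y else z).
Proof. by move=> -> ->. Qed.

Lemma sers_map (A : Type) (f : A -> data) s : sers [seq f x | x <- s] = flatten [seq serialize (f x) | x <- s].
Proof. by rewrite /sers -map_comp. Qed.

Lemma sers_map2 (A B : Type) (f : B -> data) (g : A -> B) s :
  sers [seq f y | y <- [seq g x | x <- s]] = flatten [seq serialize (f (g x)) | x <- s].
Proof. by rewrite sers_map -map_comp. Qed.

Lemma sers_allpairs (A B : Type) (f : A -> B -> data) s t :
  sers [seq f x y | x <- s, y <- t] =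
  flatten [seq flatten [seq serialize (f x y) | y <- t] | x <- s].
Proof.
elim: s => //= x s IH; rewrite sers_cat IH; congr (_ ++ _); exact: sers_map.
Qed.

(** * The printed events are the codes of the rules *)

Section Output.
Variables (N : rnuPN) (init target : config (r_place N)) (w : word).
Hypothesis input : input_spec init target w.
Notation P := (r_place N).
Notation n := (size w).

Definition occ1 : r_trans N -> nat -> option var := @occ w P _ 3 (r_net N).
Definition occ2 : r_trans' N -> nat -> option var := @occ w P _ 4 (r_net' N).

Lemma zeroE : zero_str w = sers (vnums (vec0 P)).
Proof. exact: zero_strE (is_place input). Qed.

Lemma unitE q : unit_str w (rk q) = sers (vnums (unitv q : vec P)).
Proof. exact: unit_strE (is_place input) q. Qed.

Lemma rl_strE a b s s' (x y : vec P) c c' i j i' j' sx sy :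
  s = st n c i j -> s' = st n c' i' j' -> sx = sers (vnums x) -> sy = sers (vnums y) ->
  ev_str (kstr a b) sx sy (st_str c w i j) (st_str c' w i' j') = serialize (d_ev (rl a b s s' x y)).
Proof. by move=> -> -> -> ->; rewrite !st_strE ev_strE. Qed.

Lemma walk1_strE t j : j < n ->
  walk1_str w (rk t) j = serialize (d_ev (walk_rule n (r_net N) (@dst1 N) occ1 1 t j)).
Proof.
move=> lj; rewrite /walk1_str /walk_rule (minn_idPl _); last by rewrite ltnS ltnW.
case fo : (first_occ 3 w (rk t) j); last by rewrite /occ1 /occ fo; apply: rl_strE => //; exact: zeroE.
have [v [ev _ ha]] := occP (is_net input) (is_place input) fo.
rewrite /occ1 ev (in_strP (is_net input) (is_place input) _ ha).
rewrite (out_strP (is_net input) (is_place input) _ ha) (fresh_atP ha).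
by case: ifP => _; apply: rl_strE.
Qed.

Lemma walk2_strE t j : j < n ->
  walk2_str w (rk t) j = serialize (d_ev (walk_rule n (r_net' N) (@dst2 N) occ2 2 t j)).
Proof.
move=> lj; rewrite /walk2_str /walk_rule (minn_idPl _); last by rewrite ltnS ltnW.
case fo : (first_occ 4 w (rk t) j); last by rewrite /occ2 /occ fo; apply: rl_strE => //; exact: zeroE.
have [v [ev hv ha]] := occP (is_net' input) (is_place input) fo.
rewrite /occ2 ev (in_strP (is_net' input) (is_place input) _ ha).
rewrite (out_strP (is_net' input) (is_place input) _ ha).
have h1 := eqdP ha (is_rx1 input t); have h2 := eqdP ha (is_rx2 input t).
apply: etrans (congr1 (fun k => ev_str k _ _ _ _) (if_if _ _ _ h1 h2)) _.
rewrite (negbTE (rx_standard hv)) /dst2.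
have se u : (serialize (dvar v) == serialize (dvar u)) = (v == u).
  by apply/eqP/eqP => [/serialize_dvar_inj|->].
by rewrite !se; case: ifP => _; [|case: ifP => _]; apply: rl_strE.
Qed.

Lemma back_strE (t : r_trans' N) (p : P) : back_str w (rk t) (rk p) = serialize (d_ev (back_rule n t p)).
Proof.
rewrite /back_str /back_rule (is_source input) (is_sink input) (inj_eq (@rk_inj P)).
by case: ifP => _; apply: rl_strE => //; rewrite ?zeroE ?unitE.
Qed.

Lemma flatten_rk (T : finType) (f : nat -> word) (g : T -> word) k : k = #|T| ->
  (forall t, f (rk t) = g t) ->
  flatten [seq f i | i <- iota 0 k] = flatten [seq g t | t <- enum T].
Proof. by move=> -> h; rewrite map_iota_rk; congr flatten; apply: eq_map. Qed.

Lemma flatten_rk2 (T A : finType) (f : nat -> nat -> word) (g : T -> A -> data) k k' :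
  k = #|T| -> k' = #|A| -> (forall t p, f (rk t) (rk p) = serialize (g t p)) ->
  flatten [seq flatten [seq f i q | q <- iota 0 k'] | i <- iota 0 k] =
  sers [seq g t p | t <- enum T, p <- enum A].
Proof.
move=> e e' h; rewrite sers_allpairs; apply: flatten_rk => // t.
by apply: flatten_rk.
Qed.

Lemma flatten_walk (T : finType) (f : nat -> nat -> word) (g : T -> nat -> data) k :
  k = #|T| -> (forall t j, j < n -> f (rk t) j = serialize (g t j)) ->
  flatten [seq flatten [seq f i j | j <- iota 0 n] | i <- iota 0 k] =
  sers [seq g t j | t <- enum T, j <- iota 0 n].
Proof.
move=> e h; rewrite sers_allpairs; apply: flatten_rk => // t; congr flatten.
by apply/eq_in_map => j; rewrite mem_iota add0n => /andP[_ lj]; exact: h.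
Qed.

Lemma events_strE : events_str w = sers [seq d_ev r | r <- rules n occ1 occ2].
Proof.
have e1 := net_at_trans (is_net input); have e2 := net_at_trans (is_net' input).
rewrite /rules !map_cat !map_allpairs !sers_cat /events_str.
congr (_ ++ _).
  by rewrite /sers /= cats0; apply: rl_strE; rewrite // zeroE.
congr (_ ++ _).
  by rewrite sers_map2; apply: flatten_rk => // t; apply: rl_strE; rewrite // zeroE.
congr (_ ++ _); first exact: flatten_walk e1 walk1_strE.
congr (_ ++ _).
  by rewrite sers_map2; apply: flatten_rk => // t; apply: rl_strE; rewrite // zeroE.
congr (_ ++ _).
  by rewrite sers_map2; apply: flatten_rk => // t; apply: rl_strE; rewrite // zeroE.
congr (_ ++ _); first exact: flatten_walk e2 walk2_strE.
congr (_ ++ _).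
  by rewrite sers_map2; apply: flatten_rk => // t; apply: rl_strE; rewrite // zeroE.
congr (_ ++ _).
  apply: flatten_rk2 e2 (is_place input) _ => t p.
  by apply: rl_strE; rewrite // ?zeroE ?unitE.
congr (_ ++ _); first exact: flatten_rk2 e2 (is_place input) back_strE.
congr (_ ++ _).
  by rewrite sers_map2; apply: flatten_rk => // t; apply: rl_strE; rewrite // zeroE.
have s2 d d' : sers [:: d; d'] = serialize d ++ serialize d' by rewrite /sers /= cats0.
by rewrite -[RHS]/(sers [:: d_ev _; d_ev _]) s2; congr (_ ++ _); apply: rl_strE; rewrite // zeroE.
Qed.

End Output.

(** * The printed events are pairwise distinct *)

Section Distinct.
Variables (A B : eqType) (ph : A -> B).

(** Lists are glued along disjoint sets of labels, which reduces distinctness of the whole to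
    distinctness within each group. *)
Definition phased (ps : seq B) (s : seq A) : Prop := uniq s /\ {in s, forall x, ph x \in ps}.

Lemma phased1 p x : ph x = p -> phased [:: p] [:: x].
Proof. by move=> hx; split=> // y; rewrite mem_seq1 => /eqP ->; rewrite inE hx. Qed.

Lemma phased_cat p ps s1 s2 : phased [:: p] s1 -> phased ps s2 -> p \notin ps ->
  phased (p :: ps) (s1 ++ s2).
Proof.
move=> [u1 h1] [u2 h2] np; split.
  rewrite cat_uniq u1 u2 andbT /=; apply/hasPn => x x2; apply/negP => x1.
  by have := h1 x x1; rewrite inE => /eqP e; move: np; rewrite -e (h2 _ x2).
move=> x; rewrite mem_cat inE => /orP[/h1|/h2 ->]; last by rewrite orbT.
by rewrite inE => ->.
Qed.

Lemma phased_map (C : eqType) p (g : C -> A) s : uniq s -> injective g ->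
  (forall t, ph (g t) = p) -> phased [:: p] [seq g t | t <- s].
Proof.
move=> us ig hp; split; first by rewrite map_inj_uniq.
by move=> _ /mapP[t _ ->]; rewrite hp inE.
Qed.

Lemma phased_allpairs (C D : eqType) p (g : C -> D -> A) s t : uniq s -> uniq t ->
  {in t &, forall y y' x x', g x y = g x' y' -> x = x' /\ y = y'} ->
  (forall x y, ph (g x y) = p) -> phased [:: p] [seq g x y | x <- s, y <- t].
Proof.
move=> us ut ig hp; split; last by move=> _ /allpairsP[[x y] [_ _ ->]]; rewrite hp inE.
apply: allpairs_uniq => // -[x y] [x' y'] /allpairsP[[u v] /= [_ hy [-> ->]]].
by move=> /allpairsP[[u' v'] /= [_ hy' [-> ->]]] e; have [-> ->] := ig _ _ hy hy' _ _ e.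
Qed.

End Distinct.

Section EventsDistinct.
Variables (N : rnuPN) (n : nat).
Notation P := (r_place N).
Variables (occ1 : r_trans N -> nat -> option var) (occ2 : r_trans' N -> nat -> option var).
Hypothesis T_le : #|r_trans N| <= n.
Hypothesis T'_le : #|r_trans' N| <= n.
Hypothesis P_le : #|P| <= n.

(** Here [s_sim] is merely the index 0, at which a control state stores its phase. *)
Definition phase (r : rule P) : nat * nat := (r_from r s_sim, r_to r s_sim).

Lemma phase_st a b c i j c' i' j' (x y : vec P) :
  phase (rl a b (st n c i j) (st n c' i' j') x y) = (c, c').
Proof. by rewrite /phase /= !ffunE. Qed.

Lemma rk_le (T : finType) (t : T) : #|T| <= n -> rk t <= n.
Proof. by move=> le; rewrite ltnW // (leq_trans (rk_lt t)). Qed.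

Lemma from_inj c i j c' i' j' (r r' : rule P) : r = r' -> r_from r = st n c i j ->
  r_from r' = st n c' i' j' -> c' <= 6 -> i' <= n -> j' <= n -> i = i' /\ j = j'.
Proof. by move=> -> -> e h1 h2 h3; have [_ -> ->] := st_inj e h1 h2 h3. Qed.

Lemma to_inj c i j c' i' j' (r r' : rule P) : r = r' -> r_to r = st n c i j ->
  r_to r' = st n c' i' j' -> c' <= 6 -> i' <= n -> j' <= n -> i = i' /\ j = j'.
Proof. by move=> -> -> e h1 h2 h3; have [_ -> ->] := st_inj e h1 h2 h3. Qed.

Lemma walk_from (T : finType) (Nt : nuPN P T) dst occ c t j :
  r_from (walk_rule n Nt dst occ c t j) = st n c (rk t) j.
Proof. by rewrite /walk_rule; case: (occ t j). Qed.

Lemma phase_walk (T : finType) (Nt : nuPN P T) dst occ c t j :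
  phase (walk_rule n Nt dst occ c t j) = (c, c).
Proof. by rewrite /walk_rule; case: (occ t j) => [v|]; rewrite phase_st. Qed.

(** The twelve groups of rules differ in the pair of phases before and after the step; within a
    group, a control state identifies the rule. *)
Lemma uniq_rules : uniq (rules n occ1 occ2).
Proof.
(* The transition is recovered from the state before the step by [fm] and from the state after it by
   [tm], whichever carries its number. *)
have fm (T : finType) (g : T -> rule P) c j : #|T| <= n -> c <= 6 -> j <= n ->
    (forall t, r_from (g t) = st n c (rk t) j) -> injective g.
  move=> le lc lj e t t' /from_inj/(_ (e t) (e t') lc (rk_le t' le) lj) [h _].
  exact: rk_inj h.
have tm (T : finType) (g : T -> rule P) c : #|T| <= n -> c <= 6 ->
    (forall t, r_to (g t) = st n c (rk t) 0) -> injective g.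
  move=> le lc e t t' /to_inj/(_ (e t) (e t') lc (rk_le t' le) (leq0n _)) [h _].
  exact: rk_inj h.
have fw (T : finType) (Nt : nuPN P T) dst occ c : #|T| <= n -> c <= 6 ->
    phased phase [:: (c, c)] [seq walk_rule n Nt dst occ c t j | t <- enum T, j <- iota 0 n].
  move=> le lc; apply: phased_allpairs; rewrite ?enum_uniq ?iota_uniq //; last first.
    by move=> t j; exact: phase_walk.
  move=> j j' hj hj' t t' e; have lj : j' <= n by rewrite mem_iota in hj'; lia.
  have [h ->] := from_inj e (walk_from _ _ _ _ _ _) (walk_from _ _ _ _ _ _) lc (rk_le t' le) lj.
  by split=> //; exact: rk_inj h.
suff [] : phased phase [:: (0, 0); (0, 1); (1, 1); (1, 0); (0, 2); (2, 2); (2, 3); (3, 4); (4, 3);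
  (3, 5); (5, 6); (6, 0)] (rules n occ1 occ2) by [].
rewrite /rules /idle_st; apply: phased_cat => //.
  by apply: phased1; rewrite phase_st.
apply: phased_cat => //.
  by apply: phased_map; rewrite ?enum_uniq //; [exact: (tm _ _ 1)|move=> t; rewrite phase_st].
apply: phased_cat => //; first exact: fw.
apply: phased_cat => //.
  by apply: phased_map; rewrite ?enum_uniq //; [exact: (fm _ _ 1 n)|move=> t; rewrite phase_st].
apply: phased_cat => //.
  by apply: phased_map; rewrite ?enum_uniq //; [exact: (tm _ _ 2)|move=> t; rewrite phase_st].
apply: phased_cat => //; first exact: fw.
apply: phased_cat => //.
  by apply: phased_map; rewrite ?enum_uniq //; [exact: (fm _ _ 2 n)|move=> t; rewrite phase_st].
apply: phased_cat => //.
  apply: phased_allpairs; rewrite ?enum_uniq //; last by move=> t p; rewrite phase_st.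
  move=> p p' _ _ t t' /to_inj/(_ erefl erefl isT (rk_le t' T'_le) (rk_le p' P_le)) [h h'].
  by split; [exact: rk_inj h|exact: rk_inj h'].
have back_from (t : r_trans' N) (p : P) : r_from (back_rule n t p) = st n 4 (rk t) (rk p).
  by rewrite /back_rule; case: ifP.
apply: phased_cat => //.
  apply: phased_allpairs; rewrite ?enum_uniq //; last first.
    by move=> t p; rewrite /back_rule; case: ifP => _; rewrite phase_st.
  move=> p p' _ _ t t' /from_inj/(_ (back_from t p) (back_from t' p') isT (rk_le t' T'_le) (rk_le p' P_le)).
  by case=> h h'; split; [exact: rk_inj h|exact: rk_inj h'].
apply: phased_cat => //.
  by apply: phased_map; rewrite ?enum_uniq //; [exact: (fm _ _ 3 0)|move=> t; rewrite phase_st].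
rewrite -[X in phased _ _ X]/([:: rl _ _ _ _ _ _] ++ [:: rl _ _ _ _ _ _]).
by apply: phased_cat => //; apply: phased1; rewrite phase_st.
Qed.

Lemma ev_of_inj : injective (@ev_of P).
Proof.
move=> r r' [ek /ffunP et].
have h k : ev_theta r k = ev_theta r' k by have := et k; rewrite !ffunE.
have th (Q : finType) (a b a' b' : vec Q) : theta a b = theta a' b' -> a = a' /\ b = b'.
  by move=> /ffunP e; split; apply/ffunP => q;
    [have := e (Some (inl q))|have := e (Some (inr q))]; rewrite !ffunE.
have [e1 e2] := th _ _ _ _ _ (h (Some false)); have [e3 e4] := th _ _ _ _ _ (h (Some true)).
move: ek e1 e2 e3 e4; case: (r) (r') => [[k [s s']] [x y]] [[k' [t t']] [x' y']].
by rewrite /r_kind /r_from /r_to /r_take /r_give /= => -> -> -> -> ->.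
Qed.

Lemma c_events : c_fset (@c_event (sim_eos (rules n occ1 occ2)))
  (events (sim_eos (rules n occ1 occ2))) (Lst [seq d_ev r | r <- rules n occ1 occ2]).
Proof.
set L := rules n occ1 occ2; exists [seq ev_of r | r <- L].
  have u : uniq [seq ev_of r | r <- L] by rewrite map_inj_uniq; [exact: uniq_rules|exact: ev_of_inj].
  by rewrite perm_sym -[X in perm_eq _ X](undup_id u) seq_fset_perm.
exists [seq d_ev r | r <- L] => //; move: (L) => s.
by elim: s => [|r s IH] /=; constructor; first exact/c_eventP.
Qed.

End EventsDistinct.

Lemma c_tableP (T U : finType) (f : T -> U -> nat) d : c_fun (fun=> c_fun (fun=> c_nat)) f d <->
  d = Lst [seq Lst [seq Num (f t u) | u <- enum U] | t <- enum T].
Proof.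
apply: (c_funP (gB := fun t (g : U -> nat) => Lst [seq Num (g u) | u <- enum U])) => t g e.
exact: (c_funP (gB := fun _ => Num)).
Qed.

Lemma c_cnet (Q : finType) : c_PN (cnet Q) (d_cnet #|Q|).
Proof.
exists (Lst [seq Lst [seq Num (@arc_in (cnet Q) p t) | t <- enum (trans (cnet Q))] | p <- enum Q]).
exists (Lst [seq Lst [seq Num (@arc_out (cnet Q) t p) | p <- enum Q] | t <- enum (trans (cnet Q))]).
split; [exact/c_tableP|exact/c_tableP|].
rewrite /d_cnet !map_iota_rk; congr Lst; congr [:: _; _; _; _].
- by rewrite /c_card /= card_option card_sum addnn.
- congr Lst; apply: eq_map => q; rewrite map_enum_cnet !map_iota_rk.
  by congr (Lst (_ :: _ ++ _)); apply: eq_map => p; rewrite (inj_eq (@rk_inj Q)).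
rewrite map_enum_cnet; congr (Lst (_ :: _ ++ _)); apply: eq_map => q.
by rewrite map_iota_rk; congr Lst; apply: eq_map => p; rewrite (inj_eq (@rk_inj Q)) eq_sym.
Qed.

Lemma c_sysnet : c_PN sysnet d_sysnet.
Proof.
rewrite /d_sysnet; eexists; eexists; split; last by []; exact/c_tableP.
Qed.

(** * The printed word encodes the simulating instance *)

Section Correct.
Variables (N : rnuPN) (init target : config (r_place N)) (w : word).
Hypothesis input : input_spec init target w.
Notation P := (r_place N).
Notation n := (size w).
Notation occ1 := (@occ1 N w).
Notation occ2 := (@occ2 N w).
Notation L := (rules n occ1 occ2).
Notation E := (sim_eos L).
Notation load X := (load n occ1 occ2 X).

Definition d_events : data := Lst [seq d_ev r | r <- L].

Definition d_eos : data :=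
  Lst [:: d_sysnet; Lst [:: d_cnet #|P|; d_cnet 6]; d_typing; d_idle; d_events].

Lemma c_sim_eos : c_EOS E d_eos.
Proof.
exists d_sysnet, (Lst [:: d_cnet #|P|; d_cnet 6]), d_typing, d_idle, d_events.
split=> //; [exact: c_sysnet| | |split].
- exists (fun k : bool => if k then d_cnet #|P| else d_cnet 6); last by rewrite enum_boolE.
  by case; [exact: c_cnet|rewrite -[X in d_cnet X](card_ord 6); exact: c_cnet].
- by exists (fun p => Num (rk (styping p))).
- by exists (fun p => Num (rk (sidle p))).
apply: c_events; [exact: net_at_le (is_net input)|exact: net_at_le (is_net' input)|
  exact: is_place_le input].
Qed.

Definition d_token (p : splace) (v : data) : data := Lst [:: Num (rk (p : place sysnet)); v].

Definition d_load (X : config P) (s : seq (vec P)) : data :=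
  Lst (Lst [:: d_token None (dvec (idle_st n)); Num 1] ::
    [seq Lst [:: d_token (Some s_sim) (dvec m); Num (X m)] | m <- s]).

Lemma c_load (X : config P) s : perm_eq s (finsupp X) ->
  c_mset (@c_nested E) (load X) (d_load X s).
Proof.
move=> hs; pose gA (x : nested E) := d_token (tag x) (dvec (tagged x)).
have hg x d : c_nested x d <-> d = gA x.
  split=> [[dm /c_vecP -> ->]//|->]; exists (dvec (tagged x)) => //; exact/c_vecP.
apply/(c_msetP _ _ hg); exists (ctl L (idle_st n) :: [seq tok L s_sim m | m <- s]).
  have us : uniq s by rewrite (perm_uniq hs) fset_uniq.
  apply: uniq_perm; rewrite ?fset_uniq //=.
    rewrite map_inj_uniq ?us ?andbT; last by move=> m m' /eqP; rewrite tok_inj => /eqP.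
    by apply/mapP => -[m _ /(congr1 tag)].
  move=> x; rewrite mem_finsupp inE; have [[s' ->]|[q [m ->]]] := nestedP x.
    rewrite mk_ctl ctl_inj eq_sym; case: eqP => //= _.
    by apply/mapP => -[m _ /(congr1 tag)].
  rewrite mk_tok (_ : (tok L q m == _) = false) /=; last by apply/eqP => /(congr1 tag).
  have [->|nq] := eqVneq q s_sim.
    rewrite mem_map; last by move=> m1 m2 /eqP; rewrite tok_inj => /eqP.
    by rewrite (perm_mem hs) mem_finsupp.
  have -> : stor [:: X] q m = 0 by case: q nq => -[|[|q]] //= lq _; rewrite /stor nth_default // mset0E.
  by apply/mapP => -[m' _ /eqP]; rewrite tok_neq.
rewrite /= /d_load /gA mk_ctl eqxx -map_comp; congr (Lst (_ :: _)); apply: eq_map => m /=.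
by rewrite mk_tok.
Qed.

(** The printed marking keeps the order in which the input lists the configuration; as that order is
    arbitrary, [s] is existential. *)
Lemma marking_strE k X : mset_at (@dvec _) w (kid k w 0) X ->
  exists2 s, perm_eq s (finsupp X) & marking_str k w = serialize (d_load X s).
Proof.
case=> s hs h; exists s => //.
have s2 d d' : serialize d ++ serialize d' = sers [:: d; d'] by rewrite /sers /= cats0.
have e0 : par (par (serialize d_ctl ++ par (st_str 0 w 0 0)) ++ serialize (Num 1)) =
    serialize (Lst [:: d_token None (dvec (idle_st n)); Num 1]).
  by rewrite st_strE !par_sers s2 par_sers s2 par_sers.
have sc d l : sers (d :: l) = serialize d ++ sers l by [].
rewrite /marking_str e0 (arityP h) size_map -[RHS]par_sers sc; congr (par (_ ++ _)).
rewrite sers_map -(map_nth_iota_size (vec0 P)); congr flatten.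
apply/eq_in_map => e; rewrite mem_iota add0n => /andP[_ le].
have le' : e < size [seq Lst [:: dvec x; Num (X x)] | x <- s] by rewrite size_map.
have := childP h le'; rewrite (nth_map (vec0 P)) // => he.
rewrite /entry_str (copyP (kidP he (isT : 0 < 2))) (copyP (kidP he (isT : 1 < 2))).
by rewrite s2 par_sers s2 par_sers.
Qed.

Lemma cnet_strE : cnet_str w = serialize (d_cnet #|P|).
Proof.
have un q : unit_str w q = sers [seq Num (p == q) | p <- iota 0 #|P|].
  rewrite sers_map /unit_str (is_place input); congr flatten.
  by apply: eq_map => p; case: eqP.
have ze : zero_str w = sers [seq Num 0 | _ <- iota 0 #|P|].
  by rewrite sers_map /zero_str (is_place input).
have s1 d : serialize d = sers [:: d] by rewrite /sers /= cats0.
have sep0 l : sep ++ sers l = sers (Num 0 :: l) by [].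
have bit m : [:: Bit true] ++ serialize (Num m) = serialize (Num m.*2.+1).
  by rewrite -[serialize _]/(rcons (bits m) _) -[RHS]/(rcons (bits _) _) bits_double1.
have fl (f : nat -> word) (g : nat -> data) : (forall q, f q = serialize (g q)) ->
    flatten [seq f q | q <- iota 0 #|P|] = sers [seq g q | q <- iota 0 #|P|].
  by move=> h; rewrite sers_map; congr flatten; apply: eq_map.
rewrite /cnet_str (copyP (is_place_at input)) bit (is_place input).
rewrite (fl _ (fun q => Lst (Num 0 :: [seq Num (p == q) | p <- iota 0 #|P|] ++
  [seq Num 0 | _ <- iota 0 #|P|]))) => [|q]; last by rewrite un ze -sers_cat sep0 par_sers.
rewrite (fl _ (fun q => Lst [seq Num 0 | _ <- iota 0 #|P|])) => [|q]; last by rewrite ze par_sers.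
rewrite (fl _ (fun q => Lst [seq Num (p == q) | p <- iota 0 #|P|])) => [|q]; last by rewrite un par_sers.
rewrite ze !par_sers -!sers_cat ![in LHS]s1 -!sers_cat par_sers ![in LHS]s1 -!sers_cat par_sers.
by [].
Qed.

Lemma outE s0 s1 : marking_str 1 w = serialize (d_load init s0) ->
  marking_str 2 w = serialize (d_load target s1) ->
  out w = serialize (Lst [:: d_eos; d_load init s0; d_load target s1]).
Proof.
move=> e0 e1; rewrite /out cnet_strE (events_strE input) e0 e1.
have s2 a b : serialize a ++ serialize b = sers [:: a; b] by rewrite /sers /= cats0.
have s3 a b c : serialize a ++ serialize b ++ serialize c = sers [:: a; b; c].
  by rewrite /sers /= cats0.
have s5 a b c d e : serialize a ++ serialize b ++ serialize c ++ serialize d ++ serialize e =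
    sers [:: a; b; c; d; e] by rewrite /sers /= cats0.
by rewrite (s2 (d_cnet #|P|)) !par_sers s5 par_sers s3 par_sers.
Qed.

Lemma out_correct : exists y, encodes (A := cEOS_coverability) y (out w) /\
  (rnuPN_coverable (RnuPNInstance init target) <-> cEOS_coverable y).
Proof.
exists (CEOSInstance (@sim_conservative P L) (load init) (load target)).
split; last first.
  apply: sim_coverable.
  - by move=> t; exact: occ_lists (is_net input) (is_place input) t.
  - by move=> t; exact: occ_lists (is_net' input) (is_place input) t.
  - exact: net_at_le (is_net input).
  - exact: net_at_le (is_net' input).
  exact: is_place_le input.
have [s0 h0 e0] := marking_strE (is_init input); have [s1 h1 e1] := marking_strE (is_target input).
exists (Lst [:: d_eos; d_load init s0; d_load target s1]); last exact: outE.
exists d_eos, (d_load init s0), (d_load target s1); split=> //.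
- exact: c_sim_eos.
- exact: c_load.
- exact: c_load.
Qed.

End Correct.

Theorem theorem2 : poly_time_reduces rnuPN_coverability cEOS_coverability.
Proof.
have [M [k hM]] := Emits_machine Out0_out.
(* The exponent belongs to the one program printing [out], so a single polynomial serves all
   instances. *)
exists M, (('X + 2%:P) ^+ k)%R => -[N init target] w [d hd ->].
have input := input_specP hd.
have [y [hy hiff]] := out_correct input.
exists (out (serialize d)), y; split=> //.
have -> : (('X + 2%:P) ^+ k : {poly nat})%R.[size (serialize d)]%R = (size (serialize d) + 2) ^ k.
  by rewrite horner_exp hornerD hornerX hornerC.
exact: hM.
Qed.
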